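(* Let $D\subset\mathbb{C}$ be a bounded domain with real analytic boundary and fix $w\in D$. Let $g_w=g(\cdot,w)$ be the Green function of the Laplacian on $D$ with pole $w$, let $T$ be integration against $g$, i.e. $T\phi(z)=\int_D \phi(\xi)g(z,\xi)\,dA(\xi)$, and, for a constant $a$, let $g^*_w$ be the Green function with pole $w$ of the Helmholtz operator $\Delta-a$ on $D$. Then $$g^*_w-g_w = a\,Tg_w+o(a)\qquad\text{as } a\to 0,$$ where the convergence of the $o(a)$ term is uniform in $z$ for each fixed $w$; that is, $\sup_{z\in D\setminus\{w\}}\frac{1}{|a|}\left|g^*_w(z)-g_w(z)-a\,Tg_w(z)\right|\to 0$ as $a\to 0$. Furthermore, for all constants $a$ with $|a|$ sufficiently small, a full series expansion is given by $$g^*_w=\sum_{n=0}^\infty a^n T^n g_w,$$ with convergence in $L^2(D)$.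
   Context: Here $dA$ is area (Lebesgue) measure on $\mathbb{C}=\mathbb{R}^2$ and $\Delta=\partial_x^2+\partial_y^2$; $a$ is a real constant. The Green function $g:D\times D\to[-\infty,\infty)$ of $D$ is the function such that for each $w\in D$: $g(\cdot,w)$ is harmonic on $D\setminus\{w\}$ and bounded outside every neighborhood of $w$; $g(w,w)=-\infty$ and $g(z,w)=\frac{1}{2\pi}\log|z-w|+O(1)$ as $z\to w$; and $g(z,w)\to 0$ as $z\to\zeta$ for every $\zeta\in\partial D$. Equivalently, $g_w=g(\cdot,w)$ solves $\Delta g_w=\delta_w$ in $D$ (in the sense of distributions) with $g_w=0$ on $\partial D$. Note the sign convention: $g\le 0$. For a differential operator $L$, the Green function $g^*$ of $L$ on $D$ is defined analogously: $g^*_w=g^*(\cdot,w)$ solves $Lg^*_w=\delta_w$ in $D$ in the sense of distributions, with $g^*_w=0$ on $\partial D$. In this statement $L=\Delta-a$, i.e. $\Delta g^*_w-a g^*_w=\delta_w$ (and $g^*$ depends on $a$). $T^n$ is the $n$-fold iterate of $T$, with $T^0$ the identity. *)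

(* Defs.v *)
From HB Require Import structures.
From mathcomp Require Import all_boot all_order all_algebra.
From mathcomp Require Import all_classical all_reals all_analysis.
From mathcomp Require Import measurable_realfun.
Set Implicit Arguments.
Unset Strict Implicit.
Unset Printing Implicit Defensive.
Import Order.TTheory GRing.Theory Num.Theory numFieldNormedType.Exports.
Local Open Scope classical_set_scope.
Local Open Scope ring_scope.

(* C is identified with R * R, whose library norm is the sup norm; hence the
   separate Euclidean modulus. *)

Section plane_calculus.
Context {R : realType}.
Implicit Types (D U : set (R * R)) (f phi : R * R -> R) (w z p : R * R).

Definition modulus z : R := Num.sqrt (z.1 ^+ 2 + z.2 ^+ 2).

Definition dx f : R * R -> R := 'D_(1, 0) f.
Definition dy f : R * R -> R := 'D_(0, 1) f.

Definition laplacian f z : R := dx (dx f) z + dy (dy f) z.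

Fixpoint partials (s : seq bool) f : R * R -> R :=
  if s is b :: s' then (if b then dx else dy) (partials s' f) else f.

Definition smooth f := forall s z, differentiable (partials s f) z.

Definition C2_on U f :=
  (forall s z, (size s <= 1)%N -> U z -> differentiable (partials s f) z) /\
  (forall s z, size s = 2%N -> U z -> {for z, continuous (partials s f)}).

Definition harmonic_on U f :=
  C2_on U f /\ (forall z, U z -> laplacian f z = 0).

Definition test_function D phi :=
  smooth phi /\
  exists K : set (R * R),
    [/\ compact K, K `<=` D & forall z, ~ K z -> phi z = 0].

Definition bounded_domain D :=
  [/\ D !=set0, open D, connected D & bounded_set D].

Definition frontier D : set (R * R) := closure D `\` D°.

Definition real_analytic_at (h : R -> R) (t0 : R) :=
  exists (c : nat -> R) (r : R), 0 < r /\
    forall t, `|t| < r -> pseries c t @ \oo --> h (t0 + t).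

(* Near each boundary point p, in an orthonormal frame (c, s), (- s, c) centered
   at p, the domain is the part of a disc above the graph of a real analytic
   function. *)
Definition real_analytic_boundary D :=
  forall p, frontier D p ->
  exists (c s r : R) (h : R -> R),
    [/\ c ^+ 2 + s ^+ 2 = 1, 0 < r,
        forall t, `|t| < r -> real_analytic_at h t
      & forall z, modulus (z - p) < r ->
          D z <-> h (c * (z.1 - p.1) + s * (z.2 - p.2)) <
                  - s * (z.1 - p.1) + c * (z.2 - p.2)].

End plane_calculus.

Section green.
Context {R : realType}.
Implicit Types (D : set (R * R)) (w z : R * R) (u phi : R * R -> \bar R)
  (g : R * R -> R * R -> \bar R).

Definition area : {measure set (measurableTypeR R * measurableTypeR R) -> \bar R}
  := (lebesgue_measure \x lebesgue_measure)%E.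

Definition vanishes_on_boundary D u :=
  forall zeta, frontier D zeta -> u z @[z --> within D (nbhs zeta)] --> 0%E.

Definition laplace_green_at D w u :=
  [/\ (forall z, (D `\ w) z -> u z \is a fin_num) /\
      harmonic_on (D `\ w) (fine \o u),
      forall U, nbhs w U ->
        exists M : R, forall z, (D `\` U) z -> (`|u z| <= M%:E)%E,
      u w = -oo%E,
      exists C : R, \forall z \near w^',
        `|fine (u z) - (2 * pi)^-1 * ln (modulus (z - w))| <= C
    & vanishes_on_boundary D u].

(* [g z w] is the value at z of the Green function with pole w. *)
Definition laplace_green D g := forall w, D w -> laplace_green_at D w (g^~ w).

Definition locally_integrable_on D u :=
  forall K : set (R * R), compact K -> K `<=` D -> area.-integrable K u.

(* Delta u - a u = delta_w in the sense of distributions on D; the operator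
   Delta - a is its own formal adjoint. *)
Definition helmholtz_eq_dirac D (a : R) w u :=
  locally_integrable_on D u /\
  forall phi : R * R -> R, test_function D phi ->
    (\int[area]_(z in D) (u z * (laplacian phi z - a * phi z)%:E) =
     (phi w)%:E)%E.

(* The distributional equation only determines u almost everywhere; the second
   and third clauses select the representative that is finite and continuous
   off the pole and equal to -oo at it. *)
Definition helmholtz_green_at D (a : R) w u :=
  [/\ helmholtz_eq_dirac D a w u,
      forall z, (D `\ w) z -> u z \is a fin_num /\ {for z, continuous u},
      u w = -oo%E
    & vanishes_on_boundary D u].

Definition green_op D g phi : R * R -> \bar R :=
  fun z => (\int[area]_(xi in D) (phi xi * g z xi))%E.

Definition in_L2 D u :=
  measurable_fun (D : set (measurableTypeR R * measurableTypeR R)) u /\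
  ('N[area]_2%:E [u \_ D] < +oo)%E.

Definition L2_series_sum D (f : nat -> R * R -> \bar R) u :=
  [/\ in_L2 D u, forall n, in_L2 D (f n) &
      ('N[area]_2%:E [(fun z => u z - \sum_(0 <= n < N) f n z) \_ D])%E
        @[N --> \oo] --> 0%E].

End green.

(* Main.v *)
Require Import Defs.
From HB Require Import structures.
From mathcomp Require Import all_boot all_order all_algebra.
From mathcomp Require Import all_classical all_reals all_analysis.
From mathcomp Require Import measurable_realfun.
From mathcomp Require Import ring lra.
Set Implicit Arguments.
Unset Strict Implicit.
Unset Printing Implicit Defensive.
Import Order.TTheory GRing.Theory Num.Theory numFieldNormedType.Exports.
Local Open Scope classical_set_scope.
Local Open Scope ring_scope.

(** Let G be the Green function of the Laplacian extended by zero to the plane, T the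
    integration against G, and h the Helmholtz Green function with pole w, extended by
    zero. In the weak sense T inverts the Laplacian, so h - G(., w) - a T h is weakly
    harmonic in D; it is continuous away from w and vanishes outside D. Weyl's lemma and
    the maximum principle ([weakly_harmonic_eq0]) show that such a function is zero. This
    is the resolvent equation h = G(., w) + a T h ([resolvent_equation]), and the
    expansion is its Neumann series.

    Two integral bounds control the series: the integral of |G(z, .)| is at most C1, and
    that of G(z, .)^2 at most C2, uniformly in z ([green_kernel_integrals]). By the second
    one T o T has a bounded kernel, so the correction b = a T h is bounded. It satisfies
    b = a T G_w + a T b. As soon as |a| C1 <= 1/2 this improves any bound on b until
    |b| <= 2 |a| C2 ([correction_bound]). The first-order error is then a T b = O(a^2)
    ([first_order_bound]), uniformly in z. Each further term of the series multiplies the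
    supremum of the remainder by at most |a| C1 <= 1/2 ([neumann_rest_bound]), and on a
    bounded domain the supremum controls the norm of L2.

    The properties of G come from the conditions that define it. Harmonicity is used
    through second differences: [lap_ge f z c] bounds the Laplacian of f from below
    without mentioning derivatives. It survives truncation from below, it gives the
    maximum principle at once, and it passes to integrals against test functions because
    second differences can be moved from one factor to the other ([weak_laplacian_ge]).
    Comparison with the logarithm yields G <= 0, the domination of G^2 by a multiple of
    1 / |z - xi|, and the continuous dependence on the pole that makes G jointly
    measurable. That the logarithm is a fundamental solution is seen on the
    regularisations log (|z|^2 + e^2), whose Laplacians are an approximate identity
    ([log_kernel_fundamental]); [weak_removable] carries this over to G
    ([green_kernel_weak]).

    The norm of R * R is the sup norm, so that balls are squares. The test functions are
    products of two smooth one-variable cutoffs ([bump]), adapted to these squares. *)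

(** * Open sets of the plane are measurable *)

Section countable_bases.

(** The measurable sets of the plane are generated by rectangles; the open sets are among
    them because a countable base is. *)
Definition countable_base_in (T : topologicalType) (M : set (set T)) :=
  exists2 F : nat -> set T, (forall n, M (F n)) &
    forall O x, open O -> O x -> exists n, F n x /\ F n `<=` O.

Lemma countable_base_prod (T U : topologicalType) (M : set (set T))
    (N : set (set U)) (MN : set (set (T * U))) :
  (forall A B, M A -> N B -> MN (A `*` B)) ->
  countable_base_in M -> countable_base_in N -> countable_base_in MN.
Proof.
move=> HX [F MF FO] [G NG GO].
have [f fK] : exists f : nat -> nat * nat, forall p, exists n, f n = p.
  exists (fun n => odflt (0%N, 0%N) (unpickle n)) => p.
  by exists (pickle p); rewrite pickleK.
exists (fun n => F (f n).1 `*` G (f n).2); first by move=> n; exact: HX.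
move=> O [x y] oO Oxy.
have /nbhs_interior : nbhs (x, y) O by exact: open_nbhs_nbhs.
case=> -[A B] /= [Ax By] ABO.
have [i [Fix FiA]] := FO _ x (open_interior A) Ax.
have [j [Gjy GjB]] := GO _ y (open_interior B) By.
have [n fn] := fK (i, j); exists n; rewrite fn; split => // -[a b] [/= Fa Gb].
by apply: (interior_subset (A := O)); apply: ABO; split => /=;
  apply: interior_subset; [exact: FiA|exact: GjB].
Qed.

Lemma countable_base_R (R : realType) :
  countable_base_in (@measurable _ (measurableTypeR R) : set (set R)).
Proof.
exists (fun n => let p := odflt (0, 0) (unpickle n : option (rat * rat)) in
   `](ratr p.1 : R), ratr p.2[%classic).
  by move=> n /=; exact: measurable_itv.
move=> O x oO Ox.
have /nbhs_ballP[e /= e0 eO] : nbhs x O by exact: open_nbhs_nbhs.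
have /rat_in_itvoo[p] : x - e < x by lra.
rewrite in_itv /= => /andP[p1 p2].
have /rat_in_itvoo[q] : x < x + e by lra.
rewrite in_itv /= => /andP[q1 q2].
exists (pickle (p, q)); rewrite pickleK /=; split.
  by rewrite /= in_itv /= p2 q1.
move=> y /=; rewrite in_itv /= => /andP[py yq]; apply: eO => /=.
rewrite -ball_normE /ball_ /= ltr_norml; apply/andP; split; lra.
Qed.

End countable_bases.

Section plane_integral.
Context {R : realType}.
Local Notation pl := (measurableTypeR R * measurableTypeR R)%type.

Lemma countable_base_plane :
  countable_base_in (@measurable _ pl : set (set (R * R))).
Proof.
apply: countable_base_prod (countable_base_R R) (countable_base_R R).
by move=> A B; exact: measurableX.
Qed.

Lemma countable_base_plane2 :
  countable_base_in (@measurable _ (pl * pl)%type : set (set ((R * R) * (R * R)))).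
Proof.
apply: countable_base_prod countable_base_plane countable_base_plane.
by move=> A B; exact: measurableX.
Qed.

Lemma countable_base_open (T : topologicalType) d (T' : measurableType d)
   (phi : T' -> T) (O : set T) :
  countable_base_in (fun A : set T => measurable (phi @^-1` A)) -> open O ->
  measurable (phi @^-1` O).
Proof.
move=> [F MF FO] oO.
have -> : phi @^-1` O =
    \bigcup_(n in [set n | F n `<=` O]) (phi @^-1` F n).
  apply/seteqP; split=> [x /= Ox|x [n /= FnO Fnx]]; last exact: FnO.
  by have [n [? ?]] := FO _ _ oO Ox; exists n.
exact: bigcup_measurable.
Qed.

Lemma open_plane (O : set (R * R)) : open O -> measurable (O : set pl).
Proof. exact: (@countable_base_open _ _ pl id O countable_base_plane). Qed.

Lemma open_plane2 (O : set ((R * R) * (R * R))) :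
  open O -> measurable (O : set (pl * pl)%type).
Proof. exact: (@countable_base_open _ _ (pl * pl)%type id O countable_base_plane2). Qed.

Lemma measurable_continuous_on (T : topologicalType) d (T' : measurableType d)
   (phi : T' -> T) (O : set T) (f : T -> R) :
  (forall A : set T, open A -> measurable (phi @^-1` A)) ->
  open O -> (forall x, O x -> {for x, continuous f}) ->
  (forall x, ~ O x -> f x = 0) ->
  measurable_fun [set: T'] (f \o phi).
Proof.
move=> Hop oO cf f0.
apply: (measurability (@RGenOInfty.G R)); first exact: RGenOInfty.measurableE.
move=> _ [_ [a ->] <-]; rewrite setTI.
pose W := O `&` [set x | a < f x].
have oW : open W.
  rewrite openE => x [Ox afx]; apply: filterI.
    by apply: open_nbhs_nbhs.
  by apply: (cf x Ox [set y | a < y]); apply: open_nbhs_nbhs; split => //; exact: open_gt.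
have -> : (f \o phi) @^-1` `]a, +oo[ =
   phi @^-1` W `|` (~` (phi @^-1` O) `&` [set _ | a < 0]).
  apply/seteqP; split => x /=; rewrite in_itv /= andbT.
    move=> afx; have [Ox|nOx] := pselect (O (phi x)); first by left.
    by right; rewrite -(f0 _ nOx).
  by move=> [[]//|[nO a0]]; rewrite f0.
apply: measurableU; first exact: Hop.
apply: measurableI; first by apply: measurableC; exact: Hop.
have [a0|a0] := boolP (a < 0).
- by rewrite (_ : [set _ | _] = setT)//; apply/seteqP; split.
- by rewrite (_ : [set _ | _] = set0)//; apply/seteqP; split => // x /=.
Qed.

End plane_integral.

(** * Integration on the plane *)

Section plane_measure.
Context {R : realType}.
Local Notation pl := (measurableTypeR R * measurableTypeR R)%type.
Local Notation P := (R * R)%type.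

(** A copy of [area] that carries its sigma-finiteness, as Fubini requires. *)
Definition plane_area : set pl -> \bar R := area.

HB.instance Definition _ := Measure.on plane_area.

Lemma plane_area_box (a b c d : R) : a <= b -> c <= d ->
  plane_area (`[a, b]%classic `*` `[c, d]%classic) = ((b - a) * (d - c))%:E.
Proof.
move=> ab cd.
rewrite [plane_area _](@product_measure1E _ _ _ _ R lebesgue_measure lebesgue_measure); try exact: measurable_itv.
have E (x y : R) : x <= y -> @lebesgue_measure R `[x, y]%classic = (y - x)%:E.
  rewrite lebesgue_measure_itv/= lte_fin.
  by rewrite le_eqVlt => /predU1P[->|->]; rewrite ?ltxx ?subrr// EFinB.
by rewrite [X in (X * _)%E](E _ _ ab) [X in (_ * X)%E](E _ _ cd) EFinM.
Qed.

Lemma plane_area_sigma_finite : sigma_finite setT plane_area.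
Proof.
exists (fun n => `[- n%:R, n%:R]%classic `*` `[- n%:R, n%:R]%classic).
  apply/seteqP; split => // -[x y] _.
  have [n Hn] : exists n : nat, `|x| <= n%:R /\ `|y| <= n%:R.
    exists (maxn (Num.truncn `|x|).+1 (Num.truncn `|y|).+1); split;
    rewrite (le_trans (ltW (truncnS_gt _)))// ler_nat leq_max leqnn ?orbT//.
  by exists n => //=; split; rewrite /= in_itv/= -ler_norml; apply Hn.
move=> n; split; first by apply: measurableX; exact: measurable_itv.
have n0 : - n%:R <= n%:R :> R by rewrite ge0_cp.
by rewrite plane_area_box// ltry.
Qed.

HB.instance Definition _ :=
  @Measure_isSigmaFinite.Build _ _ _ plane_area plane_area_sigma_finite.

Definition mfun (f : P -> R) := measurable_fun [set: pl] (f : pl -> R).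
Definition L1 (f : P -> R) := plane_area.-integrable [set: pl] (EFin \o f).
Definition pint (f : P -> R) : R := Rintegral plane_area [set: pl] f.

Lemma L1_mfun f : L1 f -> mfun f.
Proof. by move=> /measurable_int /measurable_EFinP. Qed.

Lemma L1D f g : L1 f -> L1 g -> L1 (fun z => f z + g z).
Proof. by move=> Lf Lg; exact: (integrableD measurableT Lf Lg). Qed.

Lemma L1B f g : L1 f -> L1 g -> L1 (fun z => f z - g z).
Proof. by move=> Lf Lg; exact: (integrableB measurableT Lf Lg). Qed.

Lemma L1Z c f : L1 f -> L1 (fun z => c * f z).
Proof. by move=> Lf; exact: (integrableZl measurableT c Lf). Qed.

Lemma L1_le f g : mfun f -> L1 g -> (forall z, `|f z| <= g z) -> L1 f.
Proof.
move=> mf Lg fg; apply: (le_integrable measurableT _ _ Lg).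
  exact/measurable_EFinP.
by move=> z _ /=; rewrite lee_fin (le_trans (fg z))// ler_norm.
Qed.

Lemma L1_norm f : L1 f -> L1 (fun z => `|f z|).
Proof. by move=> Lf; exact: (integrable_norm Lf). Qed.

Lemma L1_0 : L1 (fun=> 0).
Proof. exact: integrable0. Qed.

Lemma pintE f : L1 f -> (\int[plane_area]_z (f z)%:E)%E = (pint f)%:E.
Proof. by move=> Lf; rewrite /pint /Rintegral fineK//; exact: integrable_fin_num. Qed.

Lemma pintD f g : L1 f -> L1 g -> pint (fun z => f z + g z) = pint f + pint g.
Proof. by move=> Lf Lg; rewrite /pint RintegralD. Qed.

Lemma pintB f g : L1 f -> L1 g -> pint (fun z => f z - g z) = pint f - pint g.
Proof. by move=> Lf Lg; rewrite /pint RintegralB. Qed.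

Lemma pintZ c f : L1 f -> pint (fun z => c * f z) = c * pint f.
Proof. by move=> Lf; rewrite /pint RintegralZl. Qed.

Lemma pint_le f g : L1 f -> L1 g -> (forall z, f z <= g z) -> pint f <= pint g.
Proof. by move=> Lf Lg fg; rewrite /pint le_Rintegral. Qed.

Lemma pint_ge0 f : (forall z, 0 <= f z) -> 0 <= pint f.
Proof. by move=> f0; exact: Rintegral_ge0. Qed.

Lemma pint_norm f : L1 f -> `|pint f| <= pint (fun z => `|f z|).
Proof. by move=> Lf; exact: le_normr_Rintegral. Qed.

Lemma pint_norm_le f g : mfun f -> L1 g -> (forall z, `|f z| <= g z) ->
  `|pint f| <= pint g.
Proof.
move=> mf Lg fg; have Lf := L1_le mf Lg fg.
by rewrite (le_trans (pint_norm Lf))// pint_le//; exact: L1_norm.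
Qed.

Lemma pint0 : pint (fun=> 0) = 0.
Proof. by rewrite /pint /Rintegral integral0. Qed.

Lemma set1_box (x y : R) :
  [set (x, y)] = `[x, x]%classic `*` `[y, y]%classic :> set pl.
Proof.
apply/seteqP; split=> [_ ->|[a b]] /=; rewrite !in_itv/= ?lexx//.
by rewrite -!eq_le => -[/eqP -> /eqP ->].
Qed.

Lemma plane_area_point (w : P) : plane_area [set w] = 0%E.
Proof.
case: w => x y.
rewrite set1_box.
by rewrite plane_area_box// !subrr mul0r.
Qed.

Lemma measurable_point (w : P) : measurable ([set w] : set pl).
Proof.
case: w => x y.
rewrite set1_box.
by apply: measurableX; exact: measurable_itv.
Qed.

Lemma ae_off_point (w : P) (Q : P -> Prop) : (forall z, z <> w -> Q z) ->
  {ae plane_area, forall z, Q z}.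
Proof.
move=> HQ; exists [set w]; split; first exact: measurable_point.
  exact: plane_area_point.
by move=> z /= nQ; apply: contrapT => zw; apply: nQ; exact: HQ.
Qed.

Lemma mfun_off_point (w : P) f g : mfun f -> (forall z, z <> w -> f z = g z) ->
  mfun g.
Proof.
move=> mf fg.
have -> : g = fun z => if z == w then g w else f z.
  by apply/funext => z; case: eqP => [->//|/fg].
apply: measurable_fun_if => //.
- apply: (measurable_fun_bool true).
  rewrite setTI (_ : _ @^-1` _ = [set w]); first exact: measurable_point.
  by apply/seteqP; split => z /= => [/eqP//|->]; rewrite eqxx.
- exact: measurable_funS mf.
Qed.

Lemma pint_off_point (w : P) f g : mfun f -> (forall z, z <> w -> f z = g z) ->
  pint f = pint g.
Proof.
move=> mf fg; rewrite /pint /Rintegral; congr fine.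
apply: ae_eq_integral => //.
- exact/measurable_EFinP.
- apply/measurable_EFinP; exact: (mfun_off_point mf fg).
- have := @ae_off_point w (fun z => [set: pl] z -> (f z)%:E = (g z)%:E).
  by apply => z zw _; rewrite fg.
Qed.

Lemma L1_off_point (w : P) f g : L1 f -> (forall z, z <> w -> f z = g z) -> L1 g.
Proof.
move=> Lf fg; have mg := mfun_off_point (L1_mfun Lf) fg.
apply/integrableP; split; first exact/measurable_EFinP.
move/integrableP: Lf => [mf]; congr (_ < _)%E; apply: ae_eq_integral => //.
- by apply: measurableT_comp.
- by apply: measurableT_comp => //; exact/measurable_EFinP.
- have := @ae_off_point w
    (fun z => [set: pl] z -> `|(f z)%:E|%E = `|(g z)%:E|%E).
  by apply => z zw _; rewrite fg.
Qed.

Lemma L1_le_off (w : P) f g : mfun f -> L1 g ->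
  (forall z, z <> w -> `|f z| <= g z) -> L1 f.
Proof.
move=> mf Lg fg; pose f' z := if z == w then 0 else f z.
have ff' z : z <> w -> f z = f' z by move=> /eqP zw; rewrite /f' (negbTE zw).
have Lf' : L1 f'.
  apply: L1_le (mfun_off_point mf ff') (L1_norm Lg) _ => z; rewrite /f'.
  case: eqP => [_|zw]; first by rewrite normr0.
  by rewrite (le_trans (fg z zw))// ler_norm.
by apply: (@L1_off_point w f' f Lf') => z zw; rewrite ff'.
Qed.

(** The exceptional point [w] allows for a pole, where no domination can hold. *)
Lemma pint_dominated (w : P) (f_ : nat -> P -> R) f g :
  (forall n, mfun (f_ n)) -> mfun f -> L1 g ->
  (forall n z, z <> w -> `|f_ n z| <= g z) ->
  (forall z, z <> w -> f_ ^~ z @ \oo --> f z) ->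
  (fun n => pint (f_ n)) @ \oo --> pint f.
Proof.
move=> mf_ mf Lg fg ff.
have aef : {ae plane_area, forall z, [set: pl] z ->
    (EFin \o f_ n) z @[n --> \oo] --> (EFin \o f) z}.
  apply: (ae_off_point (w := w)) => z zw _.
  by apply: cvg_EFin; [exact: nearW|exact: ff].
have aeg : {ae plane_area, forall z n, [set: pl] z ->
    (`|(EFin \o f_ n) z| <= (EFin \o g) z)%E}.
  by apply: (ae_off_point (w := w)) => z zw n _; rewrite /= lee_fin fg.
have [Lf _ H] := @dominated_convergence _ _ _ plane_area setT measurableT
  (fun n => EFin \o f_ n) (EFin \o f) (EFin \o g)
  (fun n => (measurable_EFinP _ _).2 (mf_ n)) ((measurable_EFinP _ _).2 mf)
  aef Lg aeg.
have Lf_ n : L1 (f_ n) by exact: L1_le_off (mf_ n) Lg (fg n).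
apply: fine_cvg.
rewrite -[X in _ --> X](pintE Lf).
by apply: cvg_trans H; apply: near_eq_cvg; near=> n; rewrite /= pintE.
Unshelve. all: by end_near. Qed.

End plane_measure.

(** * Fubini for integral kernels *)

Section plane_fubini.
Context {R : realType}.
Local Notation pl := (measurableTypeR R * measurableTypeR R)%type.
Local Notation P := (R * R)%type.

(** Joint measurability, stated for a curried kernel. *)
Definition jmfun (G : P -> P -> R) :=
  measurable_fun [set: pl * pl] (fun p : pl * pl => G p.1 p.2).

Lemma jmfun_row G z : jmfun G -> mfun (G z).
Proof.
by move=> mG; apply: (measurableT_comp mG (pair1_measurable (z : pl))).
Qed.

Lemma jmfun_col G z : jmfun G -> mfun (G^~ z).
Proof.
by move=> mG; apply: (measurableT_comp mG (pair2_measurable (z : pl))).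
Qed.

Lemma pintZ_mfun (c : R) (f : P -> R) : mfun f -> pint (fun x => c * f x) = c * pint f.
Proof.
move=> mf; have [Lf|nLf] := pselect (L1 f); first exact: pintZ.
have [->|c0] := eqVneq c 0.
  rewrite mul0r (_ : (fun x => 0 * f x) = (fun=> 0 : R)) ?pint0//.
  by apply/funext => x; rewrite mul0r.
have nL0 (h : P -> R) : mfun h -> ~ L1 h -> pint h = 0.
  move=> mh nLh; rewrite /pint /Rintegral.
  have : ~~ ((\int[plane_area]_x (h x)%:E)%E \is a fin_num).
    apply/negP => hfin; apply: nLh; apply/integrableP; split.
      exact/measurable_EFinP.
    by rewrite integral_fin_num_abs.
  by case: (integral _ _ _).
rewrite !nL0 ?mulr0//; first by apply: measurable_funM.
move=> /(L1Z c^-1); rewrite (_ : (fun x => _) = f)//.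
by apply/funext => x; rewrite mulKf.
Qed.

(** Testing an integral transform against [A] moves [A] onto the kernel. With [A] equal to
    1, to the Laplacian of a bump, or to a row of [G], this gives the integrability of
    the transform, its weak Laplacian, and the composition of two kernels. *)
Lemma fubini_kernel (G : P -> P -> R) (A u : P -> R) (C : R) :
  jmfun G -> mfun A -> L1 u ->
  (forall y, L1 (fun x => A x * G x y)) ->
  (forall y, pint (fun x => `|A x * G x y|) <= C) ->
  [/\ L1 (fun x => A x * pint (fun y => G x y * u y)),
      pint (fun x => A x * pint (fun y => G x y * u y)) =
      pint (fun y => u y * pint (fun x => A x * G x y)) &
      `|pint (fun x => A x * pint (fun y => G x y * u y))| <=
        C * pint (fun y => `|u y|)].
Proof.
move=> mG mA Lu LAG AGC.
pose F (p : pl * pl) : \bar R := (A p.1 * G p.1 p.2 * u p.2)%:E.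
have mF : measurable_fun setT F.
  apply/measurable_EFinP; apply: measurable_funM; last first.
    by apply: measurableT_comp (L1_mfun Lu) _; exact: measurable_snd.
  by apply: measurable_funM => //; apply: measurableT_comp mA _; exact: measurable_fst.
have LyF y : L1 (fun x => `|A x * G x y| * `|u y|).
  rewrite (_ : (fun x => _) = fun x => `|u y| * `|A x * G x y|).
    by apply: L1Z; exact: L1_norm.
  by apply/funext => x; rewrite mulrC.
have H21 y : (\int[plane_area]_x `|F (x, y)| = (`|u y| * pint (fun x => `|A x * G x y|))%:E)%E.
  rewrite -pintZ; last exact: L1_norm.
  rewrite -pintE; last by apply: L1Z; exact: L1_norm.
  by apply: eq_integral => x _; rewrite /F /= normrM mulrC.
have iF : (plane_area \x plane_area)%E.-integrable setT F.
  apply/(integrable21ltyP _ _ mF).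
  under eq_integral do rewrite H21.
  apply: (@le_lt_trans _ _ (\int[plane_area]_y (C * `|u y|)%:E)%E).
    apply: ge0_le_integral => //.
    - by move=> y _; rewrite lee_fin mulr_ge0// pint_ge0.
    - have maF : measurable_fun setT (fun p => `|F p|%E) by exact: measurableT_comp.
      have := @measurable_fun_fubini_tonelli_G _ _ _ _ _ plane_area _ maF (fun=> abse_ge0 _).
      by apply: eq_measurable_fun => y _; rewrite -H21.
    - by apply/measurable_EFinP; apply: L1_mfun; apply: L1Z; exact: L1_norm.
    - by move=> y _; rewrite lee_fin mulrC ler_wpM2r.
  by rewrite pintE ?ltry//; apply: L1Z; exact: L1_norm.
have LF := integrable_fubini_F iF.
have HF x : fine (fubini_F plane_area F x) = A x * pint (fun y => G x y * u y).
  rewrite /fubini_F /F /= -pintZ_mfun.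
    by congr fine; apply: eq_integral => y _; rewrite mulrA.
  apply: measurable_funM; [exact: jmfun_row|exact: L1_mfun].
have HG y : fubini_G plane_area F y = (u y * pint (fun x => A x * G x y))%:E.
  rewrite /fubini_G /F /= -pintZ// -pintE; last exact: L1Z.
  by apply: eq_integral => x _; rewrite mulrC.
have Hae : {ae plane_area, forall x, [set: pl] x -> fubini_F plane_area F x =
    (A x * pint (fun y => G x y * u y))%:E}.
  apply: filterS (integrable_ae measurableT LF) => x /= /(_ I) Fx _.
  by rewrite -HF fineK.
have mAu : mfun (fun x => A x * pint (fun y => G x y * u y)).
  rewrite (_ : (fun x => _) = fine \o fubini_F plane_area F); last first.
    by apply/funext => x /=; rewrite HF.
  apply: measurableT_comp => //.
  exact: measurable_int LF.
have LAu : L1 (fun x => A x * pint (fun y => G x y * u y)).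
  apply/integrableP; split; first exact/measurable_EFinP.
  move/integrableP: (LF) => [_]; congr (_ < _)%E; apply: ae_eq_integral => //.
  - by apply: measurableT_comp => //; exact: measurable_int LF.
  - by apply: measurableT_comp => //; exact/measurable_EFinP.
  - by apply: filterS Hae => x /[apply] /= ->.
have E : pint (fun x => A x * pint (fun y => G x y * u y)) =
      pint (fun y => u y * pint (fun x => A x * G x y)).
  rewrite /pint /Rintegral; congr fine.
  transitivity (\int[plane_area]_x (fubini_F plane_area F x))%E.
    apply: ae_eq_integral => //.
    + exact/measurable_EFinP.
    + exact: measurable_int LF.
    + by apply: filterS Hae => x /[apply] ->.
  rewrite integral12_prod_meas1// -integral21_prod_meas1//.
  by apply: eq_integral => y _; rewrite HG.
split => //; rewrite E.
have mh : mfun (fun y => u y * pint (fun x => A x * G x y)).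
  apply/measurable_EFinP; apply: eq_measurable_fun (measurable_fubini_G iF).
  by move=> y _; rewrite HG.
rewrite -pintZ; last exact: L1_norm.
apply: pint_norm_le => //; first by apply: L1Z; exact: L1_norm.
move=> y; rewrite normrM mulrC ler_wpM2r//.
by rewrite (le_trans _ (AGC y))// pint_norm.
Qed.

End plane_fubini.

(** * Translation invariance of area *)

Section translation.
Context {R : realType}.
Local Notation pl := (measurableTypeR R * measurableTypeR R)%type.
Local Notation P := (R * R)%type.

Definition shift1 (a : R) : measurableTypeR R -> measurableTypeR R :=
  fun x => (x : R) + a.

Lemma measurable_shift1 a : measurable_fun setT (shift1 a).
Proof. exact: measurable_funD. Qed.

Lemma lebesgue_measure_shift (a : R) (A : set (measurableTypeR R)) :
  measurable A -> pushforward lebesgue_measure (shift1 a) A = lebesgue_measure A.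
Proof.
move=> mA; apply/esym/lebesgue_measure_unique => //=.
  exact: measurable_shift1.
move=> _ _ [[b c]] _ <-.
rewrite /pushforward (_ : _ @^-1` _ = `]b - a, c - a]%classic).
  rewrite !lebesgue_measure_itv/= !lte_fin ltrD2r; case: ifP => // _.
  by rewrite -!EFinB; congr EFin; ring.
apply/seteqP; split => x /=; rewrite !in_itv/= /shift1 => /andP[h1 h2];
  apply/andP; split; lra.
Qed.

Definition shift2 (v : P) : pl -> pl := fun z => ((z : P) + v : P).

Lemma measurable_shift2 v : measurable_fun setT (shift2 v).
Proof.
apply: measurable_fun_pair => /=; exact: measurable_funD.
Qed.

Lemma plane_area_shift (v : P) (A : set pl) : measurable A ->
  pushforward plane_area (shift2 v) A = plane_area A.
Proof.
move=> mA; apply/esym/product_measure_unique => //.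
  exact: measurable_shift2.
move=> msh X Y mX mY; rewrite /= /pushforward.
rewrite -(lebesgue_measure_shift v.1 mX) -(lebesgue_measure_shift v.2 mY).
rewrite /pushforward -product_measure1E//.
- by rewrite -(setTI (_ @^-1` _)); exact: measurable_shift1.
- by rewrite -(setTI (_ @^-1` _)); exact: measurable_shift1.
Qed.

Lemma mfun_shift (v : P) f : mfun f -> mfun (fun z => f (z + v)).
Proof. by move=> mf; exact: (measurableT_comp mf (measurable_shift2 v)). Qed.

Lemma ge0_integral_shift (v : P) (f : P -> \bar R) :
  measurable_fun [set: pl] f -> (forall z, 0 <= f z)%E ->
  (\int[plane_area]_z f ((z : P) + v)%R = \int[plane_area]_z f z)%E.
Proof.
move=> mf f0.
transitivity (\int[pushforward plane_area (shift2 v)]_(y in setT) f y)%E.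
  by rewrite ge0_integral_pushforward//; exact: measurable_shift2.
apply: eq_measure_integral; first exact: measurable_shift2.
by move=> msh A mA _; exact: plane_area_shift.
Qed.

Lemma L1_shift (v : P) f : L1 f -> L1 (fun z => f (z + v)).
Proof.
move=> /integrableP[/measurable_EFinP mf fi]; apply/integrableP; split.
  by apply/measurable_EFinP; exact: mfun_shift.
move: fi; rewrite -(@ge0_integral_shift v)//.
by apply: measurableT_comp => //; exact/measurable_EFinP.
Qed.

Lemma pint_shift (v : P) f : L1 f -> pint (fun z => f (z + v)) = pint f.
Proof.
move=> Lf; have mf := (measurable_EFinP _ _).2 (L1_mfun Lf).
rewrite /pint /Rintegral; congr fine.
transitivity (\int[pushforward plane_area (shift2 v)]_(y in setT) (f y)%:E)%E.
  rewrite integral_pushforward//; first exact: measurable_shift2.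
  exact: L1_shift.
apply: eq_measure_integral; first exact: measurable_shift2.
by move=> msh A mA _; exact: plane_area_shift.
Qed.

End translation.

(** * Integrability of the inverse distance *)

Section newton.
Context {R : realType}.
Local Notation pl := (measurableTypeR R * measurableTypeR R)%type.
Local Notation P := (R * R)%type.

Lemma near_eq_continuous (T : topologicalType) (f g : T -> R) z :
  (\forall y \near z, f y = g y) ->
  {for z, continuous f} -> {for z, continuous g}.
Proof.
move=> fg; rewrite /prop_for /continuous_at -(nbhs_singleton fg).
by apply: cvg_trans; apply: near_eq_cvg; apply: filterS fg => y ->.
Qed.

Lemma mfun_continuous_on (O : set P) (f : P -> R) : open O ->
  (forall z, O z -> {for z, continuous f}) -> (forall z, ~ O z -> f z = 0) ->
  mfun f.
Proof.
by move=> oO cf f0; apply: (measurable_continuous_on (phi := id : pl -> P) (@open_plane R) oO cf f0).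
Qed.

Lemma mfun_continuous (f : P -> R) : (forall z, {for z, continuous f}) -> mfun f.
Proof. by move=> cf; apply: (mfun_continuous_on openT) => // z /(_ I). Qed.

Lemma jmfun_continuous_on (O : set (P * P)) (G : P -> P -> R) : open O ->
  (forall p, O p -> {for p, continuous (fun p : P * P => G p.1 p.2)}) ->
  (forall p, ~ O p -> G p.1 p.2 = 0) -> jmfun G.
Proof.
by move=> oO cf f0; apply: (measurable_continuous_on (phi := id : pl * pl -> P * P) (@open_plane2 R) oO cf f0).
Qed.

Lemma continuous_plane_norm (z v : P) : {for z, continuous (fun u : P => `|u - v|)}.
Proof.
apply: (@continuous_comp _ _ _ (fun u : P => u - v) (fun u : P => `|u|)).
  by apply: cvgB; [exact: cvg_id|exact: cvg_cst].
exact: norm_continuous.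
Qed.

Lemma compact_box (c : P) (e : R) : compact [set y : P | `|y - c| <= e].
Proof.
rewrite (_ : mkset _ = `[c.1 - e, c.1 + e]%classic `*` `[c.2 - e, c.2 + e]%classic).
  by apply: compact_setX; exact: segment_compact.
apply/seteqP; split => -[a b] /=; rewrite prod_normE /= ge_max !in_itv /= !ler_distl.
  by move=> /andP[].
by move=> [-> ->].
Qed.

Lemma closed_boxE (A : R) : [set v : P | `|v| <= A] =
  `[- A, A]%classic `*` `[- A, A]%classic.
Proof.
apply/seteqP; split => -[x y] /=; rewrite prod_normE /= ge_max !in_itv/= -!ler_norml.
  by move=> /andP[].
by move=> [-> ->].
Qed.

Lemma measurable_closed_box (A : R) : measurable ([set v : P | `|v| <= A] : set pl).
Proof. by rewrite closed_boxE; apply: measurableX; exact: measurable_itv. Qed.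

Lemma plane_area_closed_box (A : R) : 0 <= A ->
  plane_area [set v : P | `|v| <= A] = (4 * A ^+ 2)%:E.
Proof.
move=> A0; have AA : - A <= A by rewrite ge0_cp.
by rewrite closed_boxE plane_area_box//; congr EFin; ring.
Qed.

(** In the plane this kernel is integrable, and it dominates the square of the logarithm. *)
Definition newton (A : R) (v : P) : R := if `|v| < A then `|v|^-1 else 0.

Lemma newton_ge0 A v : 0 <= newton A v.
Proof. by rewrite /newton; case: ifP => // _; rewrite invr_ge0. Qed.

Lemma mfun_newton A : mfun (newton A).
Proof.
apply: (@mfun_continuous_on [set v | v != 0 /\ `|v| < A]).
- rewrite (_ : mkset _ = (fun v : P => `|v|) @^-1` [set x : R | 0 < x < A]).
    apply: open_comp; first by move=> *; exact: norm_continuous.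
    rewrite (_ : mkset _ = `]0, A[%classic); first exact: interval_open.
    by apply/seteqP; split => x /=; rewrite in_itv.
  by apply/seteqP; split => v /=; rewrite normr_gt0; [case=> -> ->|move/andP].
- move=> v [v0 vA].
  apply: (near_eq_continuous (f := fun u : P => `|u|^-1)).
    near=> u; rewrite /newton ifT//.
    near: u; apply: (@norm_continuous _ _ v [set x | x < A]).
    by apply: open_nbhs_nbhs; split => //; exact: open_lt.
  by apply: cvgV; [rewrite normr_eq0|exact: norm_continuous].
- move=> v /=; rewrite /newton; case: ifP => // vA h.
  have [->|v0] := eqVneq v 0; first by rewrite normr0 invr0.
  by exfalso; apply: h.
Unshelve. all: by end_near. Qed.

Lemma dyadic_scale (A r : R) : 0 < r -> r < A ->
  exists n, A / 2 ^+ n.+1 <= r <= A / 2 ^+ n.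
Proof.
move=> r0 rA; have A0 : 0 < A by rewrite (lt_trans r0).
have H : exists n, A / 2 ^+ n.+1 <= r.
  exists (Num.truncn (A / r)); rewrite ler_pdivrMr ?exprn_gt0// mulrC -ler_pdivrMr//.
  rewrite (le_trans (ltW (truncnS_gt _)))// -natrX ler_nat.
  by apply: ltnW; exact: ltn_expl.
exists (ex_minn H); case: ex_minnP => -[|n] -> /= mn; first by rewrite expr0 divr1 ltW.
by rewrite leNgt; apply/negP => /ltW /mn; rewrite ltnn.
Qed.

(** On the shell where |v| is between A / 2^(n+1) and A / 2^n the kernel is at most
    2^(n+1) / A, and the area is at most 4 A^2 / 4^n: the shells contribute a convergent
    geometric series. *)
Lemma newton_L1 A : 0 < A -> L1 (newton A).
Proof.
move=> A0; apply/integrableP; split; first by apply/measurable_EFinP; exact: mfun_newton.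
pose B n := [set v : P | `|v| <= A / 2 ^+ n].
pose f n (v : P) : \bar R := ((2 ^+ n.+1 / A) * \1_(B n) v)%:E.
have f0 n v : (0 <= f n v)%E by rewrite lee_fin mulr_ge0// divr_ge0// ltW// exprn_gt0.
have mB n : measurable (B n : set pl) by exact: measurable_closed_box.
have mf n : measurable_fun [set: pl] (f n).
  by apply/measurable_EFinP; apply: measurable_funM.
apply: (@le_lt_trans _ _ (\int[plane_area]_v (\sum_(n <oo) f n v))%E).
  apply: ge0_le_integral => //.
  - by apply/measurable_EFinP; apply: measurableT_comp => //; exact: mfun_newton.
  - exact: ge0_emeasurable_sum.
  move=> v _; rewrite /= /newton.
  case: ifP => vA; last by rewrite normr0; exact: nneseries_ge0.
  have [->|v0] := eqVneq v 0; first by rewrite normr0 invr0 normr0; exact: nneseries_ge0.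
  have vp : 0 < `|v| by rewrite normr_gt0.
  have [n /andP[n1 n2]] := dyadic_scale vp vA.
  apply: (@le_trans _ _ (f n v)).
    rewrite lee_fin indicE mem_set// mulr1 ger0_norm ?invr_ge0//.
    by rewrite -[leRHS]invrK lef_pV2 ?posrE// invf_div// divr_gt0// exprn_gt0.
  apply: le_trans (nneseries_lim_ge n.+1 _) => //=.
  by rewrite big_nat_recr//= leeDr// sume_ge0.
rewrite integral_nneseries//.
apply: (@le_lt_trans _ _ (16 * A)%:E); last by rewrite ltry.
apply: le_trans (epsilon_trick0 xpredT _); last by rewrite mulr_ge0 ?ltW.
apply: lee_nneseries => [n _ _|n _]; first exact: integral_ge0.
rewrite /f.
under eq_integral do rewrite EFinM.
rewrite ge0_integralZl//.
- rewrite [X in (_ * X)%E](_ : _ = (4 * (A / 2 ^+ n) ^+ 2)%:E); last first.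
    rewrite integral_indic// setIT; apply: plane_area_closed_box.
    by rewrite divr_ge0 ?ltW ?exprn_gt0.
  rewrite -EFinM lee_fin natrX exprS le_eqVlt; apply/orP; left; apply/eqP.
  by field; rewrite !gt_eqF// ?exprn_gt0.
- by apply/measurable_EFinP.
- by rewrite lee_fin divr_ge0// ltW// exprn_gt0.
Qed.

End newton.

(** * Second differences and the maximum principle *)

Section second_difference.
Context {R : realType}.
Local Notation P := (R * R)%type.
Implicit Types (f g : P -> R) (z y : P) (c d t : R).

(** The five-point discrete Laplacian, without the factor t^(-2). *)
Definition sdiff f t z : R :=
  f (z.1 + t, z.2) + f (z.1 - t, z.2) + f (z.1, z.2 + t) + f (z.1, z.2 - t)
  - 4 * f z.

(** The Laplacian of [f] is at least [c] at [z], in the sense of second differences. The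
    centre [y] varies with the step [t], so that compactness can make the estimate
    uniform. *)
Definition lap_ge f z c := forall d, 0 < d ->
  \forall y \near z & t \near (0 : R), (c - d) * t ^+ 2 <= sdiff f t y.

Lemma near_pairP (z : P) (Q : P * R -> Prop) :
  filter_prod (nbhs z) (nbhs (0 : R)) Q ->
  exists2 e, 0 < e & forall y t, `|y - z| < e -> `|t| < e -> Q (y, t).
Proof.
case=> -[A B] [/= /nbhs_ballP[a /= a0 aA] /nbhs_ballP[b /= b0 bB]] AB.
exists (Num.min a b); first by rewrite lt_min a0 b0.
move=> y t; rewrite !lt_min => /andP[ya _] /andP[_ tb]; apply: (AB (y, t)); split => /=.
  by apply: aA; rewrite -ball_normE /ball_ /= distrC.
by apply: bB; rewrite -ball_normE /ball_ /= distrC subr0.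
Qed.

Lemma near_translate (z : P) (Q : P -> Prop) : (\forall y \near z, Q y) ->
  \forall y \near z & t \near (0 : R),
    [/\ Q (y.1 + t, y.2), Q (y.1 - t, y.2), Q (y.1, y.2 + t), Q (y.1, y.2 - t)
      & Q y].
Proof.
move=> Qz.
have C (F : P * R -> P) : F (z, 0) = z -> {for (z, 0), continuous F} ->
    \forall p \near (z, 0 : R), Q (F p).
  by move=> Fz cF; apply: (cF Q); rewrite Fz.
have c1 : {for (z, 0 : R), continuous (fun p : P * R => p.1.1)}.
  by apply: (@continuous_comp _ _ _ fst fst); exact: cvg_fst.
have c2 : {for (z, 0 : R), continuous (fun p : P * R => p.1.2)}.
  by apply: (@continuous_comp _ _ _ fst snd); [exact: cvg_fst|exact: cvg_snd].
have ct : {for (z, 0 : R), continuous (fun p : P * R => p.2)} by exact: cvg_snd.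
have zE : (z.1, z.2) = z by case: (z).
have h1 : \forall p \near (z, 0 : R), Q (p.1.1 + p.2, p.1.2).
  by apply: (C (fun p => (p.1.1 + p.2, p.1.2))); [rewrite /= addr0|exact: (cvg_pair (cvgD c1 ct) c2)].
have h2 : \forall p \near (z, 0 : R), Q (p.1.1 - p.2, p.1.2).
  by apply: (C (fun p => (p.1.1 - p.2, p.1.2))); [rewrite /= subr0|exact: (cvg_pair (cvgB c1 ct) c2)].
have h3 : \forall p \near (z, 0 : R), Q (p.1.1, p.1.2 + p.2).
  by apply: (C (fun p => (p.1.1, p.1.2 + p.2))); [rewrite /= addr0|exact: (cvg_pair c1 (cvgD c2 ct))].
have h4 : \forall p \near (z, 0 : R), Q (p.1.1, p.1.2 - p.2).
  by apply: (C (fun p => (p.1.1, p.1.2 - p.2))); [rewrite /= subr0|exact: (cvg_pair c1 (cvgB c2 ct))].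
have h5 : \forall p \near (z, 0 : R), Q p.1.
  by apply: (C fst) => //; exact: cvg_fst.
apply: filterS (filterI h1 (filterI h2 (filterI h3 (filterI h4 h5)))).
by move=> -[y t] /= [? [? [? []]]].
Qed.

Lemma lap_ge_near_eq f g z c : (\forall y \near z, f y = g y) ->
  lap_ge f z c -> lap_ge g z c.
Proof.
move=> fg fc d d0; apply: filterS (filterI (near_translate fg) (fc d d0)) => -[y t] /= [[e1 e2 e3 e4 e5]].
by rewrite /sdiff e1 e2 e3 e4 e5.
Qed.

Lemma lap_geD f g z c c' : lap_ge f z c -> lap_ge g z c' ->
  lap_ge (fun y => f y + g y) z (c + c').
Proof.
move=> fc gc d d0; have d2 : 0 < d / 2 by lra.
apply: filterS (filterI (fc _ d2) (gc _ d2)) => -[y t] /= [].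
by rewrite /sdiff; lra.
Qed.

Lemma lap_geZ k f z c : 0 <= k -> lap_ge f z c ->
  lap_ge (fun y => k * f y) z (k * c).
Proof.
move=> k0 fc d d0; have d1 : 0 < d / (k + 1) by rewrite divr_gt0//; lra.
apply: filterS (fc _ d1) => -[y t] /= H.
have -> : sdiff (fun y0 => k * f y0) t y = k * sdiff f t y.
  by rewrite /sdiff; ring.
have dk : k * (d / (k + 1)) <= d.
  by rewrite mulrCA -[leRHS]mulr1 ler_wpM2l ?(ltW d0)// ler_pdivrMr; lra.
have := ler_wpM2l k0 H; have := ler_wpM2r (sqr_ge0 t) dk; lra.
Qed.

Lemma lap_ge_cst k z : lap_ge (fun=> k) z 0.
Proof.
move=> d d0; apply: (filterS _ (filterT : nbhs (z, 0 : R) setT)) => -[y t] _ /=.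
rewrite /sdiff.
have := mulr_ge0 (ltW d0) (sqr_ge0 t); lra.
Qed.

(** Truncating from below keeps subharmonicity: where the truncation is active the
    function sits at its global minimum. *)
Lemma lap_ge_max f z k : (f z < k /\ {for z, continuous f}) \/ lap_ge f z 0 ->
  lap_ge (fun y => Num.max (f y) k) z 0.
Proof.
case=> [[fk cf]|fc].
  apply: (lap_ge_near_eq (f := fun=> k)); last exact: lap_ge_cst.
  have : \forall y \near z, f y < k.
    by apply: (cf [set x | x < k]); apply: open_nbhs_nbhs; split => //; exact: open_lt.
  by apply: filterS => y fy; rewrite max_r ?ltW.
move=> d d0; apply: filterS (fc d d0) => -[y t] /= H.
rewrite /sdiff; set F := fun y => Num.max (f y) k.
have Fk x : k <= F x by rewrite /F le_max lexx orbT.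
have Ff x : f x <= F x by rewrite /F le_max lexx.
rewrite -/(F (y.1 + t, y.2)) -/(F (y.1 - t, y.2)) -/(F (y.1, y.2 + t)) -/(F (y.1, y.2 - t)) -/(F y).
have [fk|kf] := leP (f y) k.
  have -> : F y = k by rewrite /F max_r.
  have := Fk (y.1 + t, y.2); have := Fk (y.1 - t, y.2).
  have := Fk (y.1, y.2 + t); have := Fk (y.1, y.2 - t).
  have := mulr_ge0 (ltW d0) (sqr_ge0 t); lra.
have -> : F y = f y by rewrite /F max_l// ltW.
have := Ff (y.1 + t, y.2); have := Ff (y.1 - t, y.2).
have := Ff (y.1, y.2 + t); have := Ff (y.1, y.2 - t).
move: H; rewrite /sdiff; lra.
Qed.

(** The maximum principle, proved with second differences only: adding a small
    multiple of the squared modulus makes every second difference positive,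
    which is impossible at an interior maximum. *)
Lemma max_principle (Om K : set P) f c : compact K ->
  (forall z, K z -> [/\ {for z, continuous f}, nbhs z Om & lap_ge f z 0]) ->
  (forall z, Om z -> ~ K z -> f z <= c) ->
  forall z, Om z -> f z <= c.
Proof.
move=> cK HK HOm z1 Omz1; rewrite leNgt; apply/negP => cf.
have Kz1 : K z1 by apply: contrapT => /(HOm _ Omz1); rewrite leNgt cf.
pose q (z : P) := z.1 ^+ 2 + z.2 ^+ 2.
have cq z : {for z, continuous q}.
  have c1 : {for z, continuous (fun p : P => p.1)} by exact: cvg_fst.
  have c2 : {for z, continuous (fun p : P => p.2)} by exact: cvg_snd.
  by apply: cvgD; rewrite ?expr2; [exact: (cvgM c1 c1)|exact: (cvgM c2 c2)].
have q0 z : 0 <= q z by rewrite addr_ge0 ?sqr_ge0.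
have [zm Kzm Hzm] : exists2 zm, K zm & forall y, K y -> q y <= q zm.
  have [||zm] := @compact_EVT_max _ R q K _ cK _; first by exists z1.
    by apply: continuous_subspaceT => z; exact: cq.
  by rewrite inE => Kzm H; exists zm => // y Ky; apply: H; rewrite inE.
pose eta := (f z1 - c) / (2 * (q zm + 1)).
have qm1 : 0 < 2 * (q zm + 1) by have := q0 zm; lra.
have eta0 : 0 < eta by rewrite divr_gt0// subr_gt0.
have etaE : eta * (q zm + 1) = (f z1 - c) / 2.
  by rewrite /eta; field; have := q0 zm; lra.
pose F z := f z + eta * q z.
have [z0 Kz0 Hz0] : exists2 z0, K z0 & forall y, K y -> F y <= F z0.
  have [||z0] := @compact_EVT_max _ R F K _ cK _; first by exists z1.
    apply: continuous_in_subspaceT => z; rewrite inE => Kz.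
    have [cfz _ _] := HK _ Kz.
    by apply: cvgD => //; apply: cvgM; [exact: cvg_cst|exact: cq].
  by rewrite inE => Kz0 H; exists z0 => // y Ky; apply: H; rewrite inE.
have [_ Omz0 /(_ _ eta0) lap0] := HK _ Kz0.
have qz0 : \forall y \near z0, q y < q z0 + 1.
  apply: (cq z0 [set x | x < q z0 + 1]); apply: open_nbhs_nbhs.
  by split; [exact: open_lt|rewrite /=; lra].
have near0 : \forall y \near z0, F y <= F z0.
  apply: filterS (filterI Omz0 qz0) => y [Omy qy].
  have [Ky|nKy] := pselect (K y); first exact: Hz0.
  have fy := HOm _ Omy nKy.
  have : eta * q y <= eta * (q zm + 1).
    by rewrite ler_wpM2l ?(ltW eta0)//; have := Hzm _ Kz0; lra.
  have := Hz0 _ Kz1; have := mulr_ge0 (ltW eta0) (q0 z1).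
  rewrite etaE /F; lra.
have [e e0 He] := near_pairP (filterI lap0 (near_translate near0)).
have [||/=] := He z0 (e / 2); first by rewrite subrr normr0.
  by rewrite ger0_norm; lra.
move=> H [h1 h2 h3 h4 _].
have t0 : 0 < eta * (e / 2) ^+ 2 by rewrite mulr_gt0// exprn_gt0//; lra.
move: H h1 h2 h3 h4; rewrite /F /q /sdiff /=.
move: t0; set t := e / 2; nra.
Qed.

End second_difference.

(** * From partial derivatives to second differences *)

Section twice_differentiable.
Context {R : realType}.
Local Notation P := (R * R)%type.

Lemma is_derive_shift (F : R -> R) (a s l : R) :
  is_derive (a + s) 1 F l -> is_derive s 1 (fun x => F (a + x)) l.
Proof.
move=> [dF <-].
have sE : (fun h : R => h^-1 *: (((fun x => F (a + x)) \o shift s) (h *: 1) - F (a + s))) =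
   (fun h : R => h^-1 *: ((F \o shift (a + s)) (h *: 1) - F (a + s))).
  by apply/funext => h /=; congr (_ *: (F _ - _)); rewrite addrCA.
split; first by rewrite /derivable sE.
by rewrite /derive sE.
Qed.

Lemma is_derive_shiftN (F : R -> R) (a s l : R) :
  is_derive (a - s) 1 F l -> is_derive s 1 (fun x => F (a - x)) (- l).
Proof.
move=> dF.
have dN : is_derive s 1 (fun x : R => a - x) (- 1).
  by apply: is_derive_eq; rewrite add0r mul1r.
have := @is_derive1_comp _ F (fun x => a - x) s l (- 1) dF dN.
by rewrite mulrN1.
Qed.

(** The mean value theorem, applied twice to s |-> f (x0 + s) + f (x0 - s) - c s^2, whose
    derivative vanishes at 0. *)
Lemma second_difference_1d (f f1 f2 : R -> R) (x0 r c d : R) :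
  (forall s, `|s| < r -> [/\ is_derive (x0 + s) 1 f (f1 (x0 + s)),
     is_derive (x0 + s) 1 f1 (f2 (x0 + s)) & `|f2 (x0 + s) - c| <= d]) ->
  forall t, `|t| < r ->
   `|f (x0 + t) + f (x0 - t) - 2 * f x0 - c * t ^+ 2| <= 2 * d * t ^+ 2.
Proof.
move=> H.
suff pos t : 0 <= t -> t < r ->
   `|f (x0 + t) + f (x0 - t) - 2 * f x0 - c * t ^+ 2| <= 2 * d * t ^+ 2.
  move=> t tr; have [t0|t0] := leP 0 t.
    by apply: pos => //; rewrite ger0_norm in tr.
  have := pos (- t); rewrite opprK sqrrN (addrC (f (x0 - t))) => ->//.
    by rewrite oppr_ge0 ltW.
  by rewrite ltr0_norm in tr.
move=> t0 tr.
pose psi s := f (x0 + s) + f (x0 - s) - c * s ^+ 2.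
pose chi s := f1 (x0 + s) - f1 (x0 - s) - c * (2 * s).
pose chi' s := f2 (x0 + s) + f2 (x0 - s) - c * 2.
have inr s : 0 <= s -> s <= t -> `|s| < r /\ `|- s| < r.
  by move=> s0 st; rewrite normrN ger0_norm//; split; exact: le_lt_trans tr.
have dpsi s : 0 <= s -> s <= t -> is_derive s 1 psi (chi s).
  move=> s0 st; have [/H[d1 _ _] /H[d1' _ _]] := inr s s0 st.
  have e1 := is_derive_shift d1; have e2 := is_derive_shiftN d1'.
  by apply: is_derive_eq; rewrite /chi /GRing.scale /=; ring.
have dchi s : 0 <= s -> s <= t -> is_derive s 1 chi (chi' s).
  move=> s0 st; have [/H[_ d1 _] /H[_ d1' _]] := inr s s0 st.
  have e1 := is_derive_shift d1; have e2 := is_derive_shiftN d1'.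
  by apply: is_derive_eq; rewrite /chi' /GRing.scale /=; ring.
have cont (g g' : R -> R) u : 0 <= u -> u <= t ->
    (forall s, 0 <= s -> s <= t -> is_derive s 1 g (g' s)) ->
    exists2 s, (0 <= s <= u) & g u - g 0 = g' s * u.
  move=> u0 ut dg.
  have d1 s : s \in `]0, u[ -> is_derive s 1 g (g' s).
    rewrite in_itv/= => /andP[s0 su]; apply: dg; first exact: ltW.
    by rewrite (le_trans (ltW su)).
  have d2 : {within `[0, u], continuous g}.
    apply: derivable_within_continuous => s; rewrite in_itv/= => /andP[s0 su].
    by have [] := dg s s0 (le_trans su ut).
  have [s] := @MVT_segment _ g g' 0 u u0 d1 d2.
  by rewrite in_itv/= subr0 => su E; exists s.
have [s /andP[s0 st] E1] := cont _ _ _ t0 (lexx t) dpsi.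
have [s' /andP[s'0 s's] E2] := cont _ _ _ s0 st dchi.
have chi0 : chi 0 = 0 by rewrite /chi addr0 subr0; ring.
have bnd : `|chi' s'| <= 2 * d.
  have [/H[_ _ b1] /H[_ _ b2]] := inr s' s'0 (le_trans s's st).
  have -> : chi' s' = (f2 (x0 + s') - c) + (f2 (x0 - s') - c) by rewrite /chi'; ring.
  by rewrite (le_trans (ler_normD _ _))//; lra.
have -> : f (x0 + t) + f (x0 - t) - 2 * f x0 - c * t ^+ 2 = psi t - psi 0.
  by rewrite /psi addr0 subr0; ring.
rewrite E1; move: E2; rewrite chi0 subr0 => ->.
rewrite -mulrA normrM; have -> : `|s * t| = s * t by rewrite ger0_norm// mulr_ge0.
have d0 : 0 <= 2 * d by apply: le_trans bnd.
apply: (@le_trans _ _ (2 * d * (s * t))); first by rewrite ler_wpM2r// mulr_ge0.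
by rewrite ler_wpM2l// expr2 ler_wpM2r.
Qed.

(** Partial derivatives as derivatives along the axes, which gives access to the calculus
    of one variable. *)
Definition pdx (f : P -> R) (y : P) (l : R) :=
  is_derive y.1 1 (fun x => f (x, y.2)) l.
Definition pdy (f : P -> R) (y : P) (l : R) :=
  is_derive y.2 1 (fun x => f (y.1, x)) l.

(** Continuity of the second derivatives makes the Taylor estimate uniform near [z]. *)
Lemma lap_ge_C2 (f fx fxx fy fyy : P -> R) (z : P) :
  (\forall y \near z, [/\ pdx f y (fx y), pdx fx y (fxx y),
     pdy f y (fy y) & pdy fy y (fyy y)]) ->
  {for z, continuous fxx} -> {for z, continuous fyy} ->
  lap_ge f z (fxx z + fyy z).
Proof.
move=> Hd cx cy d d0; pose dl := d / 8; have dl0 : 0 < dl by rewrite /dl; lra.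
have nx : \forall y \near z, `|fxx y - fxx z| <= dl.
  by move/cvgr_dist_le : (cx) => /(_ _ dl0); apply: filterS => y; rewrite distrC.
have ny : \forall y \near z, `|fyy y - fyy z| <= dl.
  by move/cvgr_dist_le : (cy) => /(_ _ dl0); apply: filterS => y; rewrite distrC.
have : nbhs z (fun y => [/\ pdx f y (fx y), pdx fx y (fxx y),
     pdy f y (fy y) & pdy fy y (fyy y)] /\ (`|fxx y - fxx z| <= dl /\ `|fyy y - fyy z| <= dl)).
  by apply: filterI => //; apply: filterI.
move=> /nbhs_ballP[e /= e0 He].
have e2 : 0 < e / 2 by lra.
exists (ball z (e / 2), ball (0 : R) (e / 2)); first by split; exact: nbhsx_ballx.
move=> [y t] /= []; rewrite -!ball_normE /= sub0r normrN => yz te.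
have Bx s : `|s| < e / 2 -> ball z e (y.1 + s, y.2).
  move=> se; rewrite ball_prod_normE /ball_ /= prod_normE /= in yz *.
  move: yz; rewrite !gt_max => /andP[y1 y2]; apply/andP; split; last lra.
  have -> : z.1 - (y.1 + s) = (z.1 - y.1) - s by ring.
  by rewrite (le_lt_trans (ler_normB _ _))//; lra.
have By s : `|s| < e / 2 -> ball z e (y.1, y.2 + s).
  move=> se; rewrite ball_prod_normE /ball_ /= prod_normE /= in yz *.
  move: yz; rewrite !gt_max => /andP[y1 y2]; apply/andP; split; first lra.
  have -> : z.2 - (y.2 + s) = (z.2 - y.2) - s by ring.
  by rewrite (le_lt_trans (ler_normB _ _))//; lra.
have hx : forall t, `|t| < e / 2 -> `|f (y.1 + t, y.2) + f (y.1 - t, y.2)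
    - 2 * f (y.1, y.2) - fxx z * t ^+ 2| <= 2 * dl * t ^+ 2.
  apply: (@second_difference_1d (fun x => f (x, y.2)) (fun x => fx (x, y.2))
    (fun x => fxx (x, y.2))) => s se.
  by have [[? ? _ _] [? _]] := He _ (Bx _ se).
have hy : forall t, `|t| < e / 2 -> `|f (y.1, y.2 + t) + f (y.1, y.2 - t)
    - 2 * f (y.1, y.2) - fyy z * t ^+ 2| <= 2 * dl * t ^+ 2.
  apply: (@second_difference_1d (fun x => f (y.1, x)) (fun x => fy (y.1, x))
    (fun x => fyy (y.1, x))) => s se.
  by have [[_ _ ? ?] [_ ?]] := He _ (By _ se).
have yE : f (y.1, y.2) = f y by case: (y).
move: (hx t te) (hy t te); rewrite yE !ler_norml => /andP[h1 _] /andP[h2 _].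
have := mulr_ge0 (ltW d0) (sqr_ge0 t).
rewrite /sdiff; move: h1 h2; rewrite /dl; lra.
Qed.

End twice_differentiable.

(** * Harmonic functions and the regularised logarithm *)

Section harmonic_functions.
Context {R : realType}.
Local Notation P := (R * R)%type.

Lemma dx_quotient (F : P -> R) y :
  (fun h : R => h^-1 *: (((fun x => F (x, y.2)) \o shift y.1) (h *: 1) - F (y.1, y.2))) =
  (fun h : R => h^-1 *: ((F \o shift y) (h *: ((1, 0) : P)) - F y)).
Proof.
apply/funext => h /=; rewrite -surjective_pairing; congr (_ *: (F _ - _)).
rewrite [RHS]surjective_pairing; congr (_, _) => /=.
by rewrite scaler0 add0r.
Qed.

Lemma dy_quotient (F : P -> R) y :
  (fun h : R => h^-1 *: (((fun x => F (y.1, x)) \o shift y.2) (h *: 1) - F (y.1, y.2))) =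
  (fun h : R => h^-1 *: ((F \o shift y) (h *: ((0, 1) : P)) - F y)).
Proof.
apply/funext => h /=; rewrite -surjective_pairing; congr (_ *: (F _ - _)).
rewrite [RHS]surjective_pairing; congr (_, _) => /=.
by rewrite scaler0 add0r.
Qed.

Lemma pdx_differentiable (F : P -> R) y : differentiable F y -> pdx F y (dx F y).
Proof.
move=> dF; have dv := @diff_derivable _ _ _ F y (1, 0) dF.
split; first by rewrite /derivable dx_quotient.
by rewrite /derive dx_quotient.
Qed.

Lemma pdy_differentiable (F : P -> R) y : differentiable F y -> pdy F y (dy F y).
Proof.
move=> dF; have dv := @diff_derivable _ _ _ F y (0, 1) dF.
split; first by rewrite /derivable dy_quotient.
by rewrite /derive dy_quotient.
Qed.

Lemma pdx_dx (F : P -> R) y l : pdx F y l -> dx F y = l.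
Proof. by case=> _ <-; rewrite /dx /derive dx_quotient. Qed.

Lemma pdy_dy (F : P -> R) y l : pdy F y l -> dy F y = l.
Proof. by case=> _ <-; rewrite /dy /derive dy_quotient. Qed.

Lemma pdxN (F : P -> R) y l : pdx F y l -> pdx (fun z => - F z) y (- l).
Proof. by move=> dF; exact: is_deriveN. Qed.

Lemma pdyN (F : P -> R) y l : pdy F y l -> pdy (fun z => - F z) y (- l).
Proof. by move=> dF; exact: is_deriveN. Qed.

Lemma harmonic_lap_ge (U : set P) (f : P -> R) z : nbhs z U -> harmonic_on U f ->
  lap_ge f z 0 /\ lap_ge (fun y => - f y) z 0.
Proof.
move=> Uz [[Hd Hc] Hl]; have Uzz : U z by exact: nbhs_singleton.
have cx : {for z, continuous (dx (dx f))} by exact: (Hc [:: true; true]).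
have cy : {for z, continuous (dy (dy f))} by exact: (Hc [:: false; false]).
have HN : \forall y \near z, [/\ pdx f y (dx f y), pdx (dx f) y (dx (dx f) y),
    pdy f y (dy f y) & pdy (dy f) y (dy (dy f) y)].
  apply: filterS Uz => y Uy; split.
  - by apply: pdx_differentiable; exact: (Hd [::]).
  - by apply: pdx_differentiable; exact: (Hd [:: true]).
  - by apply: pdy_differentiable; exact: (Hd [::]).
  - by apply: pdy_differentiable; exact: (Hd [:: false]).
have E := Hl _ Uzz; rewrite /laplacian in E.
split; first by rewrite -E; apply: lap_ge_C2 HN cx cy.
rewrite -(oppr0) -E opprD.
apply: (lap_ge_C2 (f := fun y => - f y) (fx := fun y => - dx f y)
  (fxx := fun y => - dx (dx f) y) (fy := fun y => - dy f y)
  (fyy := fun y => - dy (dy f) y)); last 2 first.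
- exact: (cvgN cx).
- exact: (cvgN cy).
by apply: filterS HN => y [? ? ? ?]; split; by [apply: pdxN|apply: pdyN].
Qed.

Lemma harmonic_continuous (U : set P) (f : P -> R) z : U z -> harmonic_on U f ->
  {for z, continuous f}.
Proof.
by move=> Uz [[Hd _] _]; apply: differentiable_continuous; exact: (Hd [::]).
Qed.

(** The squared Euclidean modulus, regularised by [e]. At [e = 0], [log_kernel] is the
    potential (2 pi)^(-1) log |z|; for [e > 0] it is smooth, with Laplacian
    [log_kernel_lap]. *)
Definition sqmod (e : R) (z : P) : R := z.1 ^+ 2 + z.2 ^+ 2 + e ^+ 2.

Definition log_kernel (e : R) (z : P) : R := (4 * pi)^-1 * ln (sqmod e z).

Definition log_kernel_lap (e : R) (z : P) : R := e ^+ 2 / (pi * sqmod e z ^+ 2).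

Lemma sqmod_ge0 e z : 0 <= sqmod e z.
Proof. by rewrite !addr_ge0 ?sqr_ge0. Qed.

Lemma sqmod_gt0 z : z != 0 -> 0 < sqmod 0 z.
Proof.
move=> z0; rewrite lt_neqAle sqmod_ge0 andbT eq_sym; apply: contra z0.
rewrite /sqmod expr0n addr0 paddr_eq0 ?sqr_ge0// !sqrf_eq0.
by case: z => a b /= /andP[/eqP -> /eqP ->].
Qed.

Lemma sqmod_gt0e e z : 0 < e -> 0 < sqmod e z.
Proof. by move=> e0; rewrite ltr_wpDl ?addr_ge0 ?sqr_ge0 ?exprn_gt0. Qed.

Lemma continuous_sqmod e z : {for z, continuous (sqmod e)}.
Proof.
have c1 : {for z, continuous (fun p : P => p.1)} by exact: cvg_fst.
have c2 : {for z, continuous (fun p : P => p.2)} by exact: cvg_snd.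
by apply: cvgD; [apply: cvgD; [exact: (cvgM c1 c1)|exact: (cvgM c2 c2)]|exact: cvg_cst].
Qed.

Lemma near_sqmod_gt0 e z : 0 < sqmod e z -> \forall y \near z, 0 < sqmod e y.
Proof.
move=> q0; apply: (@continuous_sqmod e z [set x | 0 < x]).
by apply: open_nbhs_nbhs; split => //; exact: open_gt.
Qed.

Lemma continuous_log_kernel e z : 0 < sqmod e z -> {for z, continuous (log_kernel e)}.
Proof.
move=> q0; apply: cvgM; first exact: cvg_cst.
apply: (@continuous_comp _ _ _ (sqmod e) (@ln R)); first exact: continuous_sqmod.
exact: continuous_ln.
Qed.

Lemma log_kernel_derivs (e : R) (y : P) : 0 < sqmod e y ->
 [/\ pdx (log_kernel e) y ((2 * pi)^-1 * (y.1 / sqmod e y)),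
     pdx (fun y => (2 * pi)^-1 * (y.1 / sqmod e y)) y
       ((2 * pi)^-1 * ((sqmod e y - 2 * y.1 ^+ 2) / sqmod e y ^+ 2)),
     pdy (log_kernel e) y ((2 * pi)^-1 * (y.2 / sqmod e y)) &
     pdy (fun y => (2 * pi)^-1 * (y.2 / sqmod e y)) y
       ((2 * pi)^-1 * ((sqmod e y - 2 * y.2 ^+ 2) / sqmod e y ^+ 2))].
Proof.
move=> q0.
have p0 : (pi : R) != 0 by rewrite gt_eqF// pi_gt0.
have dq (s b : R) : is_derive s 1 (fun x : R => x ^+ 2 + b) (2 * s).
  by apply: is_derive_eq; rewrite /GRing.scale /=; ring.
have H (pp a b : R) : pp != 0 -> 0 < a ^+ 2 + b ->
   is_derive a 1 (fun x : R => (4 * pp)^-1 * ln (x ^+ 2 + b)) ((2 * pp)^-1 * (a / (a ^+ 2 + b))) /\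
   is_derive a 1 (fun x : R => (2 * pp)^-1 * (x / (x ^+ 2 + b)))
    ((2 * pp)^-1 * ((a ^+ 2 + b - 2 * a ^+ 2) / (a ^+ 2 + b) ^+ 2)).
  move=> pp0 ab; split.
    have dl := @is_derive1_comp _ (@ln R) (fun x : R => x ^+ 2 + b) a _ _ (is_derive1_ln ab) (dq a b).
    have dl' : is_derive a 1 (fun x : R => ln (x ^+ 2 + b)) _ := dl.
    apply: is_derive_eq.
    by rewrite /GRing.scale /=; field; rewrite pp0 gt_eqF.
  have n0 : (fun x : R => x ^+ 2 + b) a != 0 by rewrite gt_eqF.
  have dv := @is_deriveV _ (fun x : R => x ^+ 2 + b) a _ _ n0 (dq a b).
  have dv' : is_derive a 1 (fun x : R => (x ^+ 2 + b)^-1) _ := dv.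
  apply: is_derive_eq.
  by rewrite /GRing.scale /=; field; rewrite pp0 gt_eqF.
have E1 x : sqmod e (x, y.2) = x ^+ 2 + (y.2 ^+ 2 + e ^+ 2) by rewrite /sqmod/=; ring.
have E2 x : sqmod e (y.1, x) = x ^+ 2 + (y.1 ^+ 2 + e ^+ 2) by rewrite /sqmod/=; ring.
have yE : y = (y.1, y.2) by case: (y).
have F1 : sqmod e y = y.1 ^+ 2 + (y.2 ^+ 2 + e ^+ 2) by rewrite {1}yE E1.
have F2 : sqmod e y = y.2 ^+ 2 + (y.1 ^+ 2 + e ^+ 2) by rewrite {1}yE E2.
have [h1 h2] := H pi y.1 (y.2 ^+ 2 + e ^+ 2) p0 ltac:(by rewrite -F1).
have [h3 h4] := H pi y.2 (y.1 ^+ 2 + e ^+ 2) p0 ltac:(by rewrite -F2).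
rewrite -F1 in h1 h2; rewrite -F2 in h3 h4.
rewrite /pdx /pdy /log_kernel /=; split.
- by under eq_fun do rewrite E1.
- by under eq_fun do rewrite E1.
- by under eq_fun do rewrite E2.
- by under eq_fun do rewrite E2.
Qed.

Lemma log_kernel_lap_ge (e : R) (z : P) : 0 < sqmod e z ->
  lap_ge (log_kernel e) z (log_kernel_lap e z) /\
  lap_ge (fun y => - log_kernel e y) z (- log_kernel_lap e z).
Proof.
move=> q0.
have p0 : (pi : R) != 0 by rewrite gt_eqF// pi_gt0.
pose fxx (y : P) := (2 * pi)^-1 * ((sqmod e y - 2 * y.1 ^+ 2) / sqmod e y ^+ 2).
pose fyy (y : P) := (2 * pi)^-1 * ((sqmod e y - 2 * y.2 ^+ 2) / sqmod e y ^+ 2).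
have E : log_kernel_lap e z = fxx z + fyy z.
  rewrite /log_kernel_lap /fxx /fyy; move: p0 q0.
  rewrite /sqmod; move: (pi : R) => pp p0 q0.
  by field; rewrite p0 gt_eqF.
have cq := @continuous_sqmod e z.
have cq2 : {for z, continuous (fun y => sqmod e y ^+ 2)} by exact: (cvgM cq cq).
have c1 : {for z, continuous (fun p : P => p.1)} by exact: cvg_fst.
have c2 : {for z, continuous (fun p : P => p.2)} by exact: cvg_snd.
have qn : sqmod e z ^+ 2 != 0 by rewrite expf_neq0// gt_eqF.
have cx : {for z, continuous fxx}.
  apply: cvgM; first exact: cvg_cst.
  apply: cvgM; last exact: cvgV.
  by apply: cvgB => //; apply: cvgM; [exact: cvg_cst|exact: (cvgM c1 c1)].
have cy : {for z, continuous fyy}.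
  apply: cvgM; first exact: cvg_cst.
  apply: cvgM; last exact: cvgV.
  by apply: cvgB => //; apply: cvgM; [exact: cvg_cst|exact: (cvgM c2 c2)].
pose fx (y : P) := (2 * pi)^-1 * (y.1 / sqmod e y).
pose fy (y : P) := (2 * pi)^-1 * (y.2 / sqmod e y).
have HN : \forall y \near z, [/\ pdx (log_kernel e) y (fx y), pdx fx y (fxx y),
    pdy (log_kernel e) y (fy y) & pdy fy y (fyy y)].
  by apply: filterS (near_sqmod_gt0 q0) => y; exact: log_kernel_derivs.
split; first by rewrite E; exact: (lap_ge_C2 HN cx cy).
rewrite E opprD.
apply: (lap_ge_C2 (f := fun y => - log_kernel e y)
   (fx := fun y => - fx y) (fy := fun y => - fy y)
   (fxx := fun y => - fxx y) (fyy := fun y => - fyy y)); last 2 first.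
- exact: (cvgN cx).
- exact: (cvgN cy).
by apply: filterS HN => y [? ? ? ?]; split; by [apply: pdxN|apply: pdyN].
Qed.

End harmonic_functions.

(** * Smooth functions of one variable *)

Section smooth_functions_1d.
Context {R : realType}.
Implicit Types (f g : R -> R) (p : {poly R}).

(** Recursion on the order lets each rule of differentiation pass to all orders by
    induction. *)
Fixpoint nderivable n f : Prop :=
  if n is m.+1 then (forall x, derivable f x 1) /\ nderivable m (derive1 f)
  else True.

Definition smooth1 f := forall n, nderivable n f.

Lemma nderivableS n f : nderivable n.+1 f -> nderivable n f.
Proof.
elim: n f => // n IH f [df nf]; split => //; exact: IH.
Qed.

Lemma derive1_is_derive f f' : (forall x : R, is_derive x 1 f (f' x)) ->
  (forall x : R, derivable f x 1) /\ derive1 f = f'.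
Proof.
move=> H; split; first by move=> x; have [] := H x.
by apply/funext => x; rewrite derive1E; have [_ ->] := H x.
Qed.

Lemma nderivable_is_derive n f f' : (forall x : R, is_derive x 1 f (f' x)) ->
  nderivable n f' -> nderivable n.+1 f.
Proof. by move=> /derive1_is_derive[df fE] nf; split => //; rewrite fE. Qed.

Lemma is_derive_derive1 f x : derivable f x 1 -> is_derive x 1 f (derive1 f x).
Proof. by move=> df; rewrite derive1E; exact: derivableP. Qed.

Lemma nderivableD n f g : nderivable n f -> nderivable n g ->
  nderivable n (fun x => f x + g x).
Proof.
elim: n f g => // n IH f g [df nf] [dg ng].
apply: (@nderivable_is_derive _ _ (fun x => derive1 f x + derive1 g x)); last exact: IH.
by move=> x; apply: is_deriveD; exact: is_derive_derive1.
Qed.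

Lemma nderivableM n f g : nderivable n f -> nderivable n g ->
  nderivable n (fun x => f x * g x).
Proof.
elim: n f g => // n IH f g Hf Hg.
have [df nf] := Hf; have [dg ng] := Hg.
apply: (@nderivable_is_derive _ _ (fun x => f x * derive1 g x + g x * derive1 f x)).
  move=> x; have d1 := is_derive_derive1 (df x); have d2 := is_derive_derive1 (dg x).
  exact: is_deriveM.
by apply: nderivableD; apply: IH => //; exact: nderivableS.
Qed.

Lemma nderivable_cst n (c : R) : nderivable n (fun=> c).
Proof.
elim: n c => // n IH c; apply: (@nderivable_is_derive _ _ (fun=> 0)) => //; exact: is_derive_cst.
Qed.

Lemma is_derive_affine f (a b : R) x l : is_derive (a * x + b) 1 f l ->
  is_derive x 1 (fun x => f (a * x + b)) (a * l).
Proof.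
move=> df; have da : is_derive x 1 (fun x : R => a * x + b) a.
  by apply: is_derive_eq; rewrite /GRing.scale /=; ring.
by have := @is_derive1_comp _ f (fun x : R => a * x + b) x l a df da; rewrite mulrC.
Qed.

Lemma nderivable_affine n f (a b : R) : nderivable n f ->
  nderivable n (fun x => f (a * x + b)).
Proof.
elim: n f => // n IH f [df nf].
apply: (@nderivable_is_derive _ _ (fun x => a * derive1 f (a * x + b))).
  by move=> x; apply: is_derive_affine; exact: is_derive_derive1.
by apply: nderivableM; [exact: nderivable_cst|exact: IH].
Qed.

Lemma smooth1_derivable f x : smooth1 f -> derivable f x 1.
Proof. by move=> /(_ 1%N)[]. Qed.

Lemma smooth1_derive f : smooth1 f -> smooth1 (derive1 f).
Proof. by move=> sf n; have [] := sf n.+1. Qed.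

Lemma smooth1_continuous f : smooth1 f -> continuous f.
Proof.
by move=> sf x; apply: differentiable_continuous; apply/derivable1_diffP; exact: smooth1_derivable.
Qed.

Lemma is_derive0_sqr f (C : R) : f 0 = 0 ->
  (forall h, `|h| < 1 -> `|f h| <= C * h ^+ 2) -> is_derive (0 : R) 1 f 0.
Proof.
move=> f0 fC.
have H : (fun h : R => h^-1 *: ((f \o shift 0) (h *: 1) - f 0)) @ 0^' --> (0 : R).
  have C0 : 0 <= C.
    have := fC (1 / 2) _; rewrite ger0_norm; last lra.
    move=> /(_ ltac:(lra)) => h; have := normr_ge0 (f (1 / 2)).
    by move=> /le_trans /(_ h); rewrite pmulr_lge0// exprn_gt0; lra.
  apply/cvgr0Pnorm_le => e e0.
  have d0 : 0 < Num.min 1 (e / (C + 1)) by rewrite lt_min ltr01 divr_gt0//; lra.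
  near=> h.
  have h0 : h != 0 by near: h; exact: nbhs_dnbhs_neq.
  have hd : `|h| < Num.min 1 (e / (C + 1)).
    by near: h; exact: (dnbhs0_lt d0).
  move: hd; rewrite lt_min => /andP[h1 h2].
  rewrite /= addr0 f0 subr0 /GRing.scale/= mulr1 normrM normfV.
  rewrite ler_pdivrMl ?normr_gt0// (le_trans (fC _ h1))//.
  have h3 : `|h| * (C + 1) < e by rewrite -ltr_pdivlMr//; lra.
  have -> : h ^+ 2 = `|h| * `|h| by rewrite -expr2 real_normK// num_real.
  have n0 := normr_ge0 h; nra.
split; first by apply/cvg_ex; exists 0.
exact/cvg_lim.
Unshelve. all: by end_near. Qed.

Lemma poly_bound p : exists2 A : R, 0 <= A & forall s, 1 <= s -> `|p.[s]| <= A * s ^+ size p.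
Proof.
exists (\sum_(i < size p) `|p`_i|); first by apply: sumr_ge0.
move=> s s1; rewrite horner_coef mulr_suml (le_trans (ler_norm_sum _ _ _))//.
apply: ler_sum => i _; rewrite normrM ler_wpM2l// ger0_norm ?exprn_ge0//; last lra.
by rewrite ler_weXn2l// ltnW.
Qed.

(** The functions p(1/x) exp(-1/x), extended by 0 to the left of 0, form a family closed
    under differentiation; hence they are all smooth. *)
Definition flat p (x : R) : R := if 0 < x then p.[x^-1] * expR (- x^-1) else 0.

(** The exponential of s dominates s^m / m! with m = size p + 2, which leaves two powers
    of s = 1/x to spare. *)
Lemma flat_bound p : exists C, forall h, `|h| < 1 -> `|flat p h| <= C * h ^+ 2.
Proof.
have [A A0 HA] := poly_bound p.
pose n := (size p).+1.
exists (A * n.+1`!%:R) => h h1; rewrite /flat; case: ifPn => h0; last first.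
  by rewrite normr0 mulr_ge0 ?sqr_ge0// mulr_ge0.
have hV : 1 <= h^-1 by rewrite invf_ge1// ltW// -(gtr0_norm h0).
have hV0 : 0 < h^-1 by rewrite invr_gt0.
rewrite normrM [`|expR _|]gtr0_norm ?expR_gt0// expRN.
have := @expR_ge1Dxn R h^-1 n (ltW hV0).
move=> e1; have {}e1 : h^-1 ^+ n.+1 / n.+1`!%:R <= expR h^-1 by lra.
have f0 : 0 < n.+1`!%:R :> R by rewrite ltr0n fact_gt0.
have p0 : 0 < h^-1 ^+ n.+1 / n.+1`!%:R by rewrite divr_gt0// exprn_gt0.
apply: (@le_trans _ _ (A * h^-1 ^+ size p * (h^-1 ^+ n.+1 / n.+1`!%:R)^-1)).
  rewrite ler_pM ?invr_ge0 ?expR_ge0 ?HA// lef_pV2 ?posrE ?expR_gt0//.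
rewrite le_eqVlt; apply/orP; left; apply/eqP.
rewrite invf_div /n !exprVn !exprS; field.
by rewrite expf_neq0 gt_eqF.
Qed.

Lemma flat_derive p (x : R) : is_derive x 1 (flat p) (flat ('X ^+ 2 * (p - p^`())) x).
Proof.
have [x0|x0|->] := ltgtP x 0.
- have -> : flat ('X ^+ 2 * (p - p^`())) x = 0 by rewrite /flat ltNge ltW.
  apply: (near_eq_is_derive (f := fun=> 0)).
  have : \forall y \near x, y < 0 by apply: open_nbhs_nbhs; split => //; exact: open_lt.
  by apply: filterS => y y0; rewrite /flat ltNge ltW.
- have -> : flat ('X ^+ 2 * (p - p^`())) x =
      (x^-1 ^+ 2 * (p.[x^-1] - p^`().[x^-1])) * expR (- x^-1).
    by rewrite /flat x0 hornerM hornerD hornerN hornerXn.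
  have : \forall y \near x, 0 < y by apply: open_nbhs_nbhs; split => //; exact: open_gt.
  move=> Hx.
  have near_flat : \forall y \near x, p.[y^-1] * expR (- y^-1) = flat p y.
    by apply: filterS Hx => y y0; rewrite /flat y0.
  have xn : x != 0 by rewrite gt_eqF.
  have dV : is_derive x 1 (fun y : R => y^-1) (- x^-1 ^+ 2).
    have := @is_deriveV _ (fun y : R => y) x 1 1 xn (is_derive_id x 1).
    by rewrite /GRing.scale /= mulr1 exprVn.
  have dp := @is_derive1_comp _ (fun y : R => p.[y]) (fun y : R => y^-1) x _ _
    (is_derive_poly p x^-1) dV.
  have dNV : is_derive x 1 (fun y : R => - y^-1) (x^-1 ^+ 2).
    by rewrite -[X in is_derive _ _ _ X]opprK; exact: is_deriveN.
  have de := @is_derive1_comp _ (@expR R) (fun y : R => - y^-1) x _ _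
    (is_derive_expR _) dNV.
  have dp' : is_derive x 1 (fun y : R => p.[y^-1]) _ := dp.
  have de' : is_derive x 1 (fun y : R => expR (- y^-1)) _ := de.
  apply: (near_eq_is_derive near_flat).
  by apply: is_derive_eq; rewrite /GRing.scale /=; ring.
- rewrite [X in is_derive _ _ _ X](_ : _ = 0); last by rewrite /flat ltxx.
  have [C HC] := flat_bound p.
  by apply: is_derive0_sqr HC; rewrite /flat ltxx.
Qed.

Lemma smooth1_flat p : smooth1 (flat p).
Proof.
move=> n; elim: n p => // n IH p.
by apply: nderivable_is_derive (IH _); exact: flat_derive.
Qed.

End smooth_functions_1d.

(** * Smooth bumps on squares *)

Section bump.
Context {R : realType}.
Local Notation P := (R * R)%type.
Implicit Types (f p q : R -> R).

Definition csmooth f := smooth1 f /\ exists M : R, forall x, M < `|x| -> f x = 0.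

Lemma csmooth_derive f : csmooth f -> csmooth (derive1 f).
Proof.
move=> [sf [M HM]]; split; first exact: smooth1_derive.
exists M => x Mx; rewrite derive1E.
have : \forall y \near x, M < `|y|.
  apply: (@norm_continuous _ _ x [set y | M < y]).
  by apply: open_nbhs_nbhs; split => //; exact: open_gt.
move=> near_x; have E : \forall y \near x, cst 0 y = f y.
  by apply: filterS near_x => y My; rewrite HM.
by rewrite -(near_eq_derive _ E) derive_cst.
Qed.

Lemma csmooth_bounded f : csmooth f -> exists2 B, 0 <= B & forall x, `|f x| <= B.
Proof.
move=> [sf [M HM]].
have cf := smooth1_continuous sf.
pose N := Num.max M 0.
have N0 : - N <= N by rewrite ge0_cp// /N le_max lexx orbT.
have [c _ Hc] := @EVT_max _ (fun x => `|f x|) (- N) N N0 ltac:(by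
  apply: continuous_subspaceT => x; apply: continuous_comp; [exact: cf|exact: norm_continuous]).
exists `|f c| => // x.
have [xN|xN] := leP `|x| N; first by apply: Hc; rewrite in_itv /= -ler_norml.
by rewrite HM ?normr0// (le_lt_trans _ xN)// /N le_max lexx.
Qed.

(** Taylor's formula; the third derivative is bounded, so the constant is uniform. *)
Lemma csmooth_second_difference f : csmooth f -> exists2 L, 0 <= L &
  forall x t, `|f (x + t) + f (x - t) - 2 * f x - derive1 (derive1 f) x * t ^+ 2|
    <= L * `|t| ^+ 3.
Proof.
move=> sf; have sf1 := csmooth_derive sf; have sf2 := csmooth_derive sf1.
have [B B0 HB] := csmooth_bounded (csmooth_derive sf2).
pose f2 : R -> R := derive1 (derive1 f).
have lip x s : `|f2 (x + s) - f2 x| <= B * `|s|.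
  have d2 (u : R) : is_derive u 1 f2 (derive1 f2 u).
    by apply: is_derive_derive1; apply: smooth1_derivable; case: sf2.
  have mv a b : a <= b -> `|f2 b - f2 a| <= B * (b - a).
    move=> ab; have c2 : {within `[a, b], continuous f2}.
      by apply: continuous_subspaceT; apply: smooth1_continuous; case: sf2.
    have [c _ ->] := @MVT_segment _ f2 (derive1 f2) a b ab (fun u _ => d2 u) c2.
    by rewrite normrM [`|b - a|]ger0_norm ?subr_ge0// ler_wpM2r ?subr_ge0.
  have [s0|s0] := leP 0 s.
    have := mv x (x + s) ltac:(by rewrite lerDl).
    by rewrite (ger0_norm s0) (addrC x) addrK.
  have h := mv (x + s) x ltac:(by rewrite gerDl ltW).
  have e : x - (x + s) = `|s| by rewrite (ltr0_norm s0) opprD addrA subrr add0r.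
  by rewrite e distrC in h.
exists (4 * B) => [|x t]; first lra.
have [->|t0] := eqVneq t 0.
  rewrite (_ : _ - _ = 0); last by rewrite addr0 subr0 expr0n /=; ring.
  by rewrite normr0 mulr_ge0// ?exprn_ge0//; lra.
have tp : 0 < `|t| by rewrite normr_gt0.
have := @second_difference_1d _ f (derive1 f) f2 x (2 * `|t|) (f2 x) (B * (2 * `|t|)) _ t.
move=> H; apply: le_trans (H _ _) _.
- move=> s st; split.
  + by apply: is_derive_derive1; apply: smooth1_derivable; case: sf.
  + by apply: is_derive_derive1; apply: smooth1_derivable; case: sf1.
  + by rewrite (le_trans (lip x s))// ler_wpM2l// ltW.
- lra.
- have -> : t ^+ 2 = `|t| ^+ 2 by rewrite real_normK// num_real.
  by rewrite le_eqVlt; apply/orP; left; apply/eqP; ring.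
Qed.

(** Every partial derivative of a product of one-variable functions is again such a
    product, so smoothness in the plane reduces to smoothness on the line. *)
Definition tensor p q (y : P) : R := p y.1 * q y.2.

Lemma pdx_tensor p q y : smooth1 p -> pdx (tensor p q) y (tensor (derive1 p) q y).
Proof.
move=> sp; rewrite /pdx /tensor /=.
have d := is_derive_derive1 (@smooth1_derivable _ p y.1 sp).
by apply: is_derive_eq; rewrite /GRing.scale /=; ring.
Qed.

Lemma pdy_tensor p q y : smooth1 q -> pdy (tensor p q) y (tensor p (derive1 q) y).
Proof.
move=> sp; rewrite /pdy /tensor /=.
have d := is_derive_derive1 (@smooth1_derivable _ q y.2 sp).
by apply: is_derive_eq; rewrite /GRing.scale /=; ring.
Qed.

Lemma dx_tensor p q : smooth1 p -> dx (tensor p q) = tensor (derive1 p) q.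
Proof. by move=> sp; apply/funext => y; apply: pdx_dx; exact: pdx_tensor. Qed.

Lemma dy_tensor p q : smooth1 q -> dy (tensor p q) = tensor p (derive1 q).
Proof. by move=> sp; apply/funext => y; apply: pdy_dy; exact: pdy_tensor. Qed.

Lemma partials_tensor p q s : smooth1 p -> smooth1 q ->
  exists p' q', [/\ smooth1 p', smooth1 q' & partials s (tensor p q) = tensor p' q'].
Proof.
move=> sp sq; elim: s => [|b s [p' [q' [sp' sq' /= ->]]]]; first by exists p, q.
case: b.
  by exists (derive1 p'), q'; split => //; [exact: smooth1_derive|exact: dx_tensor].
by exists p', (derive1 q'); split => //; [exact: smooth1_derive|exact: dy_tensor].
Qed.

Lemma differentiable_fst (y : P) : differentiable (fst : P -> R) y.
Proof.
by apply: (@linear_differentiable R P R fst) => z; exact: cvg_fst.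
Qed.

Lemma differentiable_snd (y : P) : differentiable (snd : P -> R) y.
Proof.
by apply: (@linear_differentiable R P R snd) => z; exact: cvg_snd.
Qed.

Lemma differentiable_tensor p q y : smooth1 p -> smooth1 q -> differentiable (tensor p q) y.
Proof.
move=> sp sq; apply: differentiableM.
  apply: (@differentiable_comp _ _ _ _ fst p); first exact: differentiable_fst.
  by apply/derivable1_diffP; exact: smooth1_derivable.
apply: (@differentiable_comp _ _ _ _ snd q); first exact: differentiable_snd.
by apply/derivable1_diffP; exact: smooth1_derivable.
Qed.

Lemma smooth_tensor p q : smooth1 p -> smooth1 q -> smooth (tensor p q).
Proof.
move=> sp sq s z; have [p' [q' [sp' sq' ->]]] := partials_tensor s sp sq.
exact: differentiable_tensor.
Qed.

Lemma laplacian_tensor p q y : smooth1 p -> smooth1 q ->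
  laplacian (tensor p q) y =
  tensor (derive1 (derive1 p)) q y + tensor p (derive1 (derive1 q)) y.
Proof.
move=> sp sq; rewrite /laplacian dx_tensor// dy_tensor// dx_tensor ?dy_tensor//;
  exact: smooth1_derive.
Qed.

Lemma sdiff_tensor p q : csmooth p -> csmooth q -> exists2 L, 0 <= L &
  forall y t, `|sdiff (tensor p q) t y - laplacian (tensor p q) y * t ^+ 2| <= L * `|t| ^+ 3.
Proof.
move=> sp sq.
have [Lp Lp0 HLp] := csmooth_second_difference sp.
have [Lq Lq0 HLq] := csmooth_second_difference sq.
have [Bp Bp0 HBp] := csmooth_bounded sp.
have [Bq Bq0 HBq] := csmooth_bounded sq.
exists (Lp * Bq + Bp * Lq) => [|y t]; first by rewrite addr_ge0 ?mulr_ge0.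
rewrite laplacian_tensor; [|by case: sp|by case: sq].
rewrite /sdiff /tensor /=.
have rid (a1 a2 a a'' b1 b2 b b'' s : R) :
   a1 * b + a2 * b + a * b1 + a * b2 - 4 * (a * b) - (a'' * b + a * b'') * s =
   (a1 + a2 - 2 * a - a'' * s) * b + a * (b1 + b2 - 2 * b - b'' * s) by ring.
rewrite rid.
rewrite [leRHS]mulrDl; apply: le_trans (ler_normD _ _) _; apply: lerD; rewrite normrM.
  by rewrite mulrAC ler_pM.
by rewrite -mulrA ler_pM.
Qed.

Definition cutoff (x : R) : R := flat 1 (1 + x) * flat 1 (1 - x).

Lemma csmooth_cutoff : csmooth cutoff.
Proof.
split.
  move=> n; apply: nderivableM.
    rewrite (_ : (fun x => _) = fun x => flat 1 (1 * x + 1)); last first.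
      by apply/funext => x; rewrite mul1r addrC.
    by apply: nderivable_affine; exact: smooth1_flat.
  rewrite (_ : (fun x => _) = fun x => flat 1 (- 1 * x + 1)); last first.
    by apply/funext => x; rewrite mulN1r addrC.
  by apply: nderivable_affine; exact: smooth1_flat.
exists 1 => x; rewrite ltr_normr /cutoff /flat => /orP[x1|x1].
  by rewrite [in X in _ * X]ifF ?mulr0//; apply/negbTE; rewrite -leNgt; lra.
by rewrite ifF ?mul0r//; apply/negbTE; rewrite -leNgt; lra.
Qed.

Lemma cutoff_ge0 x : 0 <= cutoff x.
Proof.
by apply: mulr_ge0; rewrite /flat; case: ifP => // _; rewrite hornerC mul1r expR_ge0.
Qed.

Lemma cutoff_gt0 x : `|x| < 1 -> 0 < cutoff x.
Proof.
rewrite ltr_norml => /andP[x1 x2].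
by apply: mulr_gt0; rewrite /flat ifT ?hornerC ?mul1r ?expR_gt0//; lra.
Qed.

Lemma cutoff_eq0 x : 1 <= `|x| -> cutoff x = 0.
Proof.
rewrite ler_normr /cutoff /flat => /orP[x1|x1].
  by rewrite [in X in _ * X]ifF ?mulr0//; apply/negbTE; rewrite -leNgt; lra.
by rewrite ifF ?mul0r//; apply/negbTE; rewrite -leNgt; lra.
Qed.

Lemma csmooth_affine f (a b : R) : a != 0 -> csmooth f -> csmooth (fun x => f (a * x + b)).
Proof.
move=> a0 [sf [M HM]]; split; first by move=> n; exact: nderivable_affine.
exists ((M + `|b|) / `|a|) => x.
rewrite ltr_pdivrMr ?normr_gt0// => h; apply: HM.
have := lerB_normD (a * x) b; rewrite normrM; lra.
Qed.

(** The argument is (x - c) / e, written as an affine function of [x]. *)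
Definition bump1 (e c x : R) : R := cutoff (e^-1 * x - c / e).

(** A test function, positive exactly on the open square of centre [c] and radius [e]. *)
Definition bump (e : R) (c : P) : P -> R := tensor (bump1 e c.1) (bump1 e c.2).

Lemma bump1E e c x : bump1 e c x = cutoff ((x - c) / e).
Proof. by rewrite /bump1 mulrBl mulrC. Qed.

Lemma csmooth_bump1 e c : 0 < e -> csmooth (bump1 e c).
Proof.
by move=> e0; apply: csmooth_affine csmooth_cutoff; rewrite invr_eq0 gt_eqF.
Qed.

Lemma smooth1_bump1 e c : 0 < e -> smooth1 (bump1 e c).
Proof. by move=> /(csmooth_bump1 c)[]. Qed.

Lemma bump_shift e c y : bump e c y = bump e 0 (y - c).
Proof. by rewrite /bump /tensor !bump1E /= !subr0. Qed.

Lemma bump_ge0 e c y : 0 <= bump e c y.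
Proof. by rewrite mulr_ge0// bump1E cutoff_ge0. Qed.

Lemma bump_gt0 e c y : 0 < e -> `|y - c| < e -> 0 < bump e c y.
Proof.
move=> e0; rewrite prod_normE gt_max /= => /andP[h1 h2].
by rewrite mulr_gt0// bump1E cutoff_gt0// normrM normfV (gtr0_norm e0) ltr_pdivrMr ?mul1r.
Qed.

Lemma bump_eq0 e c y : 0 < e -> e <= `|y - c| -> bump e c y = 0.
Proof.
move=> e0; rewrite prod_normE le_max /= => /orP[h|h]; rewrite /bump /tensor !bump1E.
  by rewrite cutoff_eq0 ?mul0r// normrM normfV (gtr0_norm e0) ler_pdivlMr ?mul1r.
by rewrite [X in _ * X]cutoff_eq0 ?mulr0// normrM normfV (gtr0_norm e0) ler_pdivlMr ?mul1r.
Qed.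

Lemma continuous_tensor p q y : smooth1 p -> smooth1 q -> {for y, continuous (tensor p q)}.
Proof. by move=> sp sq; apply: differentiable_continuous; exact: differentiable_tensor. Qed.

Lemma continuous_bump e c y : 0 < e -> {for y, continuous (bump e c)}.
Proof. by move=> e0; apply: continuous_tensor; exact: smooth1_bump1. Qed.

Lemma bounded_bump e : 0 < e -> exists2 B, 0 <= B & forall c y, `|bump e c y| <= B.
Proof.
move=> e0; have [B B0 HB] := csmooth_bounded (csmooth_bump1 0 e0).
exists (B * B) => [|c y]; first exact: mulr_ge0.
by rewrite bump_shift normrM ler_pM.
Qed.

Lemma laplacian_bump_shift e c y : 0 < e ->
  laplacian (bump e c) y = laplacian (bump e 0) (y - c).
Proof.
move=> e0; rewrite !laplacian_tensor; try exact: smooth1_bump1.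
have E (a x : R) : derive1 (derive1 (bump1 e a)) x = derive1 (derive1 (bump1 e 0)) (x - a).
  have D (f : R -> R) (u : R) : (forall v, derivable f v 1) ->
      derive1 (fun v => f (v - a)) u = derive1 f (u - a).
    move=> df; rewrite (_ : (fun v => f (v - a)) = fun v => f (- a + v)); last first.
      by apply/funext => v; rewrite addrC.
    have := @is_derive_shift _ f (- a) u _ (is_derive_derive1 (df (- a + u))).
    by rewrite [u - a]addrC => -[_]; rewrite -derive1E.
  have E1 : bump1 e a = fun v => bump1 e 0 (v - a).
    by apply/funext => v; rewrite !bump1E subr0.
  have E2 : derive1 (bump1 e a) = fun v => derive1 (bump1 e 0) (v - a).
    by apply/funext => v; rewrite E1 D// => u; apply: smooth1_derivable; exact: smooth1_bump1.
  rewrite E2 D// => u; apply: smooth1_derivable; apply: smooth1_derive; exact: smooth1_bump1.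
have B (a x : R) : bump1 e a x = bump1 e 0 (x - a) by rewrite !bump1E subr0.
by rewrite /tensor /= (E c.1) (E c.2) (B c.1) (B c.2).
Qed.

Lemma continuous_laplacian_bump e c y : 0 < e -> {for y, continuous (laplacian (bump e c))}.
Proof.
move=> e0; have sb a := smooth1_bump1 a e0.
rewrite (_ : laplacian _ = fun y =>
  tensor (derive1 (derive1 (bump1 e c.1))) (bump1 e c.2) y +
  tensor (bump1 e c.1) (derive1 (derive1 (bump1 e c.2))) y); last first.
  by apply/funext => z; rewrite laplacian_tensor.
by apply: cvgD; apply: continuous_tensor => //; do 2 apply: smooth1_derive.
Qed.

Lemma bounded_laplacian_bump e : 0 < e ->
  exists2 B, 0 <= B & forall c y, `|laplacian (bump e c) y| <= B.
Proof.
move=> e0; have [B B0 HB] := csmooth_bounded (csmooth_bump1 0 e0).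
have [B' B'0 HB'] := csmooth_bounded (csmooth_derive (csmooth_derive (csmooth_bump1 0 e0))).
exists (B' * B + B * B') => [|c y]; first by rewrite addr_ge0// mulr_ge0.
rewrite laplacian_bump_shift// laplacian_tensor; try exact: smooth1_bump1.
rewrite (le_trans (ler_normD _ _))// lerD// normrM ler_pM//.
Qed.

(** The Laplacian is read off the second differences, which vanish near [y]. *)
Lemma laplacian_bump_eq0 e c y : 0 < e -> e < `|y - c| -> laplacian (bump e c) y = 0.
Proof.
move=> e0 ye.
have : \forall z \near y, e < `|z - c|.
  apply: (@continuous_plane_norm R y c [set x | e < x]).
  by apply: open_nbhs_nbhs; split => //; exact: open_gt.
move=> /nbhs_ballP[r /= r0 Hr].
have [L L0 HL] := sdiff_tensor (csmooth_bump1 c.1 e0) (csmooth_bump1 c.2 e0).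
pose l := laplacian (bump e c) y.
have Hl t : 0 < t -> t < r -> `|l| <= L * t.
  move=> t0 tr; have := HL y t.
  have B0 z : `|z - y| < r -> bump e c z = 0.
    move=> zr; apply: bump_eq0 => //; apply: ltW; apply: Hr.
    by rewrite -ball_normE /ball_ /= distrC.
  have nt (u v : R) : (u = t \/ u = - t \/ u = 0) -> (v = t \/ v = - t \/ v = 0) ->
      bump e c (y.1 + u, y.2 + v) = 0.
    move=> hu hv; apply: B0; rewrite prod_normE /= gt_max.
    have -> : y.1 + u - y.1 = u by ring. have -> : y.2 + v - y.2 = v by ring.
    by apply/andP; split; [case: hu => [|[]] ->|case: hv => [|[]] ->];
      rewrite ?normrN ?normr0// gtr0_norm.
  have e1 := nt t 0 ltac:(tauto) ltac:(tauto).
  have e2 := nt (- t) 0 ltac:(tauto) ltac:(tauto).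
  have e3 := nt 0 t ltac:(tauto) ltac:(tauto).
  have e4 := nt 0 (- t) ltac:(tauto) ltac:(tauto).
  rewrite !addr0 in e1 e2 e3 e4.
  rewrite /sdiff -/(bump e c) e1 e2 e3 e4 B0; last by rewrite subrr normr0.
  rewrite mulr0 subr0 !addr0 sub0r normrN normrM -/l (gtr0_norm t0).
  rewrite [`|t ^+ 2|]ger0_norm ?sqr_ge0//.
  have -> : L * t ^+ 3 = (L * t) * t ^+ 2 by ring.
  by rewrite ler_pM2r// exprn_gt0.
apply/eqP; rewrite -normr_le0 -/l; apply/ler_addgt0Pr => d d0; rewrite add0r.
have m0 : 0 < Num.min (r / 2) (d / (L + 1)) by rewrite lt_min !divr_gt0//; lra.
have := Hl _ m0 _; rewrite gt_min => /(_ ltac:(apply/orP; left; lra)) h.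
apply: le_trans h _; apply: (@le_trans _ _ (L * (d / (L + 1)))).
  by rewrite ler_wpM2l// ge_min lexx orbT.
by rewrite mulrA ler_pdivrMr; nra.
Qed.

Lemma test_function_bump (D : set P) e c : 0 < e ->
  (forall y, `|y - c| <= e -> D y) -> test_function D (bump e c).
Proof.
move=> e0 HD; split; first by apply: smooth_tensor; exact: smooth1_bump1.
exists [set y | `|y - c| <= e]; split.
- exact: compact_box.
- by move=> y /HD.
- by move=> y /negP; rewrite -ltNge => h; apply: bump_eq0 => //; exact: ltW.
Qed.

Lemma sdiff_bump e : 0 < e -> exists2 L, 0 <= L &
  forall c y t, `|sdiff (bump e c) t y - laplacian (bump e c) y * t ^+ 2| <= L * `|t| ^+ 3.
Proof.
move=> e0; have [L L0 HL] := sdiff_tensor (csmooth_bump1 0 e0) (csmooth_bump1 0 e0).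
exists L; [exact: L0|move=> c y t]; rewrite (laplacian_bump_shift c y e0).
have E : sdiff (bump e c) t y = sdiff (bump e 0) t (y - c).
  have A (a b : R) : ((a, b) - c : P) = (a - c.1, b - c.2) by [].
  rewrite /sdiff !(bump_shift e c) !A.
  by congr (_ + _ + _ + _ - _); congr (bump _ _ (_, _)); rewrite /=; ring.
rewrite E; exact: HL.
Qed.

End bump.

(** * The Laplacian against test functions *)

Section weak_laplacian.
Context {R : realType}.
Local Notation P := (R * R)%type.

Lemma L1M_bounded (f g : P -> R) B : mfun g -> (forall z, `|g z| <= B) -> L1 f ->
  L1 (fun z => g z * f z).
Proof.
move=> mg gB Lf; apply: (@L1_le _ _ (fun z => B * `|f z|)).
- by apply: measurable_funM => //; exact: L1_mfun.
- by apply: L1Z; exact: L1_norm.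
- by move=> z; rewrite normrM ler_wpM2r.
Qed.

Lemma pint_eq (f g : P -> R) : (forall z, f z = g z) -> pint f = pint g.
Proof. by move=> /funext ->. Qed.

Lemma L1_eq (f g : P -> R) : (forall z, f z = g z) -> L1 f -> L1 g.
Proof. by move=> /funext ->. Qed.

Lemma mfun_bump e (c : P) : 0 < e -> mfun (bump e c).
Proof. by move=> e0; apply: mfun_continuous => z; exact: continuous_bump. Qed.

Lemma mfun_laplacian_bump e (c : P) : 0 < e -> mfun (laplacian (bump e c)).
Proof. by move=> e0; apply: mfun_continuous => z; exact: continuous_laplacian_bump. Qed.

Lemma L1_box (c : P) (e : R) : 0 <= e -> L1 (fun y => if `|y - c| <= e then 1 else 0).
Proof.
move=> e0; pose B := [set v : P | `|v| <= e].
have LB : L1 (\1_B : P -> R).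
  apply/integrableP; split; first by apply/measurable_EFinP; apply: measurable_indic; exact: measurable_closed_box.
  rewrite [X in (X < _)%E](_ : _ = plane_area B).
    by rewrite [X in (X < _)%E](plane_area_closed_box e0) ltry.
  transitivity (\int[plane_area]_x (\1_B x)%:E)%E.
    by apply: eq_integral => x _; rewrite /= ger0_norm.
  by rewrite integral_indic ?setIT//; exact: measurable_closed_box.
have := L1_shift (- c) LB; apply: L1_eq => z.
rewrite indicE; case: ifP => h; first by rewrite mem_set.
by rewrite memNset//= /B /= h.
Qed.

Lemma L1_bounded_box (f : P -> R) (c : P) (e B : R) : 0 <= e -> mfun f ->
  (forall y, `|f y| <= B) -> (forall y, e < `|y - c| -> f y = 0) -> L1 f.
Proof.
move=> e0 mf fB f0; have := L1M_bounded mf fB (L1_box c e0).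
apply: L1_eq => y; case: ifP => [_|/negbT]; first by rewrite mulr1.
by rewrite -ltNge mulr0 => /f0.
Qed.

Lemma L1_bump e (c : P) : 0 < e -> L1 (bump e c).
Proof.
move=> e0; have [B _ HB] := bounded_bump e0.
apply: (@L1_bounded_box _ c e B) => //; [exact: ltW|exact: mfun_bump|].
by move=> y /ltW; exact: bump_eq0.
Qed.

Lemma pint_mul_shift (f g : P -> R) (v : P) B : L1 f -> mfun g ->
  (forall z, `|g z| <= B) ->
  pint (fun y => g (y + v) * f y) = pint (fun y => g y * f (y - v)).
Proof.
move=> Lf mg gB; rewrite -(@pint_shift _ v (fun y => g y * f (y - v))).
  by apply: pint_eq => y; rewrite addrK.
by apply: L1M_bounded gB _ => //; exact: L1_shift.
Qed.

Lemma pint_sum5 (f1 f2 f3 f4 f5 : P -> R) : L1 f1 -> L1 f2 -> L1 f3 -> L1 f4 -> L1 f5 ->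
  pint (fun y => f1 y + f2 y + f3 y + f4 y - 4 * f5 y) =
  pint f1 + pint f2 + pint f3 + pint f4 - 4 * pint f5.
Proof.
move=> l1 l2 l3 l4 l5; have l12 := L1D l1 l2; have l123 := L1D l12 l3.
rewrite (pintB (L1D l123 l4) (L1Z 4 l5)) (pintD l123 l4) (pintD l12 l3) (pintD l1 l2).
by rewrite pintZ.
Qed.

Lemma sdiffE (f : P -> R) t z : sdiff f t z =
  f (z + (t, 0)) + f (z - (t, 0)) + f (z + (0, t)) + f (z - (0, t)) - 4 * f z.
Proof.
have A (a b : R) : (z + (a, b) : P) = (z.1 + a, z.2 + b) by [].
have B (a b : R) : (z - (a, b) : P) = (z.1 - a, z.2 - b) by [].
by rewrite (A t 0) (A 0 t) (B t 0) (B 0 t) !addr0 !subr0.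
Qed.

Lemma L1_sdiff (f : P -> R) t : L1 f -> L1 (sdiff f t).
Proof.
move=> Lf; have Ls v := L1_shift v Lf.
have := L1B (L1D (L1D (L1D (Ls (t, 0)) (Ls (- (t, 0)))) (Ls (0, t))) (Ls (- (0, t)))) (L1Z 4 Lf).
by apply: L1_eq => y; rewrite sdiffE.
Qed.

Lemma pint_sdiff (f g : P -> R) t B : L1 f -> mfun g -> (forall z, `|g z| <= B) ->
  pint (fun y => sdiff g t y * f y) = pint (fun y => g y * sdiff f t y).
Proof.
move=> Lf mg gB.
have Lg v : L1 (fun y => g (y + v) * f y).
  by apply: L1M_bounded (fun z => gB (z + v)) Lf; exact: mfun_shift.
have Lg' v : L1 (fun y => g y * f (y + v)).
  by apply: L1M_bounded gB _ => //; exact: L1_shift.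
have L0 := L1M_bounded mg gB Lf.
rewrite (pint_eq (g := fun y => g (y + (t, 0)) * f y + g (y + - (t, 0)) * f y
   + g (y + (0, t)) * f y + g (y + - (0, t)) * f y - 4 * (g y * f y))); last first.
  by move=> y; rewrite sdiffE; ring.
rewrite [RHS](pint_eq (g := fun y => g y * f (y + (t, 0)) + g y * f (y + - (t, 0))
   + g y * f (y + (0, t)) + g y * f (y + - (0, t)) - 4 * (g y * f y))); last first.
  by move=> y; rewrite sdiffE; ring.
rewrite (pint_sum5 (Lg _) (Lg _) (Lg _) (Lg _) L0).
rewrite (pint_sum5 (Lg' _) (Lg' _) (Lg' _) (Lg' _) L0).
rewrite !(pint_mul_shift _ Lf mg gB) !opprK; ring.
Qed.

(** Second differences move from one factor to the other under the integral, so a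
    pointwise lower bound on the Laplacian becomes a weak one after testing
    against a nonnegative bump. *)
Lemma weak_laplacian_ge (F L : P -> R) (c : P) (e e' : R) : 0 < e -> e < e' ->
  L1 (fun y => if `|y - c| < e' then F y else 0) ->
  L1 (fun y => L y * bump e c y) ->
  (forall y, `|y - c| <= e -> {for y, continuous L} /\ lap_ge F y (L y)) ->
  pint (fun y => L y * bump e c y) <= pint (fun y => laplacian (bump e c) y * F y).
Proof.
move=> e0 ee'; set F1 := (X in L1 X) => LF LL HL.
pose phi := bump e c.
have [B B0 HB] := bounded_bump e0.
have [C C0 HC] := sdiff_bump e0.
have [B' B'0 HB'] := bounded_laplacian_bump e0.
have -> : pint (fun y => laplacian phi y * F y) = pint (fun y => laplacian phi y * F1 y).
  apply: pint_eq => y; rewrite /F1; case: ifP => // /negbT; rewrite -leNgt => h.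
  by rewrite /phi laplacian_bump_eq0 ?mul0r// (lt_le_trans ee').
have near1 y : `|y - c| <= e -> \forall z \near y, F z = F1 z.
  move=> ye; have : \forall z \near y, `|z - c| < e'.
    apply: (@continuous_plane_norm R y c [set x | x < e']).
    apply: open_nbhs_nbhs; split; [exact: open_lt|exact: le_lt_trans ee'].
  by apply: filterS => z ze; rewrite /F1 ze.
have Lphi := L1_bump c e0.
apply/ler_addgt0Pr => d d0.
pose m := pint phi; have m0 : 0 <= m by apply: pint_ge0 => y; exact: bump_ge0.
pose N := pint (fun y => `|F1 y|); have N0 : 0 <= N by apply: pint_ge0.
pose dl := d / (2 * (m + 1)).
have dl0 : 0 < dl by rewrite divr_gt0//; lra.
have dlm : dl * m <= d / 2.
  rewrite /dl mulrAC ler_pdivrMr; last lra.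
  by nra.
have cover : \forall t \near (0 : R), [set y | `|y - c| <= e] `<=`
    [set y | (L y - dl) * t ^+ 2 <= sdiff F1 t y].
  have Hc := (compact_near_coveringP _).1 (@compact_box R c e).
  apply: (Hc R (nbhs (0 : R)) (fun t y => (L y - dl) * t ^+ 2 <= sdiff F1 t y)) => y ye.
  have [cL lF] := HL _ ye.
  have lF1 := lap_ge_near_eq (near1 _ ye) lF.
  have dl2 : 0 < dl / 2 by lra.
  have nL : \forall z \near y, L z < L y + dl / 2.
    apply: (cL [set x | x < L y + dl / 2]); apply: open_nbhs_nbhs.
    by split; [exact: open_lt|rewrite /=; lra].
  apply: filterS (filterI (near_translate nL) (lF1 _ dl2)) => -[z t] /= [[_ _ _ _ Lz]].
  apply: le_trans; have := sqr_ge0 t; nra.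
have [t [t0 Ht tsmall]] : exists t, [/\ 0 < t,
   (forall y, `|y - c| <= e -> (L y - dl) * t ^+ 2 <= sdiff F1 t y) &
   C * t * N <= d / 2].
  move: cover => /nbhs_ballP[r /= r0 Hr].
  have K0 : 0 < 2 * (C * N + 1) by have := mulr_ge0 C0 N0; lra.
  exists (Num.min (r / 2) (d / (2 * (C * N + 1)))).
  have t0 : 0 < Num.min (r / 2) (d / (2 * (C * N + 1))).
    by rewrite lt_min !divr_gt0.
  split => //.
    move=> y ye; apply: (Hr (Num.min (r / 2) (d / (2 * (C * N + 1)))) _ y ye).
    rewrite -ball_normE /ball_ /= sub0r normrN gtr0_norm//.
    by rewrite gt_min; apply/orP; left; lra.
  apply: (@le_trans _ _ (C * N * (d / (2 * (C * N + 1))))).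
    by rewrite mulrAC ler_wpM2l ?mulr_ge0// ge_min lexx orbT.
  rewrite mulrA ler_pdivrMr//; have := mulr_ge0 C0 N0; nra.
have LS : L1 (fun y => sdiff phi t y * F1 y).
  have Bs y : `|sdiff phi t y| <= C * `|t| ^+ 3 + B' * t ^+ 2.
    have := HC c y t; have := HB' c y; rewrite -/phi => h1 h2.
    have -> : sdiff phi t y = (sdiff phi t y - laplacian phi y * t ^+ 2) + laplacian phi y * t ^+ 2.
      by rewrite subrK.
    rewrite (le_trans (ler_normD _ _))// lerD// normrM [`|t ^+ 2|]ger0_norm ?sqr_ge0//.
    by rewrite ler_wpM2r ?sqr_ge0.
  by apply: L1M_bounded Bs LF; apply: L1_mfun; exact: L1_sdiff.
have Ll : L1 (fun y => laplacian phi y * F1 y).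
  by apply: L1M_bounded (HB' c) LF; exact: mfun_laplacian_bump.
have LS2 : L1 (fun y => phi y * sdiff F1 t y).
  apply: L1M_bounded (HB c) _; first exact: mfun_bump.
  exact: L1_sdiff.
have step1 : t ^+ 2 * (pint (fun y => L y * phi y) - dl * m) <= pint (fun y => phi y * sdiff F1 t y).
  rewrite -pintZ// -pintB//; last exact: L1Z.
  rewrite -pintZ; last by apply: L1B => //; exact: L1Z.
  apply: pint_le => //; first by apply: L1Z; apply: L1B => //; exact: L1Z.
  move=> y; have [ye|ye] := leP `|y - c| e.
    by have := ler_wpM2l (bump_ge0 e c y) (Ht y ye); rewrite -/phi; lra.
  by rewrite /phi bump_eq0 ?(ltW ye)//; lra.
have step2 : pint (fun y => sdiff phi t y * F1 y) <= t ^+ 2 * pint (fun y => laplacian phi y * F1 y) + C * t ^+ 3 * N.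
  rewrite -pintZ// -pintZ; last exact: L1_norm.
  rewrite -pintD; [|exact: L1Z|by apply: L1Z; exact: L1_norm].
  apply: pint_le => //.
    by apply: L1D; [exact: L1Z|by apply: L1Z; exact: L1_norm].
  move=> y; have := HC c y t; rewrite -/phi (gtr0_norm t0) => h.
  have h2 : (sdiff phi t y - laplacian phi y * t ^+ 2) * F1 y <= C * t ^+ 3 * `|F1 y|.
    by rewrite (le_trans (ler_norm _))// normrM ler_wpM2r.
  lra.
rewrite -(pint_sdiff t LF (mfun_bump c e0) (HB c)) in step1.
have t2 : 0 < t ^+ 2 by rewrite exprn_gt0.
have := le_trans step1 step2.
have -> : C * t ^+ 3 * N = t ^+ 2 * (C * t * N) by ring.
rewrite -mulrDr ler_pM2l// -/phi; lra.
Qed.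

End weak_laplacian.

(** * The logarithm as a fundamental solution *)

Section poisson_mass.
Context {R : realType}.
Local Notation P := (R * R)%type.
Local Notation leb := (@lebesgue_measure R).

Lemma cvgy_bound (F : R -> R) l C : (forall x, 1 <= x -> `|l - F x| <= C / x) ->
  F x @[x --> +oo] --> l.
Proof.
move=> HF; apply/cvgrPdist_le => d d0; near=> x.
have x1 : 1 <= x by near: x; exact: nbhs_pinfty_ge.
have xC : C / d <= x by near: x; apply: nbhs_pinfty_ge; exact: num_real.
apply: le_trans (HF _ x1) _; rewrite ler_pdivrMr; last lra.
by rewrite mulrC -ler_pdivrMr.
Unshelve. all: by end_near. Qed.

Lemma integral_even_primitive (f F : R -> R) (l : R) :
  (forall x, 0 <= f x) -> continuous f -> (forall x, f (- x) = f x) ->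
  (forall x : R, derivable F x 1 /\ 'D_1 F x = f x) -> F 0 = 0 -> F x @[x --> +oo] --> l ->
  (\int[leb]_x (f x)%:E = (2 * l)%:E)%E.
Proof.
move=> f0 cf ef dF F0 Fl.
rewrite ge0_symfun_integralT//; last by move=> x; rewrite /= ef.
rewrite -set_itvcy.
have dF1 (x : R) : derivable F x 1 by have [] := dF x.
rewrite (ge0_continuous_FTC2y (F := F) (l := l))//.
- by rewrite F0 sube0 EFinM.
- exact: continuous_subspaceT.
- apply: cvg_at_right_filter; apply: differentiable_continuous.
  exact/derivable1_diffP.
- by move=> x _; rewrite derive1E; have [_ ->] := dF x.
Qed.

(** The inner integral of [log_kernel_lap], from a primitive made of a rational function
    and an arctangent. *)
Lemma integral_inner (a c : R) : 0 < a -> 0 <= c ->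
  (\int[leb]_y (c / (y ^+ 2 + a) ^+ 2)%:E = (c * pi / (2 * a * Num.sqrt a))%:E)%E.
Proof.
move=> a0 c0.
have s0 : 0 < Num.sqrt a by rewrite sqrtr_gt0.
have sa : Num.sqrt a ^+ 2 = a by rewrite sqr_sqrtr// ltW.
have q0 (y : R) : 0 < y ^+ 2 + a by rewrite ltr_wpDl ?sqr_ge0.
pose F (y : R) := c * (y / (y ^+ 2 + a) / (2 * a) +
   atan ((Num.sqrt a)^-1 * y) / (2 * a * Num.sqrt a)).
rewrite (integral_even_primitive (F := F) (l := c * (pi / 2 / (2 * a * Num.sqrt a)))).
- congr EFin; field; rewrite !gt_eqF//.
- by move=> y; rewrite divr_ge0// exprn_ge0// ltW.
- move=> y; apply: cvgM; first exact: cvg_cst.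
  apply: cvgV; first by rewrite expf_neq0// gt_eqF.
  have cy : {for y, continuous (fun y : R => y ^+ 2 + a)}.
    by apply: cvgD; [exact: exprn_continuous|exact: cvg_cst].
  exact: (cvgM cy cy).
- by move=> y; rewrite sqrrN.
- move=> y; suff [] : is_derive y 1 F (c / (y ^+ 2 + a) ^+ 2) by [].
  have dq : is_derive y 1 (fun x : R => x ^+ 2 + a) (2 * y).
    by apply: is_derive_eq; rewrite /GRing.scale /=; ring.
  have n0 : (fun x : R => x ^+ 2 + a) y != 0 by rewrite gt_eqF.
  have dv' := @is_deriveV _ (fun x : R => x ^+ 2 + a) y _ _ n0 dq.
  have dv : is_derive y 1 (fun x : R => (x ^+ 2 + a)^-1) _ := dv'.
  have dl : is_derive y 1 (fun x : R => (Num.sqrt a)^-1 * x) (Num.sqrt a)^-1.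
    by apply: is_derive_eq; rewrite /GRing.scale /=; ring.
  have dt' := @is_derive1_comp _ (@atan R) (fun x : R => (Num.sqrt a)^-1 * x) y _ _
     (is_derive1_atan _) dl.
  have dt : is_derive y 1 (fun x : R => atan ((Num.sqrt a)^-1 * x)) _ := dt'.
  apply: is_derive_eq; rewrite /GRing.scale /=.
  rewrite exprMn exprVn sa; move: (Num.sqrt a) s0 sa => s s0 sa.
  rewrite -sa; move: (q0 y); rewrite -sa => q0'.
  by field; rewrite !gt_eqF//= addrC gt_eqF.
- by rewrite /F mul0r mulr0 atan0 !mul0r addr0 mulr0.
apply: cvgM; first exact: cvg_cst.
rewrite -[X in _ --> X]add0r; apply: cvgD.
  apply: (@cvgy_bound _ _ (2 * a)^-1) => x x1; rewrite sub0r normrN.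
  rewrite ger0_norm ?divr_ge0 ?(ltW (q0 x))//; [|lra|lra].
  rewrite mulrC ler_pM2l ?invr_gt0; last lra.
  have xp : 0 < x by lra.
  rewrite ler_pdivrMr// mulrDr expr2 mulKf ?gt_eqF// lerDl.
  by rewrite mulr_ge0 ?invr_ge0// ltW.
apply: cvgM; last exact: cvg_cst.
apply: (@cvg_comp _ _ _ (fun y => (Num.sqrt a)^-1 * y) (@atan R)); last exact: cvgy_atan.
by apply: gt0_cvgMry; rewrite ?invr_gt0//; exact: cvg_id.
Qed.

(** What remains is the density e^2 / (2 (x^2 + e^2)^(3/2)), with primitive
    x / (2 sqrt (x^2 + e^2)). *)
Lemma integral_outer (e : R) : 0 < e ->
  (\int[leb]_x (e ^+ 2 / pi * pi / (2 * (x ^+ 2 + e ^+ 2) * Num.sqrt (x ^+ 2 + e ^+ 2)))%:E = 1)%E.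
Proof.
move=> e0.
have e2 : 0 < e ^+ 2 by rewrite exprn_gt0.
have p0 : (pi : R) != 0 by rewrite gt_eqF// pi_gt0.
rewrite mulfVK//.
have q0 (y : R) : 0 < y ^+ 2 + e ^+ 2 by rewrite ltr_wpDl ?sqr_ge0.
have s0 y : 0 < Num.sqrt (y ^+ 2 + e ^+ 2) by rewrite sqrtr_gt0.
have sa y : Num.sqrt (y ^+ 2 + e ^+ 2) ^+ 2 = y ^+ 2 + e ^+ 2 by rewrite sqr_sqrtr// ltW.
pose F (y : R) := 2^-1 * (y / Num.sqrt (y ^+ 2 + e ^+ 2)).
have dq (y : R) : is_derive y 1 (fun x : R => x ^+ 2 + e ^+ 2) (2 * y).
  by apply: is_derive_eq; rewrite /GRing.scale /=; ring.
have ds (y : R) : is_derive y 1 (fun x : R => Num.sqrt (x ^+ 2 + e ^+ 2))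
   ((2 * Num.sqrt (y ^+ 2 + e ^+ 2))^-1 * (2 * y)).
  exact: (@is_derive1_comp _ (@Num.sqrt R) (fun x : R => x ^+ 2 + e ^+ 2) y _ _
     (is_derive1_sqrt (q0 y)) (dq y)).
rewrite (integral_even_primitive (F := F) (l := 2^-1)).
- by rewrite divff.
- by move=> y; rewrite divr_ge0// ?mulr_ge0// ltW.
- move=> y.
  have cy : {for y, continuous (fun y : R => y ^+ 2 + e ^+ 2)}.
    by apply: cvgD; [exact: exprn_continuous|exact: cvg_cst].
  have cs : {for y, continuous (fun y : R => Num.sqrt (y ^+ 2 + e ^+ 2))}.
    by apply: differentiable_continuous; apply/derivable1_diffP; have [] := ds y.
  apply: cvgM; first exact: cvg_cst.
  apply: cvgV; first by rewrite !mulf_neq0// gt_eqF.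
  by apply: cvgM => //; apply: cvgM => //; exact: cvg_cst.
- by move=> y; rewrite sqrrN.
- move=> y; suff [] : is_derive y 1 F (e ^+ 2 / (2 * (y ^+ 2 + e ^+ 2) * Num.sqrt (y ^+ 2 + e ^+ 2))) by [].
  have n0 : Num.sqrt (y ^+ 2 + e ^+ 2) != 0 by rewrite gt_eqF.
  have dv' := @is_deriveV _ (fun x : R => Num.sqrt (x ^+ 2 + e ^+ 2)) y _ _ n0 (ds y).
  have dv : is_derive y 1 (fun x : R => (Num.sqrt (x ^+ 2 + e ^+ 2))^-1) _ := dv'.
  apply: is_derive_eq; rewrite /GRing.scale /=.
  have := sa y; have := s0 y; move: (Num.sqrt _) => s ss sE.
  have -> : e ^+ 2 = s ^+ 2 - y ^+ 2 by rewrite sE; ring.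
  have -> : y ^+ 2 + (s ^+ 2 - y ^+ 2) = s ^+ 2 by ring.
  by field; rewrite gt_eqF.
- by rewrite /F mul0r mulr0.
rewrite -[X in _ --> X]mulr1; apply: cvgM; first exact: cvg_cst.
apply: (@cvgy_bound _ _ (e ^+ 2)) => x x1.
have := sa x; have := s0 x; have := q0 x; move: (Num.sqrt _) => s qq ss sE.
have xs : x <= s by nra.
rewrite ger0_norm; last by rewrite subr_ge0 ler_pdivrMr// mul1r.
rewrite ler_pdivlMr; last lra.
have us : x = x / s * s by rewrite divfK// gt_eqF.
have u1 : x / s <= 1 by rewrite ler_pdivrMr// mul1r.
have u0 : 0 <= x / s by rewrite divr_ge0//; lra.
have -> : e ^+ 2 = s ^+ 2 - x ^+ 2 by rewrite sE; ring.
move: us u1 u0; move: (x / s) => u us u1 u0.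
have s1 : 1 <= s by lra.
rewrite us.
have -> : s ^+ 2 - (u * s) ^+ 2 = (1 - u) * (s * s * (1 + u)) by ring.
have h1 : 0 <= 1 - u by lra.
apply: ler_wpM2l => //; nra.
Qed.

End poisson_mass.

Section fundamental_solution.
Context {R : realType}.
Local Notation P := (R * R)%type.
Local Notation pl := (measurableTypeR R * measurableTypeR R)%type.

Lemma log_kernel_lap_ge0 e (z : P) : 0 <= log_kernel_lap e z.
Proof. by rewrite divr_ge0 ?sqr_ge0// mulr_ge0 ?exprn_ge0 ?sqmod_ge0 ?pi_ge0. Qed.

Lemma continuous_log_kernel_lap e (z : P) : 0 < sqmod e z ->
  {for z, continuous (log_kernel_lap e)}.
Proof.
move=> q0; have cq := @continuous_sqmod R e z.
apply: cvgM; first exact: cvg_cst.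
apply: cvgV; first by rewrite gt_eqF// mulr_gt0 ?pi_gt0// exprn_gt0.
by apply: cvgM; [exact: cvg_cst|exact: (cvgM cq cq)].
Qed.

Lemma mfun_log_kernel_lap e : 0 < e -> mfun (@log_kernel_lap R e).
Proof.
move=> e0; apply: mfun_continuous => z; apply: continuous_log_kernel_lap.
exact: sqmod_gt0e.
Qed.

(** The mass does not depend on [e]; the constant 2 pi in the definition of the Green
    function is the one that makes it equal to 1. *)
Lemma integral_log_kernel_lap e : 0 < e ->
  (\int[plane_area]_z (@log_kernel_lap R e z)%:E = 1)%E.
Proof.
move=> e0; have e2 : 0 < e ^+ 2 by rewrite exprn_gt0.
have p0 : 0 < (pi : R) by exact: pi_gt0.
transitivity (\int[(@lebesgue_measure R \x @lebesgue_measure R)%E]_z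
   (@log_kernel_lap R e z)%:E)%E; first by [].
rewrite fubini_tonelli1; last 2 first.
- by apply/measurable_EFinP; exact: mfun_log_kernel_lap.
- by move=> z; rewrite lee_fin log_kernel_lap_ge0.
rewrite -[RHS](integral_outer e0); apply: eq_integral => x _.
rewrite /fubini_F.
have a0 : 0 < x ^+ 2 + e ^+ 2 by rewrite ltr_wpDl ?sqr_ge0.
have c0 : 0 <= e ^+ 2 / pi by rewrite divr_ge0// ltW.
rewrite -(integral_inner a0 c0); apply: eq_integral => y _.
rewrite /log_kernel_lap /sqmod /=; congr EFin.
by rewrite invfM mulrA; congr (_ / _); congr (_ ^+ 2); ring.
Qed.

Lemma L1_log_kernel_lap e : 0 < e -> L1 (@log_kernel_lap R e).
Proof.
move=> e0; apply/integrableP; split.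
  by apply/measurable_EFinP; exact: mfun_log_kernel_lap.
rewrite [X in (X < _)%E](_ : _ = 1%E) ?ltry//.
rewrite -[RHS](integral_log_kernel_lap e0); apply: eq_integral => z _.
by rewrite /= ger0_norm// log_kernel_lap_ge0.
Qed.

Lemma pint_log_kernel_lap e : 0 < e -> pint (@log_kernel_lap R e) = 1.
Proof. by move=> e0; rewrite /pint /Rintegral integral_log_kernel_lap. Qed.

(** The Euclidean modulus against the sup norm. *)
Lemma sqmod0_norm (z : P) : `|z| ^+ 2 <= sqmod 0 z <= 2 * `|z| ^+ 2.
Proof.
rewrite /sqmod expr0n addr0 prod_normE.
have h1 : z.1 ^+ 2 = `|z.1| ^+ 2 by rewrite real_normK// num_real.
have h2 : z.2 ^+ 2 = `|z.2| ^+ 2 by rewrite real_normK// num_real.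
rewrite h1 h2; have := normr_ge0 z.1; have := normr_ge0 z.2.
move: `|z.1| `|z.2| => a b b0 a0; have a2 := sqr_ge0 a; have b2 := sqr_ge0 b.
have [ab|/ltW ba] := leP a b.
  have : a ^+ 2 <= b ^+ 2 by rewrite lerXn2r.
  by move=> h; apply/andP; split; lra.
have : b ^+ 2 <= a ^+ 2 by rewrite lerXn2r.
by move=> h; apply/andP; split; lra.
Qed.

(** Away from the origin the density at scale [e] is of order e^2 / d^2 times the density
    at scale [d], so the mass it leaves there tends to 0 with [e]. *)
Lemma log_kernel_lap_tail e d (z : P) : 0 < e -> e <= d -> d <= `|z| ->
  log_kernel_lap e z <= 4 * e ^+ 2 / d ^+ 2 * log_kernel_lap d z.
Proof.
move=> e0 ed dz; have d0 : 0 < d by rewrite (lt_le_trans e0).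
have p0 : 0 < (pi : R) by exact: pi_gt0.
have /andP[h _] := sqmod0_norm z.
have hd : d ^+ 2 <= `|z| ^+ 2 by rewrite lerXn2r// nnegrE ?normr_ge0 // ltW.
have E : sqmod e z = sqmod 0 z + e ^+ 2 by rewrite /sqmod expr0n addr0.
have F : sqmod d z = sqmod 0 z + d ^+ 2 by rewrite /sqmod expr0n addr0.
have q0 : 0 < sqmod e z by exact: sqmod_gt0e.
have qd : 0 < sqmod d z by exact: sqmod_gt0e.
have le2 : sqmod d z <= 2 * sqmod e z by have := sqr_ge0 e; lra.
have key : (sqmod e z ^+ 2)^-1 <= 4 * (sqmod d z ^+ 2)^-1.
  rewrite -[leLHS]mul1r ler_pdivrMr ?exprn_gt0// mulrAC ler_pdivlMr ?exprn_gt0// mul1r.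
  nra.
have -> : 4 * e ^+ 2 / d ^+ 2 * log_kernel_lap d z = e ^+ 2 / pi * (4 * (sqmod d z ^+ 2)^-1).
  rewrite /log_kernel_lap; move: (pi : R) p0 (sqmod d z) qd => p p0 q qd'.
  by field; rewrite !gt_eqF.
have -> : log_kernel_lap e z = e ^+ 2 / pi * (sqmod e z ^+ 2)^-1.
  by rewrite /log_kernel_lap invfM mulrA.
by rewrite ler_wpM2l// divr_ge0 ?sqr_ge0// ltW.
Qed.

(** Densities of mass one that concentrate at the origin form an approximate identity. *)
Lemma log_kernel_lap_delta (phi : P -> R) B : mfun phi -> (forall z, `|phi z| <= B) ->
  {for (0 : P), continuous phi} ->
  forall d, 0 < d -> exists2 r, 0 < r & forall e, 0 < e -> e < r ->
    `|pint (fun z => log_kernel_lap e z * phi z) - phi 0| <= d.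
Proof.
move=> mphi phiB cphi d d0.
have d2 : 0 < d / 2 by lra.
have B0 : 0 <= B by rewrite (le_trans (normr_ge0 _) (phiB 0)).
have /nbhs_ballP[r /= r0 Hr] : \forall z \near (0 : P), `|phi 0 - phi z| <= d / 2.
  by move/cvgr_dist_le : cphi; exact.
have r20 : 0 < r ^+ 2 by rewrite exprn_gt0.
pose K := 8 * B / r ^+ 2.
have K0 : 0 <= K by rewrite divr_ge0 ?mulr_ge0// ltW.
exists (Num.min r (Num.min 1 (d / (2 * (K + 1))))).
  by rewrite !lt_min r0 ltr01 divr_gt0//; lra.
move=> e e0; rewrite !lt_min => /andP[er /andP[e1 eK]].
have Le := L1_log_kernel_lap e0; have Lr := L1_log_kernel_lap r0.
have Lp : L1 (fun z => log_kernel_lap e z * phi z).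
  by apply: L1_eq (L1M_bounded mphi phiB Le) => z; rewrite mulrC.
have L0 := L1Z (phi 0) Le.
rewrite -[phi 0 in X in `|X|]mulr1 -(pint_log_kernel_lap e0) -pintZ// -pintB//.
have mE : pint (fun z => d / 2 * log_kernel_lap e z + K * e ^+ 2 * log_kernel_lap r z)
    = d / 2 + K * e ^+ 2.
  by rewrite (pintD (L1Z _ Le) (L1Z _ Lr)) (pintZ _ Le) (pintZ _ Lr) !pint_log_kernel_lap// !mulr1.
apply: (@le_trans _ _ (d / 2 + K * e ^+ 2)).
  rewrite -mE; apply: pint_norm_le.
  - exact: L1_mfun (L1B Lp L0).
  - exact: (L1D (L1Z _ Le) (L1Z _ Lr)).
  move=> z.
  have -> : log_kernel_lap e z * phi z - phi 0 * log_kernel_lap e z =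
     (phi z - phi 0) * log_kernel_lap e z by ring.
  rewrite normrM (ger0_norm (log_kernel_lap_ge0 e z)).
  have pe := log_kernel_lap_ge0 e z; have pr := log_kernel_lap_ge0 r z.
  have [zr|rz] := ltP `|z| r.
    have hz : `|phi z - phi 0| <= d / 2.
      by rewrite distrC; apply: Hr; rewrite -ball_normE /ball_ /= sub0r normrN.
    have := ler_wpM2r pe hz; have : 0 <= K * e ^+ 2 * log_kernel_lap r z.
      by apply: mulr_ge0 => //; apply: mulr_ge0 => //; exact: sqr_ge0.
    lra.
  have tail := log_kernel_lap_tail e0 (ltW er) rz.
  have hb : `|phi z - phi 0| <= 2 * B.
    by rewrite (le_trans (ler_normB _ _))//; have := phiB z; have := phiB 0; lra.
  have := ler_pM (normr_ge0 _) pe hb tail.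
  have -> : 2 * B * (4 * e ^+ 2 / r ^+ 2 * log_kernel_lap r z) = K * e ^+ 2 * log_kernel_lap r z.
    by rewrite /K; field; rewrite gt_eqF.
  have := mulr_ge0 (ltW d2) pe; lra.
have : K * e ^+ 2 <= d / 2; last lra.
have e2 : e ^+ 2 <= e by rewrite expr2; nra.
have : (K + 1) * e <= d / 2.
  move: eK; rewrite ltr_pdivlMr; nra.
have := ler_wpM2l K0 e2; nra.
Qed.

End fundamental_solution.

Section fundamental_solution_weak.
Context {R : realType}.
Local Notation P := (R * R)%type.
Local Notation pl := (measurableTypeR R * measurableTypeR R)%type.

Lemma mfun_if_ball (f : P -> R) c r : mfun f ->
  mfun (fun y => if `|y - c| < r then f y else 0).
Proof.
move=> mf; apply: measurable_fun_ifT => //.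
apply: measurable_fun_ltr => //.
by apply: (@mfun_continuous _ (fun y => `|y - c|)) => z; exact: continuous_plane_norm.
Qed.

Lemma L1_continuous_ball (f : P -> R) c r : 0 <= r -> (forall y, {for y, continuous f}) ->
  L1 (fun y => if `|y - c| < r then f y else 0).
Proof.
move=> r0 cf.
have [||m _ Hm] := @compact_EVT_max _ R (fun y => `|f y|) [set y | `|y - c| <= r] _
    (@compact_box R c r); first by exists c; rewrite /= subrr normr0.
  apply: continuous_subspaceT => y; apply: continuous_comp; first exact: cf.
  exact: norm_continuous.
apply: (@L1_bounded_box _ _ c r `|f m|) => //.
- by apply: mfun_if_ball; exact: mfun_continuous.
- by move=> y; case: ifP => yr; [apply: Hm; rewrite inE /= ltW|rewrite normr0].
- by move=> y ry; rewrite ltNge (ltW ry).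
Qed.

Lemma log_kernel00 : log_kernel 0 (0 : P) = 0.
Proof. by rewrite /log_kernel /sqmod !expr0n /= !addr0 ln0// mulr0. Qed.

Lemma mfun_log_kernel0 : mfun (@log_kernel R 0).
Proof.
apply: (@mfun_continuous_on _ [set v | 0 < sqmod 0 v]).
- apply: (@open_comp _ _ (sqmod 0) [set x : R | 0 < x]); last exact: open_gt.
  by move=> *; exact: continuous_sqmod.
- by move=> z; exact: continuous_log_kernel.
- move=> z /= h; have [->|z0] := eqVneq z 0; first exact: log_kernel00.
  by exfalso; apply: h; exact: sqmod_gt0.
Qed.

(** Near the pole |log s| is at most a multiple of 1 / s. *)
Lemma log_kernel0_bound (A : R) : 0 < A -> exists2 C, 0 <= C &
  forall v : P, `|v| < A -> `|log_kernel 0 v| <= C * (1 + newton A v).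
Proof.
move=> A0; have p0 : 0 < (pi : R) by exact: pi_gt0.
have l2 : 0 <= ln (2 : R) by rewrite ln_ge0//; lra.
pose K := ln 2 + 2 * `|ln A| + 2 * A.
have K0 : 0 <= K by rewrite /K; have := normr_ge0 (ln A); lra.
exists ((4 * pi)^-1 * K) => [|v vA].
  by rewrite mulr_ge0// invr_ge0 mulr_ge0// ltW.
have [->|v0] := eqVneq v 0.
  rewrite log_kernel00 normr0; apply: mulr_ge0; last by rewrite addr_ge0 ?newton_ge0.
  by rewrite mulr_ge0// invr_ge0 mulr_ge0// ltW.
have s0 : 0 < `|v| by rewrite normr_gt0.
have q0 := sqmod_gt0 v0.
have /andP[h1 h2] := sqmod0_norm v.
rewrite /log_kernel normrM ger0_norm ?invr_ge0 ?mulr_ge0 ?(ltW p0)// -mulrA ler_wpM2l//.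
  by rewrite invr_ge0 mulr_ge0// ltW.
have ln1 : 2 * ln `|v| <= ln (sqmod 0 v).
  rewrite -(ler_ln (exprn_gt0 2 s0) q0) lnXn// in h1.
  by rewrite mulr_natl.
have ln2 : ln (sqmod 0 v) <= ln 2 + 2 * ln `|v|.
  have t0 : 0 < 2 * `|v| ^+ 2 by rewrite mulr_gt0// exprn_gt0.
  rewrite -(ler_ln q0 t0) lnM ?posrE// ?exprn_gt0// lnXn// in h2.
  by rewrite mulr_natl.
have lA : ln `|v| = ln A - ln (A / `|v|) by rewrite ln_div ?posrE//; ring.
have lp : 0 <= ln (A / `|v|) by rewrite ln_ge0// ler_pdivlMr// mul1r ltW.
have ls : ln (A / `|v|) < A / `|v| by apply: ln_sublinear; rewrite divr_gt0.
rewrite /newton vA.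
have iv : 0 < `|v|^-1 by rewrite invr_gt0.
have kk : 2 * (A / `|v|) <= K * `|v|^-1.
  by rewrite mulrA ler_pM2r// /K; have := normr_ge0 (ln A); lra.
have : `|ln (sqmod 0 v)| <= ln 2 + 2 * `|ln A| + 2 * (A / `|v|).
  have := ler_norm (ln A); have := ler_norm (- ln A); rewrite normrN => a1 a2.
  by rewrite ler_norml; apply/andP; split; lra.
rewrite mulrDr mulr1; have : ln 2 + 2 * `|ln A| <= K by rewrite /K; lra.
lra.
Qed.

Lemma L1_log_kernel0_ball c r : 0 < r ->
  L1 (fun y : P => if `|y - c| < r then log_kernel 0 y else 0).
Proof.
move=> r0; pose A := `|c| + r; have A0 : 0 < A by have := normr_ge0 c; rewrite /A; lra.
have [C C0 HC] := log_kernel0_bound A0.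
have LB := L1Z C (L1D (L1_box c (ltW r0)) (newton_L1 A0)).
apply: L1_le LB _; first by apply: mfun_if_ball; exact: mfun_log_kernel0.
move=> y; case: ifP => yr; last first.
  rewrite normr0 mulr_ge0// addr_ge0 ?newton_ge0//; case: ifP => // _.
rewrite (ltW yr); apply: HC; rewrite -[y](subrK c).
by rewrite (le_lt_trans (ler_normD _ _))// /A addrC ltrD2l.
Qed.

(** The weak inequality is applied to the regularised logarithm and to its opposite. *)
Lemma log_kernel_weak_pos (eps : R) (c : P) (e : R) : 0 < eps -> 0 < e ->
  pint (fun y => laplacian (bump eps c) y * log_kernel e y) =
  pint (fun y => log_kernel_lap e y * bump eps c y).
Proof.
move=> eps0 e0.
have ee : eps < 2 * eps by lra.
have r0 : 0 <= 2 * eps by lra.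
have [B B0 HB] := bounded_bump eps0.
have ck y : {for y, continuous (log_kernel e)} by apply: continuous_log_kernel; exact: sqmod_gt0e.
have cl y : {for y, continuous (log_kernel_lap e)}.
  by apply: continuous_log_kernel_lap; exact: sqmod_gt0e.
have LF : L1 (fun y : P => if `|y - c| < 2 * eps then log_kernel e y else 0).
  exact: L1_continuous_ball.
have LF' : L1 (fun y : P => if `|y - c| < 2 * eps then - log_kernel e y else 0).
  by apply: L1_continuous_ball => // y; exact: (cvgN (ck y)).
have LL : L1 (fun y => log_kernel_lap e y * bump eps c y).
  by apply: L1_eq (L1M_bounded (mfun_bump c eps0) (HB c) (L1_log_kernel_lap e0)) => y; rewrite mulrC.
have LL' : L1 (fun y => - log_kernel_lap e y * bump eps c y).
  by apply: L1_eq (L1Z (-1) LL) => y; ring.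
have [B' B'0 HB'] := bounded_laplacian_bump eps0.
have LK : L1 (fun y => laplacian (bump eps c) y * log_kernel e y).
  have := L1M_bounded (mfun_laplacian_bump c eps0) (HB' c) LF.
  apply: L1_eq => y; case: ifP => // /negbT; rewrite -leNgt => h.
  by rewrite laplacian_bump_eq0 ?mul0r// (lt_le_trans ee).
apply/eqP; rewrite eq_le; apply/andP; split.
  have H : pint (fun y => - log_kernel_lap e y * bump eps c y) <=
      pint (fun y => laplacian (bump eps c) y * - log_kernel e y).
    apply: (@weak_laplacian_ge _ _ _ c eps (2 * eps)) => // y _; split.
      exact: (cvgN (cl y)).
    by have [] := log_kernel_lap_ge (sqmod_gt0e y e0).
  have E1 : pint (fun y => - log_kernel_lap e y * bump eps c y) =
      -1 * pint (fun y => log_kernel_lap e y * bump eps c y).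
    by rewrite -pintZ//; apply: pint_eq => y; ring.
  have E2 : pint (fun y => laplacian (bump eps c) y * - log_kernel e y) =
      -1 * pint (fun y => laplacian (bump eps c) y * log_kernel e y).
    by rewrite -pintZ//; apply: pint_eq => y; ring.
  by move: H; rewrite E1 E2 !mulN1r lerN2.
apply: (@weak_laplacian_ge _ _ _ c eps (2 * eps)) => // y _; split => //.
by have [] := log_kernel_lap_ge (sqmod_gt0e y e0).
Qed.

(** As [e] tends to 0, one side of the regularised identity converges by domination, the
    other because the Laplacians are an approximate identity. *)
Lemma log_kernel_fundamental0 (eps : R) (c : P) : 0 < eps ->
  pint (fun y => laplacian (bump eps c) y * log_kernel 0 y) = bump eps c 0.
Proof.
move=> eps0.
have ee : eps < 2 * eps by lra.
have r0 : 0 < 2 * eps by lra.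
have [B B0 HB] := bounded_bump eps0.
have [B' B'0 HB'] := bounded_laplacian_bump eps0.
pose phi := bump eps c.
pose en (n : nat) : R := n.+1%:R^-1.
have en0 n : 0 < en n by rewrite invr_gt0.
have en1 n : en n <= 1 by rewrite invf_le1// ler1n.
have k1c y : {for y, continuous (log_kernel 1 : P -> R)}.
  by apply: continuous_log_kernel; exact: sqmod_gt0e.
pose dom (y : P) := B' * (`|if `|y - c| < 2 * eps then log_kernel 0 y else 0| +
   `|if `|y - c| < 2 * eps then log_kernel 1 y else 0|).
have Ldom : L1 dom.
  apply: L1Z; apply: L1D; apply: L1_norm; first exact: L1_log_kernel0_ball.
  by apply: L1_continuous_ball => //; exact: ltW.
pose f_ n (y : P) := laplacian phi y * log_kernel (en n) y.
have mf_ n : mfun (f_ n).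
  apply: measurable_funM; first exact: mfun_laplacian_bump.
  by apply: mfun_continuous => y; apply: continuous_log_kernel; exact: sqmod_gt0e.
have mf : mfun (fun y => laplacian phi y * log_kernel 0 y).
  by apply: measurable_funM; [exact: mfun_laplacian_bump|exact: mfun_log_kernel0].
have := @pint_dominated R 0 f_ (fun y => laplacian phi y * log_kernel 0 y) dom mf_ mf Ldom.
move=> H; have {}H : (fun n => pint (f_ n)) @ \oo --> pint (fun y => laplacian phi y * log_kernel 0 y).
  apply: H.
    move=> n y /eqP y0; rewrite /f_.
    rewrite normrM /dom; case: ifP => [_|/negbT]; last first.
      rewrite -leNgt => h; rewrite /phi laplacian_bump_eq0 ?(lt_le_trans ee)//.
      by rewrite !normr0 mul0r addr0 mulr0.
    rewrite ler_pM//; first exact: HB'.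
    have q0 := sqmod_gt0 y0.
    have qn : 0 < sqmod (en n) y by exact: sqmod_gt0e.
    have q1 : 0 < sqmod 1 y by exact: sqmod_gt0e.
    have a1 : ln (sqmod 0 y) <= ln (sqmod (en n) y).
      rewrite ler_ln ?posrE// /sqmod expr0n /= addr0 lerDl; exact: sqr_ge0.
    have a2 : ln (sqmod (en n) y) <= ln (sqmod 1 y).
      rewrite ler_ln ?posrE// /sqmod lerD2l.
      by rewrite lerXn2r ?nnegrE// ltW.
    rewrite /log_kernel !normrM -mulrDr ler_wpM2l//.
    have := ler_norm (ln (sqmod 1 y)); have := ler_norm (- ln (sqmod 0 y)).
    have := normr_ge0 (ln (sqmod 1 y)); have := normr_ge0 (ln (sqmod 0 y)).
    by rewrite normrN => b1 b2 b3 b4; rewrite ler_norml; apply/andP; split; lra.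
  move=> y /eqP y0; have q0 := sqmod_gt0 y0.
  apply: cvgM; first exact: cvg_cst.
  apply: cvgM; first exact: cvg_cst.
  apply: continuous_cvg; first exact: continuous_ln.
  rewrite /sqmod; apply: cvgD; first exact: cvg_cst.
  have ec : en @ \oo --> (0 : R) by exact: cvg_harmonic.
  exact: (cvgM ec ec).
apply/eqP; rewrite -subr_eq0 -normr_le0; apply/ler_addgt0Pr => d d0; rewrite add0r.
have d2 : 0 < d / 2 by lra.
have [r rp Hr] := log_kernel_lap_delta (mfun_bump c eps0) (HB c) (@continuous_bump _ eps c 0 eps0) d2.
have ec : en @ \oo --> (0 : R) by exact: cvg_harmonic.
have [n [n1 n2]] : exists n, en n < r /\
    `|pint (fun y => laplacian phi y * log_kernel 0 y) - pint (f_ n)| <= d / 2.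
  have [N _ HN] : \forall n \near \oo, en n < r /\
    `|pint (fun y => laplacian phi y * log_kernel 0 y) - pint (f_ n)| <= d / 2.
    near=> n; split; near: n; last by move/cvgrPdist_le : H; exact.
    by move/cvgr_lt : ec; apply.
  by exists N; apply: HN => /=.
have := Hr _ (en0 n) n1.
rewrite -(log_kernel_weak_pos c eps0 (en0 n)) -/(f_ n) => n3.
have -> : pint (fun y => laplacian phi y * log_kernel 0 y) - phi 0 =
  (pint (fun y => laplacian phi y * log_kernel 0 y) - pint (f_ n)) + (pint (f_ n) - phi 0) by ring.
by rewrite (le_trans (ler_normD _ _))//; rewrite /phi in n2 n3 *; lra.
Unshelve. all: by end_near. Qed.

Lemma log_kernel_fundamental (eps : R) (c xi : P) : 0 < eps ->
  pint (fun y => laplacian (bump eps c) y * log_kernel 0 (y - xi)) = bump eps c xi.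
Proof.
move=> eps0.
have [B' B'0 HB'] := bounded_laplacian_bump eps0.
have L0 : L1 (fun y => laplacian (bump eps (c - xi)) y * log_kernel 0 y).
  have r0 : 0 < 2 * eps by lra.
  have := L1M_bounded (mfun_laplacian_bump (c - xi) eps0) (HB' _) (L1_log_kernel0_ball (c - xi) r0).
  apply: L1_eq => y; case: ifP => // /negbT; rewrite -leNgt => h.
  by rewrite laplacian_bump_eq0 ?mul0r// (lt_le_trans _ h)//; lra.
rewrite [RHS]bump_shift; have -> : xi - c = 0 - (c - xi) by rewrite sub0r opprB.
rewrite -bump_shift -(log_kernel_fundamental0 (c - xi) eps0) -(pint_shift (- xi) L0).
have E (y : P) : y - c = (y - xi) - (c - xi) by rewrite opprB addrA subrK.
apply: pint_eq => y.
by rewrite (laplacian_bump_shift c y eps0) (laplacian_bump_shift (c - xi) (y - xi) eps0) -E.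
Qed.

End fundamental_solution_weak.

(** * Isolated singularities of subharmonic functions *)

Section singular_max_principle.
Context {R : realType}.
Local Notation P := (R * R)%type.

Lemma bounded_setE (D : set P) : bounded_set D -> exists2 M, 0 < M & forall z, D z -> `|z| <= M.
Proof.
move=> [M [Mr HM]]; exists (Num.max M 0 + 1).
  by rewrite ltr_wpDl// le_max lexx orbT.
by move=> z Dz; apply: (HM (Num.max M 0 + 1)) => //; rewrite ltr_pwDr// le_max lexx.
Qed.

Lemma closure_norm_le (D : set P) M : (forall z, D z -> `|z| <= M) ->
  forall z, closure D z -> `|z| <= M.
Proof.
move=> HM z; have cB : closed [set y : P | `|y| <= M].
  apply: (@closed_comp _ _ (fun y : P => `|y|) [set x : R | x <= M]).
    by move=> y _; exact: norm_continuous.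
  exact: closed_le.
by move=> cz; apply: cB; apply: closure_subset cz.
Qed.

Lemma compact_closure_diff (D V : set P) : bounded_set D -> open V ->
  compact (closure D `\` V).
Proof.
move=> /bounded_setE[M M0 HM] oV.
apply: (@subclosed_compact _ _ [set y : P | `|y - 0| <= M]).
- by apply: closedI; [exact: closed_closure|exact: open_closedC].
- exact: compact_box.
- by move=> z [cz _]; rewrite /= subr0; exact: closure_norm_le cz.
Qed.

(** Punctures and boundary points are treated alike: an asymptotic bound near them confines
    the interior argument to a compact set. *)
Lemma max_principle_closure (Om : set P) (f : P -> R) (c : R) : bounded_set Om ->
  (forall z, closure Om z ->
     [/\ nbhs z Om, {for z, continuous f} & lap_ge f z 0] \/
     (forall d, 0 < d -> \forall y \near z, Om y -> f y <= c + d)) ->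
  forall z, Om z -> f z <= c.
Proof.
move=> bOm HOm z Omz; apply/ler_addgt0Pr => d d0.
pose V := ([set y | Om y -> f y <= c + d])°.
have oV : open V by exact: open_interior.
apply: (max_principle (Om := Om) (K := closure Om `\` V)) Omz.
- exact: compact_closure_diff.
- move=> y [cy nVy]; have [[h1 h2 h3]|h] := HOm y cy; first by split.
  by exfalso; apply: nVy; exact: h.
- move=> y Omy nK; have Vy : V y.
    by apply: contrapT => nV; apply: nK; split => //; exact: subset_closure.
  exact: (interior_subset Vy).
Qed.

Lemma log_kernel_pole (B : R) : \forall v \near (0 : P), v != 0 -> log_kernel 0 v <= B.
Proof.
have p0 : 0 < (pi : R) by exact: pi_gt0.
pose t := Num.min 1 (expR (4 * pi * B) / 2).
have t0 : 0 < t by rewrite lt_min ltr01 divr_gt0// expR_gt0.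
apply/nbhs_ballP; exists t => //= v; rewrite -ball_normE /ball_ /= sub0r normrN => vt v0.
have q0 := sqmod_gt0 v0; have /andP[_ h2] := sqmod0_norm v.
have s0 := normr_ge0 v.
move: vt; rewrite lt_min => /andP[v1 v2].
have qe : sqmod 0 v <= expR (4 * pi * B).
  apply: le_trans h2 _; have : `|v| ^+ 2 <= `|v| by rewrite expr2 ler_piMr// ltW.
  lra.
rewrite /log_kernel mulrC ler_pdivrMr; last by rewrite mulr_gt0.
by rewrite mulrC -[leRHS]expRK ler_ln ?posrE ?expR_gt0.
Qed.

Lemma continuous_subr (z xi : P) : {for z, continuous (fun y : P => (y - xi : P))}.
Proof. by apply: (@cvgB _ _ _ (nbhs z) _ id (cst xi)); [exact: cvg_id|exact: cvg_cst]. Qed.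

Lemma continuous_translate (T : topologicalType) (f : P -> T) (z xi : P) :
  {for z - xi, continuous f} -> {for z, continuous (fun y : P => f (y - xi))}.
Proof.
move=> cf; apply: (@continuous_comp P P T (fun y : P => (y - xi : P)) f) => //.
exact: continuous_subr.
Qed.

Lemma near_sub (z xi : P) (Q : P -> Prop) : (\forall v \near z - xi, Q v) ->
  \forall y \near z, Q (y - xi).
Proof.
by move=> HQ; exact: (@continuous_subr z xi Q).
Qed.

Lemma lap_ge_translate (f : P -> R) (z xi : P) c : lap_ge f (z - xi) c ->
  lap_ge (fun y : P => f (y - xi)) z c.
Proof.
move=> lf d d0; have [e e0 He] := near_pairP (lf d d0).
exists (ball z e, ball (0 : R) e); first by split; exact: nbhsx_ballx.
move=> [y t] /= []; rewrite -!ball_normE /= sub0r normrN => yz te.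
have := He (y - xi) t _ te; rewrite opprB addrA subrK distrC => /(_ yz) /=.
by congr (_ <= _); rewrite /sdiff /=; do 4 ?[congr (_ + _)]; congr (f (_, _)); rewrite /=; ring.
Qed.

Lemma log_kernel_lap_ge_pm (y xi : P) : y != xi ->
  [/\ {for y, continuous (fun z : P => log_kernel 0 (z - xi))},
   lap_ge (fun z : P => log_kernel 0 (z - xi)) y 0 &
   lap_ge (fun z : P => - log_kernel 0 (z - xi)) y 0].
Proof.
rewrite -subr_eq0 => yx; have q0 := sqmod_gt0 yx.
have L0 : log_kernel_lap 0 (y - xi) = 0 by rewrite /log_kernel_lap expr0n /= mul0r.
have [h1 h2] := log_kernel_lap_ge q0; rewrite L0 in h1 h2; rewrite oppr0 in h2.
split.
- by apply: continuous_translate; exact: continuous_log_kernel.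
- exact: lap_ge_translate.
- exact: (lap_ge_translate (f := fun v => - log_kernel 0 v)).
Qed.

Lemma near_neq (y xi : P) : y != xi -> \forall z \near y, z != xi.
Proof.
move=> yx; have d0 : 0 < `|y - xi| by rewrite normr_gt0 subr_eq0.
apply/nbhs_ballP; exists `|y - xi| => //= z; rewrite -ball_normE /= => h.
by apply: contraTneq h => ->; rewrite ltxx.
Qed.

(** A bounded-above singularity is invisible to the weak Laplacian: adding a
    small multiple of the logarithm and truncating from below produces
    subharmonic functions that are constant near the singular point. *)
Lemma weak_removable (F : P -> R) (c xi : P) (e e' M : R) : 0 < e -> e < e' ->
  mfun F -> L1 (fun y => if `|y - c| < e' then F y else 0) ->
  (forall y, `|y - c| <= e -> y != xi -> lap_ge F y 0) ->
  (\forall y \near xi, y != xi -> F y <= M) ->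
  0 <= pint (fun y => laplacian (bump e c) y * F y).
Proof.
move=> e0 ee' mF LF HF FM.
have e'0 : 0 < e' by rewrite (lt_trans e0).
have [B B0 HB] := bounded_laplacian_bump e0.
pose k (y : P) := log_kernel 0 (y - xi).
have mk : mfun k by exact: mfun_shift (@mfun_log_kernel0 R).
have Lk : L1 (fun y => if `|y - c| < e' then k y else 0).
  have := L1_shift (- xi) (L1_log_kernel0_ball (c - xi) e'0).
  apply: L1_eq => y; have -> : y - xi - (c - xi) = y - c by rewrite opprB addrA subrK.
  by [].
(* The value at xi only has to lie below the truncation level of Fn. *)
pose f n (y : P) := if y == xi then - n%:R - 1 else F y + n.+1%:R^-1 * k y.
have fE n y : y <> xi -> F y + n.+1%:R^-1 * k y = f n y.
  by move=> /eqP yx; rewrite /f (negbTE yx).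
pose Fn n (y : P) := Num.max (f n y) (- n%:R).
have mf n : mfun (f n).
  apply: mfun_off_point (fE n).
  by apply: measurable_funD => //; exact: measurable_funM.
have mFn n : mfun (Fn n).
  have mc : measurable_fun setT ((fun=> - n%:R) : P -> R) by exact: measurable_cst.
  exact: (measurable_maxr (mf n) mc).
have Fnb n y : y <> xi -> `|Fn n y| <= `|F y| + `|k y|.
  move=> yx; apply: (@le_trans _ _ `|f n y|).
    rewrite /Fn; have [h|//] := leP (f n y) (- n%:R); rewrite normrN ger0_norm//.
    have := ler_norm (- f n y); rewrite normrN; lra.
  rewrite -fE// (le_trans (ler_normD _ _))// lerD2l normrM ger0_norm ?invr_ge0//.
  by rewrite ler_piMl// invf_le1// ler1n.
have nonneg n : 0 <= pint (fun y => laplacian (bump e c) y * Fn n y).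
  have := @weak_laplacian_ge _ (Fn n) (fun=> 0) c e e' e0 ee'.
  rewrite (_ : (fun y => 0 * bump e c y) = fun=> 0); last by apply/funext => y; rewrite mul0r.
  rewrite pint0; apply.
  - apply: (@L1_le_off _ xi _ (fun y => `|if `|y - c| < e' then F y else 0| + `|if `|y - c| < e' then k y else 0|)).
    + exact: mfun_if_ball.
    + by apply: L1D; exact: L1_norm.
    + move=> y yx; case: ifP => _; first exact: Fnb.
      by rewrite !normr0 addr0.
  - exact: L1_0.
  move=> y yc; split; first exact: cvg_cst.
  have [->|yx] := eqVneq y xi.
    apply: (lap_ge_near_eq (f := fun=> - n%:R)); last exact: lap_ge_cst.
    have kp : \forall z \near xi, z - xi != 0 -> log_kernel 0 (z - xi) <= - n.+1%:R * (n%:R + M).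
      apply: (@near_sub xi xi (fun v => v != 0 -> log_kernel 0 v <= - n.+1%:R * (n%:R + M))).
      by rewrite subrr; exact: log_kernel_pole.
    apply: filterS (filterI kp FM) => z [k1 k2].
    rewrite /Fn max_r// /f; case: eqP => [_|/eqP zx]; first by rewrite lerBlDr lerDl.
    have := k2 zx; move: k1; rewrite subr_eq0 => /(_ zx); rewrite -/(k z) => k1.
    have np : 0 < n.+1%:R :> R by rewrite ltr0n.
    have : n.+1%:R^-1 * k z <= - (n%:R + M).
      by rewrite ler_pdivrMl// mulrN -mulNr.
    move: (_ * k z) => a ha hF; rewrite -lerBrDr; apply: le_trans hF _; lra.
  apply: lap_ge_max; right.
  apply: (lap_ge_near_eq (f := fun z => F z + n.+1%:R^-1 * k z)).
    by apply: filterS (near_neq yx) => z /eqP; exact: fE.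
  rewrite -[0]addr0; apply: lap_geD; first exact: HF.
  rewrite -[0](mulr0 n.+1%:R^-1); apply: lap_geZ; first by rewrite invr_ge0.
  by have [] := log_kernel_lap_ge_pm yx.
have mG : mfun (fun y => laplacian (bump e c) y * F y).
  by apply: measurable_funM => //; exact: mfun_laplacian_bump.
have Ldom := L1Z B (L1D (L1_norm LF) (L1_norm Lk)).
have H : (fun n => pint (fun y => laplacian (bump e c) y * Fn n y)) @ \oo -->
    pint (fun y => laplacian (bump e c) y * F y).
  apply: (@pint_dominated R xi _ _ _ _ mG Ldom).
  - by move=> n; exact: (measurable_funM (mfun_laplacian_bump c e0) (mFn n)).
  - move=> n y yx; rewrite normrM; case: ifP => [_|/negbT].
      by rewrite ler_pM//; exact: Fnb.
    rewrite -leNgt => h; rewrite laplacian_bump_eq0 ?(lt_le_trans ee')//.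
    by rewrite !normr0 addr0 mul0r mulr0.
  move=> y yx; apply: cvgM; first exact: cvg_cst.
  have fc : (fun n => f n y) @ \oo --> F y.
    have hc : (fun n : nat => F y + n.+1%:R^-1 * k y) @ \oo --> F y + 0 * k y.
      apply: cvgD; first exact: cvg_cst.
      by apply: cvgM; [exact: cvg_harmonic|exact: cvg_cst].
    rewrite mul0r addr0 in hc; apply: cvg_trans hc; apply: near_eq_cvg.
    by apply: nearW => n; rewrite fE.
  apply: cvg_trans fc; apply: near_eq_cvg; near=> n.
  rewrite /Fn max_l//.
  have : `|F y| + `|k y| <= n%:R by near: n; exact: nbhs_infty_ger.
  rewrite -(fE _ _ yx) => h.
  have : `|n.+1%:R^-1 * k y| <= `|k y|.
    by rewrite normrM ger0_norm ?invr_ge0// ler_piMl// invf_le1// ler1n.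
  have := ler_norm (- F y); have := ler_norm (- (n.+1%:R^-1 * k y)).
  rewrite !normrN; move: (n.+1%:R^-1 * k y) => a; move: (n%:R : R) h => b; lra.
rewrite leNgt; apply/negP => neg.
have /(_ _)[] := (cvgr_lt _ H) 0 neg.
by move=> N _ /(_ N (leqnn N)) /=; rewrite ltNge nonneg.
Unshelve. all: by end_near. Qed.

End singular_max_principle.

(** * Pointwise bounds on the Green function *)

Section boundary_values.
Context {R : realType}.
Local Notation P := (R * R)%type.

(** The function extended by zero is small near every point outside [D], whether or not
    that point lies on the frontier; so it is continuous there. *)
Lemma extension_small (D : set P) (U : P -> \bar R) (f : P -> R) (z : P) (d : R) :
  vanishes_on_boundary D U ->
  (forall y, D y -> f y = 0 \/ f y = fine (U y)) -> (forall y, ~ D y -> f y = 0) ->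
  ~ D z -> 0 < d -> \forall y \near z, `|f y| <= d.
Proof.
move=> vb fU f0 nDz d0; have d0' := ltW d0.
have [cz|ncz] := pselect (closure D z); last first.
  have : \forall y \near z, ~ closure D y.
    by apply: open_nbhs_nbhs; split => //; exact/closed_openC/closed_closure.
  apply: filterS => y ncy; rewrite f0 ?normr0// => Dy.
  by apply: ncy; exact: subset_closure.
have fz : frontier D z by split => // Di; apply: nDz; exact: interior_subset Di.
have /fine_cvgP[_] := vb z fz.
move=> /cvgr0_norm_le/(_ d d0) h.
have {}h : \forall y \near z, D y -> `|fine (U y)| <= d by exact: h.
apply: filterS h => y h; have [Dy|nDy] := pselect (D y); last by rewrite f0// normr0.
by case: (fU y Dy) => ->; [rewrite normr0|exact: h].
Qed.

End boundary_values.

Section green_kernel.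
Context {R : realType}.
Local Notation P := (R * R)%type.
Context (D : set P) (g : P -> P -> \bar R).
Context (bD : bounded_set D) (oD : open D) (gD : laplace_green D g).

(** A real kernel on the whole plane; the value 0 on the diagonal stands for -oo. *)
Definition green_kernel (z xi : P) : R :=
  if `[< [/\ D z, D xi & z <> xi] >] then fine (g z xi) else 0.

Local Notation G := green_kernel.
Local Notation k := (log_kernel (0 : R)).

Lemma green_kernelE z xi : D z -> D xi -> z <> xi -> g z xi = (G z xi)%:E.
Proof.
move=> Dz Dxi zxi; rewrite /green_kernel asboolT//.
by have [[/(_ z (conj Dz zxi)) + _] _ _ _ _] := gD Dxi; move/fineK ->.
Qed.

Lemma green_kernel_out z xi : ~ D z \/ ~ D xi -> G z xi = 0.
Proof. by move=> h; rewrite /green_kernel asboolF// => -[]; tauto. Qed.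

Lemma near_punctured z xi : D z -> z <> xi -> \forall y \near z, D y /\ y <> xi.
Proof.
move=> Dz /eqP zxi; apply: filterS (filterI (open_nbhs_nbhs (conj oD Dz)) (near_neq zxi)).
by move=> y [Dy /eqP].
Qed.

Lemma green_kernel_harmonic z xi : D z -> D xi -> z <> xi ->
  [/\ {for z, continuous (G^~ xi)}, lap_ge (G^~ xi) z 0 &
      lap_ge (fun y => - G y xi) z 0].
Proof.
move=> Dz Dxi zxi; have [[_ hg] _ _ _ _] := gD Dxi.
have E : \forall y \near z, (fine \o g^~ xi) y = G y xi.
  by apply: filterS (near_punctured Dz zxi) => y [Dy yx]; rewrite /= green_kernelE.
have N : nbhs z (D `\ xi) by exact: near_punctured.
have [h1 h2] := harmonic_lap_ge N hg.
split.
- apply: near_eq_continuous E _; exact: (harmonic_continuous (nbhs_singleton N) hg).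
- exact: lap_ge_near_eq E h1.
- by apply: lap_ge_near_eq h2; apply: filterS E => y ->.
Qed.

Lemma log_kernel0E (v : P) : k v = (2 * pi)^-1 * ln (modulus v).
Proof.
have p0 : (pi : R) != 0 by rewrite gt_eqF// pi_gt0.
have E : sqmod 0 v = v.1 ^+ 2 + v.2 ^+ 2 by rewrite /sqmod expr0n addr0.
have [->|v0] := eqVneq v 0.
  by rewrite log_kernel00 /modulus /= !expr0n /= addr0 sqrtr0 ln0// mulr0.
have q0 := sqmod_gt0 v0; rewrite /log_kernel /modulus -E.
have -> : sqmod 0 v = Num.sqrt (sqmod 0 v) ^+ 2 by rewrite sqr_sqrtr// ltW.
have s0 : 0 < Num.sqrt (sqmod 0 v) by rewrite sqrtr_gt0.
rewrite lnXn// sqrtr_sqr ger0_norm ?(ltW s0)// -[X in _ * X]mulr_natl.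
by move: (pi : R) p0 (ln _) => p p0 l; field.
Qed.

Lemma green_kernel_pole xi : D xi -> exists C,
  \forall z \near xi, z != xi -> `|G z xi - k (z - xi)| <= C.
Proof.
move=> Dxi; have [_ _ _ [C HC] _] := gD Dxi; exists C.
have HC' : \forall z \near xi, z != xi ->
    `|fine (g z xi) - (2 * pi)^-1 * ln (modulus (z - xi))| <= C by exact: HC.
apply: filterS (filterI HC' (open_nbhs_nbhs (conj oD Dxi))) => z [h Dz] zx.
by rewrite log_kernel0E; have := h zx; rewrite green_kernelE//; exact/eqP.
Qed.

Lemma green_kernel_boundary xi z d : ~ D z -> 0 < d ->
  \forall y \near z, `|G y xi| <= d.
Proof.
move=> nDz d0; have [Dxi|nDxi] := pselect (D xi); last first.
  by apply: (filterS _ (filterT : nbhs z setT)) => y _; rewrite green_kernel_out ?normr0 ?ltW//; right.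
have [_ _ _ _ vb] := gD Dxi.
apply: (extension_small vb) => // [y Dy|y nDy]; last by rewrite green_kernel_out//; left.
by rewrite /green_kernel; case: asboolP; [right|left].
Qed.

Definition green_domain xi : set P := [set z | D z /\ z <> xi].

Lemma bounded_green_domain xi : bounded_set (green_domain xi).
Proof.
by case: bD => N [Nr HN]; exists N; split => // m Nm z [Dz _]; exact: (HN m Nm z Dz).
Qed.

(** The maximum principle: near the pole the logarithm tends to -oo, and elsewhere the
    boundary values are 0. *)
Lemma green_kernel_le0 z xi : G z xi <= 0.
Proof.
rewrite /green_kernel; case: asboolP => // -[Dz Dxi zxi].
suff : G z xi <= 0 by rewrite /green_kernel asboolT.
have [C HC] := green_kernel_pole Dxi.
apply: (@max_principle_closure _ (green_domain xi) (G^~ xi)) => //.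
  exact: bounded_green_domain.
move=> y cy; have [->|/eqP yx] := eqVneq y xi.
  right => d d0.
  have kp := @near_sub _ xi xi (fun v => v != 0 -> k v <= - C) _.
  have {}kp : \forall v \near xi, v - xi != 0 -> k (v - xi) <= - C.
    by apply: kp; rewrite subrr; exact: log_kernel_pole.
  apply: filterS (filterI kp HC) => v [h1 h2] [Dv /eqP vx].
  have := h1 _; rewrite subr_eq0 => /(_ vx) => h3.
  have := ler_norm (G v xi - k (v - xi)); have := h2 vx; lra.
have [Dy|nDy] := pselect (D y).
  left; have [h1 h2 _] := green_kernel_harmonic Dy Dxi yx; split => //.
  exact: near_punctured.
right => d d0; apply: filterS (green_kernel_boundary xi nDy d0) => v h _.
by rewrite add0r (le_trans (ler_norm _)).
Qed.

Context (M : R) (M0 : 0 < M) (HM : forall z, D z -> `|z| <= M).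

(** An upper bound of the logarithmic kernel on pairs of points of [D]. *)
Definition log_diam : R := (4 * pi)^-1 * ln (8 * M ^+ 2 + 1).

Lemma log_kernel_le_diam x y : D x -> D y -> k (x - y) <= log_diam.
Proof.
move=> Dx Dy; have p0 : 0 < (pi : R) by exact: pi_gt0.
rewrite /log_kernel /log_diam ler_wpM2l ?invr_ge0 ?mulr_ge0 ?(ltW p0)//.
have [->|v0] := eqVneq (x - y) 0.
  rewrite ln0; last by rewrite /sqmod !expr0n /= !addr0.
  by rewrite ln_ge0// lerDr mulr_ge0 ?sqr_ge0.
have q0 := sqmod_gt0 v0; have /andP[_ h] := sqmod0_norm (x - y).
have h2 : `|x - y| ^+ 2 <= (2 * M) ^+ 2.
  rewrite lerXn2r ?nnegrE//; first by have := M0; lra.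
  by rewrite (le_trans (ler_normB _ _))//; have := HM Dx; have := HM Dy; lra.
have m2 := sqr_ge0 M.
by rewrite ler_ln ?posrE//; [rewrite exprMn in h2; lra|lra].
Qed.

(** Compare the opposite of [G] with 1 + eta times the logarithm: at the pole the excess
    eta beats the bounded error. Then eta tends to 0. *)
Lemma green_kernel_lower z xi : D z -> D xi -> z <> xi ->
  - G z xi <= log_diam - k (z - xi).
Proof.
move=> Dz Dxi zxi.
have [C HC] := green_kernel_pole Dxi.
have kz : 0 <= log_diam - k (z - xi) by rewrite subr_ge0 log_kernel_le_diam.
suff H eta : 0 < eta -> - G z xi + (1 + eta) * (k (z - xi) - log_diam) <= 0.
  apply/ler_addgt0Pr => d d0.
  pose eta := d / (log_diam - k (z - xi) + 1).
  have e0 : 0 < eta by rewrite divr_gt0//; lra.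
  have : eta * (log_diam - k (z - xi)) <= d.
    by rewrite /eta mulrAC ler_pdivrMr; nra.
  have := H _ e0; lra.
move=> e0.
apply: (@max_principle_closure _ (green_domain xi)
  (fun y => - G y xi + (1 + eta) * (k (y - xi) - log_diam))) => //.
  exact: bounded_green_domain.
move=> y cy; have [->|yx'] := eqVneq y xi.
  right => d d0.
  pose B := log_diam - (C + `|log_diam|) / eta.
  have kp : \forall v \near xi, v - xi != 0 -> k (v - xi) <= B.
    apply: (@near_sub _ xi xi (fun v => v != 0 -> k v <= B)).
    by rewrite subrr; exact: log_kernel_pole.
  apply: filterS (filterI kp HC) => v [h1 h2] [Dv /eqP vx].
  have := h1 _; rewrite subr_eq0 => /(_ vx) => h3.
  have h4 : eta * k (v - xi) <= eta * log_diam - (C + `|log_diam|).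
    have := ler_wpM2l (ltW e0) h3; rewrite /B mulrBr.
    by have -> : eta * ((C + `|log_diam|) / eta) = C + `|log_diam| by field; rewrite gt_eqF.
  have := ler_norm (- (G v xi - k (v - xi))); rewrite normrN; have := h2 vx.
  have := ler_norm (- log_diam); rewrite normrN; lra.
have yx : y <> xi by exact/eqP.
have [Dy|nDy] := pselect (D y).
  left; have [h1 _ h2] := green_kernel_harmonic Dy Dxi yx.
  have [k1 k2 _] := log_kernel_lap_ge_pm yx'.
  split; first exact: near_punctured.
    apply: cvgD; first exact: (cvgN h1).
    by apply: cvgM; [exact: cvg_cst|apply: cvgB => //; exact: cvg_cst].
  have e1 : 0 <= 1 + eta by lra.
  have := lap_geD h2 (lap_geZ e1 (lap_geD k2 (lap_ge_cst (- log_diam) y))).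
  by rewrite addr0 mulr0 addr0.
right => d d0; apply: filterS (green_kernel_boundary xi nDy d0) => v h [Dv vx].
have := log_kernel_le_diam Dv Dxi; have := ler_norm (- G v xi); rewrite normrN => h1 h2.
have : (1 + eta) * (k (v - xi) - log_diam) <= 0 by apply: mulr_ge0_le0; lra.
lra.
Qed.

(** With w = sqrt (d / |z - xi|) the preceding bound reads - G <= log w / pi, and log w is
    at most w. *)
Lemma green_kernel_sqr z xi :
  G z xi ^+ 2 <= (8 * M ^+ 2 + 1) * newton (2 * M + 1) (z - xi).
Proof.
have m2 := sqr_ge0 M.
have d1 : 1 <= 8 * M ^+ 2 + 1 by lra.
have RH : 0 <= (8 * M ^+ 2 + 1) * newton (2 * M + 1) (z - xi).
  by rewrite mulr_ge0 ?newton_ge0//; lra.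
have [[Dz [Dxi zxi]]|h] := pselect (D z /\ D xi /\ z <> xi); last first.
  by rewrite /green_kernel asboolF ?expr0n// => -[? ? ?]; apply: h.
have p0 : 0 < (pi : R) by exact: pi_gt0.
have p2 : 2 <= (pi : R) by exact: pi_ge2.
have Gl := green_kernel_lower Dz Dxi zxi.
have Gu := green_kernel_le0 z xi.
have v0 : z - xi != 0 by rewrite subr_eq0; exact/eqP.
have q0 := sqmod_gt0 v0; have /andP[hq _] := sqmod0_norm (z - xi).
have s0 : 0 < `|z - xi| by rewrite normr_gt0.
have sA : `|z - xi| < 2 * M + 1.
  by rewrite (le_lt_trans (ler_normB _ _))//; have := HM Dz; have := HM Dxi; lra.
rewrite /newton sA.
pose d := 8 * M ^+ 2 + 1; rewrite -/d in d1 RH *.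
pose s := `|z - xi|; rewrite -/s in hq s0 *.
have d0 : 0 < d by lra.
pose w := Num.sqrt (d / s).
have w0 : 0 < w by rewrite sqrtr_gt0 divr_gt0.
have w2 : w ^+ 2 = d / s by rewrite sqr_sqrtr// ltW// divr_gt0.
have ld : log_diam <= (4 * pi)^-1 * ln (d ^+ 2).
  rewrite /log_diam -/d ler_wpM2l ?invr_ge0 ?mulr_ge0 ?(ltW p0)//.
  by rewrite ler_ln ?posrE ?exprn_gt0// expr2; nra.
have lk : (4 * pi)^-1 * ln (s ^+ 2) <= k (z - xi).
  rewrite /log_kernel ler_wpM2l ?invr_ge0 ?mulr_ge0 ?(ltW p0)//.
  by rewrite ler_ln ?posrE ?exprn_gt0.
have lw : ln (d ^+ 2) - ln (s ^+ 2) = 4 * ln w.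
  rewrite -ln_div ?posrE ?exprn_gt0// -expr_div_n -w2 -exprM lnXn//.
  by rewrite [RHS]mulr_natl.
have wb : ln w <= w by apply: ltW; exact: ln_sublinear.
have Gw : - G z xi <= w.
  apply: le_trans Gl _; apply: (@le_trans _ _ ((4 * pi)^-1 * (4 * ln w))).
    by rewrite -lw mulrBr; lra.
  have -> : (4 * pi)^-1 * (4 * ln w) = ln w / pi.
    by move: (pi : R) (ln w) p0 => p l p0; field; rewrite gt_eqF.
  rewrite ler_pdivrMr//; apply: le_trans wb _; rewrite -[leLHS]mulr1 ler_wpM2l ?(ltW w0)//.
  lra.
have -> : d * s^-1 = w ^+ 2 by rewrite w2.
by rewrite -sqrrN lerXn2r ?nnegrE ?oppr_ge0// ltW.
Qed.

(** The regular parts of the Green functions with poles [x1] and [x2] differ by a harmonic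
    function whose boundary values are a difference of logarithms. A small multiple of
    the two logarithms absorbs the singularities. *)
Lemma green_regular_diff (x1 x2 : P) (d : R) : D x1 -> D x2 -> x1 <> x2 -> 0 <= d ->
  (forall z, frontier D z -> `|k (z - x1) - k (z - x2)| <= d) ->
  forall z, D z -> z <> x1 -> z <> x2 ->
    (G z x1 - k (z - x1)) - (G z x2 - k (z - x2)) <= d.
Proof.
move=> D1 D2 x12 d0 Hd z Dz zx1 zx2.
pose h1 y := G y x1 - k (y - x1); pose h2 y := G y x2 - k (y - x2).
have hreg x y : D x -> D y -> y <> x ->
    [/\ {for y, continuous (fun y => G y x - k (y - x))},
      lap_ge (fun y => G y x - k (y - x)) y 0 &
      lap_ge (fun y => - (G y x - k (y - x))) y 0].
  move=> Dx Dy yx; have [a1 a2 a3] := green_kernel_harmonic Dy Dx yx.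
  have [b1 b2 b3] := log_kernel_lap_ge_pm (introN eqP yx).
  split; first exact: (cvgB a1 b1).
    by have := lap_geD a2 b3; rewrite addr0.
  have := lap_geD a3 b2; rewrite addr0; apply: lap_ge_near_eq.
  by apply: (filterS _ (filterT : nbhs y setT)) => v _; rewrite opprB addrC.
suff H eta : 0 < eta -> h1 z - h2 z - d <= eta * (2 * log_diam - k (z - x1) - k (z - x2)).
  have K0 : 0 <= 2 * log_diam - k (z - x1) - k (z - x2).
    by have := log_kernel_le_diam Dz D1; have := log_kernel_le_diam Dz D2; lra.
  rewrite -subr_le0; apply/ler_addgt0Pr => t t0; rewrite add0r.
  pose K := 2 * log_diam - k (z - x1) - k (z - x2); rewrite -/K in K0 H.
  have e0 : 0 < t / (K + 1) by rewrite divr_gt0//; lra.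
  have : t / (K + 1) * K <= t by rewrite mulrAC ler_pdivrMr; nra.
  have := H _ e0; rewrite /h1 /h2; lra.
move=> e0; rewrite -subr_le0.
pose Om := [set y | [/\ D y, y <> x1 & y <> x2]].
pose f y := h1 y - h2 y - d - eta * (2 * log_diam - k (y - x1) - k (y - x2)).
have bOm : bounded_set Om.
  by case: bD => N [Nr HN]; exists N; split => // m Nm y [Dy _ _]; exact: (HN m Nm y Dy).
apply: (@max_principle_closure _ Om f) => //.
have pole (sg : R) x x' : `|sg| = 1 -> D x -> D x' -> x <> x' -> forall dd, 0 < dd ->
   \forall y \near x, Om y -> x' = x1 \/ x' = x2 -> x = x1 \/ x = x2 ->
    sg * (G y x - k (y - x)) - sg * (G y x' - k (y - x')) - d
    - eta * (2 * log_diam - k (y - x) - k (y - x')) <= 0 + dd.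
  move=> sg1 Dx Dx' xx' dd dd0.
  have [C HC] := green_kernel_pole Dx.
  have [c1 _ _] := hreg x' x Dx' Dx xx'.
  pose m := G x x' - k (x - x').
  have N1 : \forall y \near x, `|m - (G y x' - k (y - x'))| <= 1.
    by move/cvgr_dist_le : c1 => /(_ 1 ltr01).
  pose B := 2 * log_diam - log_diam - (C + `|m| + 1) / eta.
  have kp : \forall v \near x, v - x != 0 -> k (v - x) <= B.
    apply: (@near_sub _ x x (fun v => v != 0 -> k v <= B)).
    by rewrite subrr; exact: log_kernel_pole.
  have nD : \forall y \near x, D y by exact: open_nbhs_nbhs.
  apply: filterS (filterI (filterI HC N1) (filterI kp nD)) => y [[a1 a2] [a3 Dy]] [_ y1 y2] _ hx.
  have yx : y != x by apply/eqP; case: hx => ->.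
  have b1 := a1 yx.
  have b3 : k (y - x) <= B by apply: a3; rewrite subr_eq0.
  have b4 := log_kernel_le_diam Dy Dx'.
  have b5 : C + `|m| + 1 <= eta * (2 * log_diam - k (y - x) - k (y - x')).
    have h : (C + `|m| + 1) / eta <= 2 * log_diam - k (y - x) - k (y - x').
      by move: b3; rewrite /B; lra.
    by rewrite mulrC -ler_pdivrMr.
  have b6 : sg * (G y x - k (y - x)) <= C.
    by rewrite (le_trans (ler_norm _))// normrM sg1 mul1r.
  have b7 : - (sg * (G y x' - k (y - x'))) <= `|m| + 1.
    rewrite (le_trans (ler_norm _))// normrN normrM sg1 mul1r.
    have := ler_normD (- (m - (G y x' - k (y - x')))) m; rewrite normrN.
    by rewrite opprB subrK; lra.
  lra.
move=> y cy; have [->|/eqP y1] := eqVneq y x1.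
  right => dd dd0; apply: filterS (pole 1 x1 x2 (normr1 _) D1 D2 x12 dd dd0) => v h Ov.
  by have := h Ov (or_intror erefl) (or_introl erefl); rewrite !mul1r.
have [->|/eqP y2] := eqVneq y x2.
  have sg1 : `|(-1 : R)| = 1 by rewrite normrN normr1.
  right => dd dd0; apply: filterS (pole (-1) x2 x1 sg1 D2 D1 (nesym x12) dd dd0) => v h Ov.
  have := h Ov (or_introl erefl) (or_intror erefl); rewrite !mulN1r /f /h1 /h2; lra.
have [Dy|nDy] := pselect (D y).
  left.
  have [a1 a2 _] := hreg x1 y D1 Dy y1.
  have [b1 _ b3] := hreg x2 y D2 Dy y2.
  have [p1 p2 _] := log_kernel_lap_ge_pm (introN eqP y1).
  have [q1 q2 _] := log_kernel_lap_ge_pm (introN eqP y2).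
  split.
  - apply: filterS (filterI (near_punctured Dy y1) (near_punctured Dy y2)).
    by move=> v [[Dv v1] [_ v2]].
  - apply: cvgB; first by apply: cvgB; [exact: (cvgB a1 b1)|exact: cvg_cst].
    apply: cvgM; first exact: cvg_cst.
    by apply: cvgB => //; apply: cvgB => //; exact: cvg_cst.
  - have := lap_geD (lap_geD a2 b3) (lap_geD (lap_ge_cst (- d - eta * (2 * log_diam)) y)
      (lap_geZ (ltW e0) (lap_geD p2 q2))).
    rewrite !addr0 mulr0 !addr0; apply: lap_ge_near_eq.
    by apply: (filterS _ (filterT : nbhs y setT)) => v _; rewrite /f /h1 /h2; ring.
right => dd dd0; have d3 : 0 < dd / 3 by lra.
have fy : frontier D y.
  split; first by apply: closure_subset cy => v [].
  by move=> Di; apply: nDy; exact: interior_subset Di.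
have [p1 _ _] := log_kernel_lap_ge_pm (introN eqP y1).
have [q1 _ _] := log_kernel_lap_ge_pm (introN eqP y2).
have ckk : {for y, continuous (fun v : P => k (v - x1) - k (v - x2))} by exact: (cvgB p1 q1).
have nk : \forall v \near y, `|(k (y - x1) - k (y - x2)) - (k (v - x1) - k (v - x2))| <= dd / 3.
  by move/cvgr_dist_le : ckk => /(_ _ d3).
apply: filterS (filterI nk (filterI (green_kernel_boundary x1 nDy d3) (green_kernel_boundary x2 nDy d3))).
move=> v [n1 [n2 n3]] [Dv v1 v2].
have e1 := log_kernel_le_diam Dv D1; have e2 := log_kernel_le_diam Dv D2.
have e3 : 0 <= eta * (2 * log_diam - k (v - x1) - k (v - x2)) by apply: mulr_ge0; lra.
have := Hd y fy; move: n1 n2 n3; rewrite !ler_norml.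
move=> /andP[? ?] /andP[? ?] /andP[? ?] /andP[? ?].
rewrite /f /h1 /h2; lra.
Qed.

End green_kernel.

(** * Regularity and integrals of the Green function *)

Section green_kernel_regularity.
Context {R : realType}.
Local Notation P := (R * R)%type.
Context (D : set P) (g : P -> P -> \bar R).
Context (bD : bounded_set D) (oD : open D) (gD : laplace_green D g).

Local Notation G := (green_kernel D g).
Local Notation k := (log_kernel (0 : R)).

(** The frontier is compact, so logarithms with nearby poles are uniformly close on it. *)
Lemma green_regular_near xi0 d : D xi0 -> 0 < d ->
  \forall xi \near xi0, forall z, D z -> z <> xi -> z <> xi0 ->
    `|(G z xi - k (z - xi)) - (G z xi0 - k (z - xi0))| <= d.
Proof.
move=> D0 d0; have [M M0 HM] := bounded_setE bD.
have cF : compact (frontier D) by apply: compact_closure_diff => //; exact: open_interior.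
have Hc := (compact_near_coveringP _).1 cF.
have N1 : \forall xi \near xi0, frontier D `<=` [set z | `|k (z - xi) - k (z - xi0)| <= d].
  apply: (Hc P (nbhs xi0) (fun xi z => `|k (z - xi) - k (z - xi0)| <= d)) => z [_ nDz].
  have zx : z - xi0 != 0.
    rewrite subr_eq0; apply/eqP => zx; apply: nDz; rewrite zx.
    exact: open_nbhs_nbhs.
  have ck := continuous_log_kernel (sqmod_gt0 zx).
  have d2 : 0 < d / 2 by lra.
  have nk : \forall v \near z - xi0, `|k (z - xi0) - k v| <= d / 2.
    by move/cvgr_dist_le : ck => /(_ _ d2).
  have csub : {for (z, xi0), continuous (fun p : P * P => (p.1 - p.2 : P))}.
    apply: (@cvgB _ _ _ (nbhs (z, xi0)) _ fst snd); [exact: cvg_fst|exact: cvg_snd].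
  have n1 : \forall p \near (z, xi0), `|k (z - xi0) - k (p.1 - p.2)| <= d / 2.
    exact: (csub (fun v => `|k (z - xi0) - k v| <= d / 2)).
  have n2 : \forall p \near (z, xi0), `|k (z - xi0) - k (p.1 - xi0)| <= d / 2.
    have h : \forall y \near z, `|k (z - xi0) - k (y - xi0)| <= d / 2.
      exact: (@near_sub _ z xi0 (fun v => `|k (z - xi0) - k v| <= d / 2)).
    have cf : {for (z, xi0), continuous (fst : P * P -> P)} by exact: cvg_fst.
    exact: (cf (fun y => `|k (z - xi0) - k (y - xi0)| <= d / 2)).
  apply: filterS (filterI n1 n2) => -[y xi] /= [].
  rewrite !ler_norml => /andP[? ?] /andP[? ?]; apply/andP; split; lra.
apply: filterS (filterI N1 (open_nbhs_nbhs (conj oD D0))) => xi [Hxi Dxi] z Dz zx zx0.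
have [->|/eqP xx] := eqVneq xi xi0; first by rewrite subrr normr0 ltW.
rewrite ler_norml; apply/andP; split; last first.
  by apply: (green_regular_diff bD oD gD M0 HM Dxi D0 xx (ltW d0)) => // y /Hxi.
rewrite lerNl opprB.
apply: (green_regular_diff bD oD gD M0 HM D0 Dxi (nesym xx) (ltW d0)) => // y /Hxi /=.
by rewrite distrC.
Qed.

(** The regular part moves little with the pole, uniformly in [z], and the logarithm is
    continuous in the difference. *)
Lemma green_kernel_jcontinuous (p : P * P) : D p.1 -> D p.2 -> p.1 <> p.2 ->
  {for p, continuous (fun p : P * P => G p.1 p.2)}.
Proof.
case: p => z0 xi0 /= Dz Dx zx.
apply/cvgrPdist_le => d d0 /=.
have d3 : 0 < d / 4 by lra.
have z0' : z0 - xi0 != 0 by rewrite subr_eq0; exact/eqP.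
have ck := continuous_log_kernel (sqmod_gt0 z0').
have nk : \forall v \near z0 - xi0, `|k (z0 - xi0) - k v| <= d / 4.
  by move/cvgr_dist_le : ck => /(_ _ d3).
have c1 : {for (z0, xi0), continuous (fst : P * P -> P)} by exact: cvg_fst.
have c2 : {for (z0, xi0), continuous (snd : P * P -> P)} by exact: cvg_snd.
have csub : {for (z0, xi0), continuous (fun p : P * P => (p.1 - p.2 : P))}.
  exact: (@cvgB _ _ _ (nbhs (z0, xi0)) _ fst snd _ _ c1 c2).
have n1 : \forall p \near (z0, xi0), `|k (z0 - xi0) - k (p.1 - p.2)| <= d / 4.
  exact: (csub (fun v => `|k (z0 - xi0) - k v| <= d / 4)).
have n1' : \forall p \near (z0, xi0), p.1 - p.2 != 0.
  apply: (csub (fun v => v != 0)); exact: near_neq.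
have n2 : \forall p \near (z0, xi0), `|k (z0 - xi0) - k (p.1 - xi0)| <= d / 4.
  have h : \forall y \near z0, `|k (z0 - xi0) - k (y - xi0)| <= d / 4.
    exact: (@near_sub _ z0 xi0 (fun v => `|k (z0 - xi0) - k v| <= d / 4)).
  exact: (c1 (fun y => `|k (z0 - xi0) - k (y - xi0)| <= d / 4)).
have [cG _ _] := green_kernel_harmonic oD gD Dz Dx zx.
have n3 : \forall p \near (z0, xi0), `|G z0 xi0 - G p.1 xi0| <= d / 4.
  have h : \forall y \near z0, `|G z0 xi0 - G y xi0| <= d / 4.
    by move/cvgr_dist_le : cG => /(_ _ d3).
  exact: (c1 (fun y => `|G z0 xi0 - G y xi0| <= d / 4)).
have n4 : \forall p \near (z0, xi0), D p.1 /\ p.1 <> xi0.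
  exact: (c1 (fun y => D y /\ y <> xi0) (near_punctured oD Dz zx)).
have n5 : \forall p \near (z0, xi0), forall z, D z -> z <> p.2 -> z <> xi0 ->
    `|(G z p.2 - k (z - p.2)) - (G z xi0 - k (z - xi0))| <= d / 4.
  exact: (c2 _ (green_regular_near Dx d3)).
apply: filterS (filterI n1 (filterI n1' (filterI n2 (filterI n3 (filterI n4 n5))))).
move=> -[z xi] /= [h1 [h1' [h2 [h3 [[h4 h4'] h5]]]]].
have zxi : z <> xi by apply/eqP; rewrite -subr_eq0.
have := h5 z h4 zxi h4'; move: h1 h2 h3; rewrite !ler_norml.
move=> /andP[? ?] /andP[? ?] /andP[? ?] /andP[? ?]; apply/andP; split; lra.
Qed.

Lemma jmfun_green_kernel : jmfun G.
Proof.
have Oeq : forall p : P * P, ([/\ D p.1, D p.2 & p.1 <> p.2]) ->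
    \forall q \near p, [/\ D q.1, D q.2 & q.1 <> q.2].
  move=> [z xi] [/= Dz Dx zx].
  have c1 : {for (z, xi), continuous (fst : P * P -> P)} by exact: cvg_fst.
  have c2 : {for (z, xi), continuous (snd : P * P -> P)} by exact: cvg_snd.
  have csub : {for (z, xi), continuous (fun p : P * P => (p.1 - p.2 : P))}.
    exact: (@cvgB _ _ _ (nbhs (z, xi)) _ fst snd _ _ c1 c2).
  have n1 : \forall p \near (z, xi), D p.1 by exact: (c1 D (open_nbhs_nbhs (conj oD Dz))).
  have n2 : \forall p \near (z, xi), D p.2 by exact: (c2 D (open_nbhs_nbhs (conj oD Dx))).
  have n3 : \forall p \near (z, xi), p.1 - p.2 != 0.
    apply: (csub (fun v => v != 0)); apply: near_neq.
    by rewrite subr_eq0; exact/eqP.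
  apply: filterS (filterI n1 (filterI n2 n3)) => -[a b] [/= ? [? h]]; split => //.
  by apply/eqP; rewrite -subr_eq0.
apply: (@jmfun_continuous_on _ [set p | [/\ D p.1, D p.2 & p.1 <> p.2]]).
- by rewrite openE => p /Oeq.
- by move=> p [? ? ?]; exact: green_kernel_jcontinuous.
- by move=> [z xi] h; rewrite /green_kernel asboolF.
Qed.

Lemma green_kernel_continuous z xi : z <> xi -> {for z, continuous (G^~ xi)}.
Proof.
move=> zx; have [Dxi|nDxi] := pselect (D xi); last first.
  rewrite (_ : G^~ xi = fun=> 0); first exact: cvg_cst.
  by apply/funext => y; rewrite green_kernel_out//; right.
have [Dz|nDz] := pselect (D z); first by have [] := green_kernel_harmonic oD gD Dz Dxi zx.
apply/cvgrPdist_le => d d0; have := green_kernel_boundary gD xi nDz d0.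
by apply: filterS => y; rewrite [G z xi]green_kernel_out ?sub0r ?normrN//; left.
Qed.

Lemma green_kernel_bounds : exists A : R, [/\ 0 < A,
  (forall z, D z -> `|z| <= A),
  (forall z xi, G z xi ^+ 2 <= A * newton A (z - xi)) &
  (forall z xi, D z -> D xi -> `|z - xi| < A)].
Proof.
have [M M0 HM] := bounded_setE bD; have m2 := sqr_ge0 M.
pose A := 8 * M ^+ 2 + 1 + (2 * M + 1).
exists A; split; first by rewrite /A; lra.
- by move=> z /HM; rewrite /A; lra.
- move=> z xi; apply: le_trans (green_kernel_sqr bD oD gD M0 HM z xi) _.
  apply: ler_pM; [lra|exact: newton_ge0|rewrite /A; lra|].
  rewrite /newton; case: ifP => h; last by case: ifP => // _; rewrite invr_ge0.
  by rewrite ifT// (lt_le_trans h)// /A; lra.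
- move=> z xi /HM h1 /HM h2; rewrite (le_lt_trans (ler_normB _ _))// /A; lra.
Qed.

(** The bound on the square gives C2; then |G| <= 1 + G^2 on the bounded set [D] gives
    C1. *)
Lemma green_kernel_integrals : exists C1 C2 : R, [/\ 0 <= C1, 0 <= C2,
  (forall z, [/\ L1 (G z), L1 (fun xi => G z xi ^+ 2),
     pint (fun xi => `|G z xi|) <= C1 & pint (fun xi => G z xi ^+ 2) <= C2]) &
  (forall xi, [/\ L1 (G^~ xi), L1 (fun z => G z xi ^+ 2),
     pint (fun z => `|G z xi|) <= C1 & pint (fun z => G z xi ^+ 2) <= C2])].
Proof.
have [A [A0 HA HG _]] := green_kernel_bounds.
have LN := newton_L1 A0.
pose C2 := A * pint (newton A).
pose box (y : P) : R := if `|y - 0| <= A then 1 else 0.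
have Lb : L1 box by apply: L1_box; exact: ltW.
have b0 y : 0 <= box y by rewrite /box; case: ifP.
have C20 : 0 <= C2.
  by apply: mulr_ge0; [exact: ltW|apply: pint_ge0 => z; exact: newton_ge0].
have Gb z xi : `|G z xi| <= box z + G z xi ^+ 2 /\ `|G z xi| <= box xi + G z xi ^+ 2.
  have [[Dz Dxi]|h] := pselect (D z /\ D xi); last first.
    rewrite (@green_kernel_out _ D g z xi); last exact/not_andP.
    by rewrite normr0 !addr_ge0 ?sqr_ge0.
  rewrite /box !subr0 !HA// -[G z xi ^+ 2]real_normK ?num_real//.
  have := sqr_ge0 (`|G z xi| - 1); have := normr_ge0 (G z xi).
  by move: `|_| => a a0 h; split; nra.
exists (pint box + C2), C2; split => //; first by apply: addr_ge0 => //; exact: pint_ge0.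
  move=> z.
  have LNz : L1 (fun xi => A * newton A (z - xi)).
    have := L1Z A (L1_shift (- z) LN); apply: L1_eq => xi.
    by rewrite /newton distrC.
  have EN : pint (fun xi => A * newton A (z - xi)) = C2.
    rewrite /C2 -(pint_shift (- z) LN) -pintZ; last exact: L1_shift.
    by apply: pint_eq => xi; rewrite /newton distrC.
  have m1 : mfun (G z) by exact: (jmfun_row z jmfun_green_kernel).
  have m2 : mfun (fun xi => G z xi ^+ 2) by exact: measurable_funX.
  have L2 : L1 (fun xi => G z xi ^+ 2).
    by apply: L1_le m2 LNz _ => xi; rewrite ger0_norm ?sqr_ge0.
  have L : L1 (G z) by apply: L1_le m1 (L1D Lb L2) _ => xi; have [] := Gb z xi.
  have I2 : pint (fun xi => G z xi ^+ 2) <= C2 by rewrite -EN; exact: pint_le.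
  split => //; apply: (@le_trans _ _ (pint (fun xi => box xi + G z xi ^+ 2))).
    by apply: pint_le; [exact: L1_norm|exact: L1D|move=> xi; have [] := Gb z xi].
  by rewrite pintD// lerD2l.
move=> xi.
have LNz : L1 (fun z => A * newton A (z - xi)) by apply: L1Z; exact: L1_shift.
have EN : pint (fun z => A * newton A (z - xi)) = C2.
  by rewrite /C2 -(pint_shift (- xi) LN) -pintZ//; exact: L1_shift.
have m1 : mfun (G^~ xi) by exact: (jmfun_col xi jmfun_green_kernel).
have m2 : mfun (fun z => G z xi ^+ 2) by exact: measurable_funX.
have L2 : L1 (fun z => G z xi ^+ 2).
  by apply: L1_le m2 LNz _ => z; rewrite ger0_norm ?sqr_ge0.
have L : L1 (G^~ xi) by apply: L1_le m1 (L1D Lb L2) _ => z; have [] := Gb z xi.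
have I2 : pint (fun z => G z xi ^+ 2) <= C2 by rewrite -EN; exact: pint_le.
split => //; apply: (@le_trans _ _ (pint (fun z => box z + G z xi ^+ 2))).
  by apply: pint_le; [exact: L1_norm|exact: L1D|move=> z; have [] := Gb z xi].
by rewrite pintD// lerD2l.
Qed.

(** The Green function is a fundamental solution: off the diagonal it differs from
    the logarithm by a harmonic function with a removable singularity. *)
Lemma green_kernel_weak (c xi : P) (e e' : R) : 0 < e -> e < e' ->
  (forall y, `|y - c| < e' -> D y) ->
  pint (fun y => laplacian (bump e c) y * G y xi) = bump e c xi.
Proof.
move=> e0 ee' HD; have e'0 : 0 < e' by rewrite (lt_trans e0).
have [Dxi|nDxi] := pselect (D xi); last first.
  rewrite (pint_eq (g := fun=> 0)); last first.
    by move=> y; rewrite green_kernel_out ?mulr0//; right.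
  rewrite pint0 bump_eq0// leNgt; apply/negP => h; apply: nDxi; apply: HD.
  by rewrite (lt_trans h).
have [C1 [C2 [_ _ _ /(_ xi)[LG _ _ _]]]] := green_kernel_integrals.
pose F (y : P) := G y xi - k (y - xi).
have mk : mfun (fun y : P => k (y - xi)) by exact: mfun_shift (@mfun_log_kernel0 R).
have mG := L1_mfun LG.
have mF : mfun F by exact: measurable_funB.
have [B B0 HB] := bounded_laplacian_bump e0.
have Lk : L1 (fun y => if `|y - c| < e' then k (y - xi) else 0).
  have := L1_shift (- xi) (L1_log_kernel0_ball (c - xi) e'0).
  apply: L1_eq => y; have -> : y - xi - (c - xi) = y - c by rewrite opprB addrA subrK.
  by [].
have LGb : L1 (fun y => if `|y - c| < e' then G y xi else 0).
  apply: L1_le (L1_norm LG) _; first exact: mfun_if_ball.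
  by move=> y; case: ifP => // _; rewrite normr0.
have LF : L1 (fun y => if `|y - c| < e' then F y else 0).
  by apply: L1_eq (L1B LGb Lk) => y; case: ifP => // _; rewrite subr0.
have LNF : L1 (fun y => if `|y - c| < e' then - F y else 0).
  by apply: L1_eq (L1Z (-1) LF) => y; case: ifP => // _; [rewrite mulN1r|rewrite mulr0].
have [C HC] := green_kernel_pole oD gD Dxi.
have reg y : `|y - c| <= e -> y != xi -> lap_ge F y 0 /\ lap_ge (fun z => - F z) y 0.
  move=> yc yx; have Dy : D y by apply: HD; rewrite (le_lt_trans yc).
  have [a1 a2 a3] := green_kernel_harmonic oD gD Dy Dxi (elimN eqP yx).
  have [b1 b2 b3] := log_kernel_lap_ge_pm yx.
  split; first by have := lap_geD a2 b3; rewrite addr0.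
  have := lap_geD a3 b2; rewrite addr0; apply: lap_ge_near_eq.
  by apply: (filterS _ (filterT : nbhs y setT)) => v _; rewrite /F opprB addrC.
have h1 : 0 <= pint (fun y => laplacian (bump e c) y * F y).
  apply: (@weak_removable _ F c xi e e' C) => //.
    by move=> y yc yx; have [] := reg y yc yx.
  by apply: filterS HC => y h /h; apply: le_trans; exact: ler_norm.
have h2 : 0 <= pint (fun y => laplacian (bump e c) y * - F y).
  apply: (@weak_removable _ (fun y => - F y) c xi e e' C) => //.
  - exact: measurable_funN.
  - by move=> y yc yx; have [] := reg y yc yx.
  - by apply: filterS HC => y h /h; apply: le_trans; rewrite -normrN; exact: ler_norm.
have offb (f : P -> R) y : laplacian (bump e c) y * (if `|y - c| < e' then f y else 0) =
    laplacian (bump e c) y * f y.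
  case: ifP => // /negbT; rewrite -leNgt => h.
  by rewrite laplacian_bump_eq0 ?mul0r// (lt_le_trans ee').
have LlF : L1 (fun y => laplacian (bump e c) y * F y).
  by apply: L1_eq (L1M_bounded (mfun_laplacian_bump c e0) (HB c) LF) => y; exact: (offb F).
have Llk : L1 (fun y => laplacian (bump e c) y * k (y - xi)).
  by apply: L1_eq (L1M_bounded (mfun_laplacian_bump c e0) (HB c) Lk) => y; exact: (offb (fun y => k (y - xi))).
have F0 : pint (fun y => laplacian (bump e c) y * F y) = 0.
  have E : pint (fun y => laplacian (bump e c) y * - F y) =
      -1 * pint (fun y => laplacian (bump e c) y * F y).
    by rewrite -pintZ//; apply: pint_eq => y; rewrite mulN1r mulrN.
  by rewrite E mulN1r oppr_ge0 in h2; apply/eqP; rewrite eq_le h1 h2.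
transitivity (pint (fun y => laplacian (bump e c) y * F y) +
  pint (fun y => laplacian (bump e c) y * k (y - xi))).
  by rewrite -pintD//; apply: pint_eq => y; rewrite /F; ring.
by rewrite F0 add0r log_kernel_fundamental.
Qed.

End green_kernel_regularity.

(** * Uniqueness of weakly harmonic functions *)

Section weyl_uniqueness.
Context {R : realType}.
Local Notation P := (R * R)%type.

Lemma csmooth_lipschitz (f : R -> R) : csmooth f ->
  exists2 L, 0 <= L & forall x y, `|f x - f y| <= L * `|x - y|.
Proof.
move=> sf; have [B B0 HB] := csmooth_bounded (csmooth_derive sf).
have s1 : smooth1 f by case: sf.
exists B => //.
suff H x y : y <= x -> `|f x - f y| <= B * `|x - y|.
  move=> x y; have [yx|/ltW xy] := leP y x; first exact: H.
  by rewrite distrC (distrC x); exact: H.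
move=> yx; have c2 : {within `[y, x], continuous f}.
  by apply: continuous_subspaceT; exact: smooth1_continuous.
have df (u : R) : u \in `]y, x[ -> is_derive u 1 f (derive1 f u).
  by move=> _; apply: is_derive_derive1; exact: smooth1_derivable.
have [c _ ->] := @MVT_segment _ f (derive1 f) y x yx df c2.
by rewrite normrM ler_wpM2r.
Qed.

Lemma lipschitz_bump (e : R) : 0 < e -> exists2 L, 0 <= L &
  forall (c c' x : P), `|bump e c x - bump e c' x| <= L * `|c - c'|.
Proof.
move=> e0; have [L L0 HL] := csmooth_lipschitz (csmooth_bump1 0 e0).
have [B B0 HB] := csmooth_bounded (csmooth_bump1 0 e0).
exists (L * B + B * L) => [|c c' x]; first by rewrite addr_ge0// mulr_ge0.
have S (a u : R) : bump1 e a u = bump1 e 0 (u - a) by rewrite !bump1E subr0.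
rewrite /bump /tensor !(S c.1) !(S c.2) !(S c'.1) !(S c'.2).
set p1 := bump1 e 0 (x.1 - c.1); set p2 := bump1 e 0 (x.2 - c.2).
set q1 := bump1 e 0 (x.1 - c'.1); set q2 := bump1 e 0 (x.2 - c'.2).
have -> : p1 * p2 - q1 * q2 = (p1 - q1) * p2 + q1 * (p2 - q2) by ring.
have h1 : `|p1 - q1| <= L * `|c - c'|.
  apply: le_trans (HL _ _) _; rewrite ler_wpM2l// prod_normE le_max.
  have -> : x.1 - c.1 - (x.1 - c'.1) = - (c.1 - c'.1) by ring.
  by rewrite normrN lexx.
have h2 : `|p2 - q2| <= L * `|c - c'|.
  apply: le_trans (HL _ _) _; rewrite ler_wpM2l// prod_normE le_max.
  have -> : x.2 - c.2 - (x.2 - c'.2) = - (c.2 - c'.2) by ring.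
  by rewrite normrN lexx orbT.
rewrite (le_trans (ler_normD _ _))// (normrM (p1 - q1)) (normrM q1) mulrDl lerD//.
  by rewrite [leRHS]mulrAC; apply: ler_pM => //; exact: HB.
by rewrite -[leRHS]mulrA; apply: ler_pM => //; exact: HB.
Qed.

Lemma pint_bump_shift e (c : P) : 0 < e -> pint (bump e c) = pint (bump e 0).
Proof.
move=> e0; rewrite -(pint_shift (- c) (L1_bump 0 e0)).
by apply: pint_eq => y; rewrite [LHS]bump_shift.
Qed.

Lemma pint_box (e : R) : 0 <= e -> pint (fun y : P => if `|y - 0| <= e then 1 else 0) = 4 * e ^+ 2.
Proof.
move=> e0; rewrite /pint /Rintegral -[RHS]/(fine (4 * e ^+ 2)%:E); congr fine.
rewrite -(plane_area_closed_box e0) -[X in plane_area X]setIT -integral_indic//; last first.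
  exact: measurable_closed_box.
apply: eq_integral => y _; rewrite indicE subr0; congr EFin.
by case: ifP => h; [rewrite mem_set|rewrite memNset//= h].
Qed.

Lemma pint_bump_gt0 e : 0 < e -> 0 < pint (bump e (0 : P)).
Proof.
move=> e0; have e2 : 0 <= e / 2 by lra.
have [||m] := @compact_EVT_min _ R (bump e (0 : P)) [set y | `|y - 0| <= e / 2] _
    (@compact_box R 0 (e / 2)).
- by exists 0; rewrite /= subrr normr0.
- by apply: continuous_subspaceT => y; exact: continuous_bump.
rewrite inE /= => me Hm.
have bm : 0 < bump e 0 m by apply: bump_gt0 => //; rewrite (le_lt_trans me)//; lra.
have Lb := L1_box (0 : P) e2.
apply: (@lt_le_trans _ _ (bump e 0 m * (4 * (e / 2) ^+ 2))).
  by rewrite mulr_gt0// mulr_gt0// exprn_gt0//; lra.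
rewrite -(pint_box e2) -pintZ//; apply: pint_le; [exact: L1Z|exact: L1_bump|].
move=> y; case: ifP => h; last by rewrite mulr0 bump_ge0.
by rewrite mulr1; apply: Hm; rewrite inE.
Qed.

Lemma compact_margin (K D : set P) : compact K -> open D -> K `<=` D ->
  exists2 s, 0 < s & forall z, K z -> forall y, `|y - z| < s -> D y.
Proof.
move=> cK oD KD; have Hc := (compact_near_coveringP _).1 cK.
have : \forall s \near (0 : R), K `<=` [set z | forall y, `|y - z| < s -> D y].
  apply: (Hc R (nbhs (0 : R)) (fun s z => forall y, `|y - z| < s -> D y)) => z Kz.
  have /nbhs_ballP[r /= r0 Hr] : nbhs z D by exact: (open_nbhs_nbhs (conj oD (KD z Kz))).
  exists (ball z (r / 2), ball (0 : R) (r / 2)).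
    by split; apply: nbhsx_ballx; lra.
  move=> [y s] /= []; rewrite -!ball_normE /= sub0r normrN => yz sr x xy.
  apply: Hr; rewrite -ball_normE /=.
  have -> : z - x = (z - y) + (y - x) by rewrite addrA subrK.
  rewrite (le_lt_trans (ler_normD _ _))// [`|y - x|]distrC.
  by have := ler_norm s; lra.
move=> /nbhs_ballP[r /= r0 Hr]; exists (r / 2); first lra.
move=> z Kz; apply: (Hr (r / 2) _ z Kz).
by rewrite -ball_normE /ball_ /= sub0r normrN gtr0_norm; lra.
Qed.

Definition mollify (e : R) (v : P -> R) (z : P) : R := pint (fun y => bump e z y * v y).

Lemma L1_mollify (e : R) (v : P -> R) (z : P) : 0 < e -> L1 v -> L1 (fun y => bump e z y * v y).
Proof.
move=> e0 Lv; have [B B0 HB] := bounded_bump e0.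
exact: L1M_bounded (mfun_bump z e0) (HB z) Lv.
Qed.

Lemma mollify_continuous (e : R) (v : P -> R) (z : P) : 0 < e -> L1 v -> {for z, continuous (mollify e v)}.
Proof.
move=> e0 Lv; have [L L0 HL] := lipschitz_bump e0.
apply/cvgrPdist_le => d d0; pose N := pint (fun y => `|v y|).
have N0 : 0 <= N by apply: pint_ge0.
have r0 : 0 < d / (L * N + 1) by rewrite divr_gt0//; have := mulr_ge0 L0 N0; lra.
have : \forall y \near z, `|z - y| < d / (L * N + 1).
  by apply/nbhs_ballP; exists (d / (L * N + 1)) => //= y; rewrite -ball_normE.
apply: filterS => y yz.
rewrite /mollify -pintB; [|exact: L1_mollify..].
apply: (@le_trans _ _ (L * `|z - y| * N)).
  rewrite -pintZ; last exact: L1_norm.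
  apply: pint_norm_le.
  - by apply: L1_mfun; apply: L1B; exact: L1_mollify.
  - by apply: L1Z; exact: L1_norm.
  - by move=> x; rewrite -mulrBl normrM ler_wpM2r.
move: yz; rewrite ltr_pdivlMr; last by have := mulr_ge0 L0 N0; lra.
have := normr_ge0 (z - y); have := mulr_ge0 L0 N0; move: `|z - y| => q; nra.
Qed.

Lemma sdiff_mollify (e : R) (v : P -> R) (z : P) (t : R) : 0 < e -> L1 v ->
  sdiff (mollify e v) t z = pint (fun y => sdiff (bump e z) t y * v y).
Proof.
move=> e0 Lv; have Lm c := L1_mollify c e0 Lv.
rewrite {1}/sdiff /mollify -(pint_sum5 (Lm _) (Lm _) (Lm _) (Lm _) (Lm _)).
apply: pint_eq => y; rewrite /sdiff.
have E (a b : P) : y - a = b - z -> bump e a y = bump e z b.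
  by move=> h; rewrite bump_shift h -bump_shift.
have A (u1 u2 : R) : y - (z.1 + u1, z.2 + u2) = (y.1 - u1, y.2 - u2) - z.
  by congr (_, _) => /=; ring.
have e1 := E (z.1 + t, z.2) (y.1 - t, y.2).
have e2 := E (z.1 - t, z.2) (y.1 + t, y.2).
have e3 := E (z.1, z.2 + t) (y.1, y.2 - t).
have e4 := E (z.1, z.2 - t) (y.1, y.2 + t).
rewrite e1 ?e2 ?e3 ?e4; first ring.
all: by congr (_, _) => /=; ring.
Qed.

(** Second differences pass to the bump; their main term is its Laplacian, which
    integrates to 0 against [v]. *)
Lemma mollify_lap_ge (e e' : R) (v : P -> R) (D : set P) (z : P) : 0 < e -> e < e' -> L1 v ->
  (forall y, `|y - z| < e' -> D y) ->
  (forall c r, e < r -> (forall y, `|y - c| < r -> D y) ->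
     pint (fun y => laplacian (bump e c) y * v y) = 0) ->
  lap_ge (mollify e v) z 0.
Proof.
move=> e0 ee' Lv HD Hv d d0.
have [L L0 HL] := sdiff_bump e0; pose N := pint (fun y => `|v y|).
have N0 : 0 <= N by apply: pint_ge0.
have LN := mulr_ge0 L0 N0.
have r0 : 0 < d / (L * N + 1) by rewrite divr_gt0//; lra.
exists (ball z ((e' - e) / 2), ball (0 : R) (d / (L * N + 1))).
  by split; apply: nbhsx_ballx => //; lra.
move=> [y t] /= []; rewrite -!ball_normE /= sub0r normrN => yz tr.
have w0 : pint (fun x => laplacian (bump e y) x * v x) = 0.
  apply: (Hv y ((e + e') / 2)); first lra.
  move=> x xy; apply: HD; have -> : x - z = (x - y) + (y - z) by rewrite addrA subrK.
  by rewrite (le_lt_trans (ler_normD _ _))// [`|y - z|]distrC; lra.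
have [B B0 HB] := bounded_laplacian_bump e0.
have Ll : L1 (fun x => laplacian (bump e y) x * v x).
  by apply: L1M_bounded (HB y) Lv; exact: mfun_laplacian_bump.
have Ls : L1 (fun x => sdiff (bump e y) t x * v x).
  have [B1 B10 HB1] := bounded_bump e0.
  apply: (@L1M_bounded _ _ _ (L * `|t| ^+ 3 + B * t ^+ 2)) => //.
    by apply: L1_mfun; apply: L1_sdiff; exact: L1_bump.
  move=> x; have := HL y x t; have := HB y x => h1 h2.
  have -> : sdiff (bump e y) t x = (sdiff (bump e y) t x - laplacian (bump e y) x * t ^+ 2) + laplacian (bump e y) x * t ^+ 2.
    by rewrite subrK.
  rewrite (le_trans (ler_normD _ _))// lerD// normrM [`|t ^+ 2|]ger0_norm ?sqr_ge0//.
  by rewrite ler_wpM2r ?sqr_ge0.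
have : `|sdiff (mollify e v) t y| <= L * `|t| ^+ 3 * N.
  rewrite sdiff_mollify//.
  have -> : pint (fun x => sdiff (bump e y) t x * v x) =
     pint (fun x => sdiff (bump e y) t x * v x - t ^+ 2 * (laplacian (bump e y) x * v x)).
    rewrite pintB//; last exact: L1Z.
    by rewrite pintZ// w0 mulr0 subr0.
  rewrite -pintZ; last exact: L1_norm.
  apply: pint_norm_le.
  - by apply: L1_mfun; apply: L1B => //; exact: L1Z.
  - by apply: L1Z; exact: L1_norm.
  move=> x; have -> : sdiff (bump e y) t x * v x - t ^+ 2 * (laplacian (bump e y) x * v x)
    = (sdiff (bump e y) t x - laplacian (bump e y) x * t ^+ 2) * v x by ring.
  by rewrite normrM ler_wpM2r.
rewrite ler_norml => /andP[h _]; apply: le_trans h.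
have tt : t ^+ 2 = `|t| ^+ 2 by rewrite real_normK// num_real.
rewrite sub0r mulNr lerN2 tt.
have -> : L * `|t| ^+ 3 * N = (L * N * `|t|) * `|t| ^+ 2 by ring.
rewrite ler_wpM2r ?exprn_ge0//.
move: tr; rewrite ltr_pdivlMr; last lra.
have := normr_ge0 t; move: `|t| => a; nra.
Qed.

(** Weyl's lemma combined with the maximum principle. A mollification of [v] is
    subharmonic on a compact core of [D] and, since [v] is small off a compact subset of
    [D], it is small outside the core. Hence it is small at [z1], where it is close to
    [v z1] if the scale is fine. *)
Lemma weakly_harmonic_le0 (D : set P) (w : P) (v : P -> R) :
  bounded_set D -> open D -> D w -> L1 v ->
  (forall z, z <> w -> {for z, continuous v}) ->
  (forall z, ~ D z -> v z = 0) ->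
  (forall e c r, 0 < e -> e < r -> (forall y, `|y - c| < r -> D y) ->
     pint (fun y => laplacian (bump e c) y * v y) = 0) ->
  forall z, z <> w -> v z <= 0.
Proof.
move=> bD oD Dw Lv cv v0 wv z1 z1w; rewrite leNgt; apply/negP => vz1.
pose d := v z1 / 3; have d0 : 0 < d by rewrite /d; lra.
pose V := ([set y | v y <= d])°.
have oV : open V by exact: open_interior.
have Vb z : ~ D z -> V z.
  move=> nDz; have zw : z <> w by move=> zw; apply: nDz; rewrite zw.
  have : \forall y \near z, v y < d.
    apply: (cv z zw [set x | x < d]); apply: open_nbhs_nbhs.
    by split; [exact: open_lt|rewrite /= v0].
  by apply: filterS => y /ltW.
(* The point w joins K because v is not controlled there. *)
pose K := (closure D `\` V) `|` [set w].
have cK : compact K.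
  by apply: compactU; [exact: compact_closure_diff|exact: compact_set1].
have KD : K `<=` D.
  by move=> z [[_ nV]|-> //]; apply: contrapT => /Vb.
have [s s0 Hs] := compact_margin cK oD KD.
have vout z : ~ K z -> v z <= d.
  move=> nK; have Vz : V z.
    apply: contrapT => nV; apply: nK; left; split => //.
    by apply: subset_closure; apply: contrapT => /Vb.
  exact: (interior_subset Vz).
have n1 : \forall y \near z1, 2 * d < v y.
  apply: (cv z1 z1w [set x | 2 * d < x]); apply: open_nbhs_nbhs.
  by split; [exact: open_gt|rewrite /= /d; lra].
move: n1 => /nbhs_ballP[r /= r0 Hr].
(* The scale keeps supports inside D, and inside the square where v > 2 d. *)
pose e := Num.min (s / 4) (r / 2).
have e0 : 0 < e by rewrite lt_min !divr_gt0.
have es : e <= s / 4 by rewrite ge_min lexx.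
have er : e <= r / 2 by rewrite ge_min lexx orbT.
pose m := pint (bump e (0 : P)); have m0 : 0 < m by exact: pint_bump_gt0.
pose K2 := [set z : P | forall y, ~ D y -> s / 2 <= `|z - y|].
have cK2 : compact K2.
  have K2D : K2 `<=` D.
    move=> z K2z; apply: contrapT => nDz; have := K2z z nDz.
    by rewrite subrr normr0; lra.
  have [M M0 HM] := bounded_setE bD.
  apply: (@subclosed_compact _ _ [set y : P | `|y - 0| <= M]).
  - have -> : K2 = ~` (\bigcup_(y in ~` D) [set z : P | `|z - y| < s / 2]).
      apply/seteqP; split => [z K2z [y nDy] /=|z nU y nDy].
        by rewrite ltNge K2z.
      by rewrite leNgt; apply/negP => h; apply: nU; exists y.
    apply: open_closedC; apply: bigcup_open => y _.
    apply: (@open_comp _ _ (fun z : P => `|z - y|) [set x : R | x < s / 2]).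
      by move=> z _; exact: continuous_plane_norm.
    exact: open_lt.
  - exact: compact_box.
  - by move=> z /K2D Dz; rewrite /= subr0; exact: HM.
have mp : mollify e v z1 <= d * m.
  apply: (@max_principle _ setT K2 (mollify e v) (d * m) cK2) => //.
    move=> z K2z; split; [exact: mollify_continuous|exact: filterT|].
    apply: (@mollify_lap_ge e (s / 2) v D) => //; first lra.
      move=> y yz; apply: contrapT => nDy; have := K2z y nDy.
      by rewrite distrC leNgt yz.
    by move=> c r' er' Hc; exact: (wv e c r').
  move=> z _ nK2; have [y [nDy zy]] : exists y, ~ D y /\ `|z - y| < s / 2.
    apply: contrapT => h; apply: nK2 => y nDy; rewrite leNgt; apply/negP => zy.
    by apply: h; exists y.
  rewrite /mollify /m -(pint_bump_shift z e0) -pintZ; last exact: L1_bump.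
  apply: pint_le; [exact: L1_mollify|by apply: L1Z; exact: L1_bump|].
  move=> x; have [xe|xe] := ltP `|x - z| e; last by rewrite bump_eq0// mul0r mulr0.
  rewrite mulrC ler_wpM2r ?bump_ge0//; apply: vout => Kx; apply: nDy.
  apply: (Hs x Kx); have -> : y - x = (y - z) + (z - x) by rewrite addrA subrK.
  by rewrite (le_lt_trans (ler_normD _ _))// (distrC y) (distrC z x); lra.
have : 2 * d * m <= mollify e v z1.
  rewrite /mollify /m -(pint_bump_shift z1 e0) -pintZ; last exact: L1_bump.
  apply: pint_le; [by apply: L1Z; exact: L1_bump|exact: L1_mollify|].
  move=> x; have [xe|xe] := ltP `|x - z1| e; last by rewrite bump_eq0// mul0r mulr0.
  rewrite [leRHS]mulrC ler_wpM2r ?bump_ge0//; apply: ltW; apply: Hr.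
  by rewrite -ball_normE /= distrC; lra.
have := mulr_gt0 d0 m0; lra.
Qed.

Lemma weakly_harmonic_eq0 (D : set P) (w : P) (v : P -> R) :
  bounded_set D -> open D -> D w -> L1 v ->
  (forall z, z <> w -> {for z, continuous v}) ->
  (forall z, ~ D z -> v z = 0) ->
  (forall e c r, 0 < e -> e < r -> (forall y, `|y - c| < r -> D y) ->
     pint (fun y => laplacian (bump e c) y * v y) = 0) ->
  forall z, z <> w -> v z = 0.
Proof.
move=> bD oD Dw Lv cv v0 wv z zw; apply/eqP; rewrite eq_le; apply/andP; split.
  exact: (weakly_harmonic_le0 bD oD Dw Lv cv v0 wv).
rewrite -oppr_le0.
apply: (@weakly_harmonic_le0 D w (fun y => - v y) bD oD Dw) zw.
- by apply: L1_eq (L1Z (-1) Lv) => y; rewrite mulN1r.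
- by move=> y yw; exact: (cvgN (cv y yw)).
- by move=> y nDy; rewrite v0// oppr0.
move=> e c r e0 er Hc; have [B B0 HB] := bounded_laplacian_bump e0.
have Ll := L1M_bounded (mfun_laplacian_bump c e0) (HB c) Lv.
rewrite (pint_eq (g := fun y => -1 * (laplacian (bump e c) y * v y))); last first.
  by move=> y; rewrite mulN1r mulrN.
by rewrite pintZ// (wv e c r)// mulr0.
Qed.

End weyl_uniqueness.

(** * Continuity of the Green potential *)

Section green_potential.
Context {R : realType}.
Local Notation P := (R * R)%type.
Context (D : set P) (g : P -> P -> \bar R).
Context (bD : bounded_set D) (oD : open D) (gD : laplace_green D g).

Local Notation G := (green_kernel D g).

Definition green_potential (u : P -> R) (z : P) : R := pint (fun xi => G z xi * u xi).
Local Notation T := green_potential.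

Lemma green_potential_out (u : P -> R) z : ~ D z -> T u z = 0.
Proof.
move=> nDz; rewrite /green_potential (pint_eq (g := fun=> 0)) ?pint0// => xi.
by rewrite green_kernel_out ?mul0r//; left.
Qed.

Lemma mfun_green_integrand (u : P -> R) z : mfun u -> mfun (fun xi => G z xi * u xi).
Proof.
by move=> mu; apply: measurable_funM => //; exact: (jmfun_row z (jmfun_green_kernel bD oD gD)).
Qed.

Definition green_trunc (N : R) (z xi : P) : R := Num.max (G z xi) (- N).

Lemma green_trunc_norm N z xi : 0 <= N -> `|green_trunc N z xi| <= N.
Proof.
move=> N0; have := green_kernel_le0 bD oD gD z xi; rewrite /green_trunc ler_norml maxEle => h.
by case: ifPn => [?|]; [apply/andP; split; lra|rewrite -ltNge => ?; apply/andP; split; lra].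
Qed.

(** Where the truncation is active, |G| exceeds [N], so the error is at most G^2 / N times
    |u|; and there [xi] is so close to [z] that the bound on [u] applies. *)
Lemma green_trunc_error (z0 : P) (r B : R) (u : P -> R) : 0 < r ->
  (forall xi, `|xi - z0| < r -> `|u xi| <= B) ->
  exists2 N0, 0 < N0 & forall N z xi, N0 <= N -> `|z - z0| < r / 2 ->
    `|G z xi * u xi - green_trunc N z xi * u xi| <= B / N * G z xi ^+ 2.
Proof.
move=> r0 Hu; have B0 : 0 <= B by apply: le_trans (Hu z0 _) => //; rewrite subrr normr0.
have [A [A0 _ HG _]] := green_kernel_bounds bD oD gD.
exists (1 + 2 * A / r) => [|N z xi HN zr].
  by rewrite addr_gt0// divr_gt0// mulr_gt0.
have N1 : 1 <= N by have : 0 < 2 * A / r; [rewrite divr_gt0// mulr_gt0|lra].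
have N0 : 0 < N by lra.
rewrite /green_trunc maxEle; case: ifPn => [GN|_]; last first.
  by rewrite subrr normr0 mulr_ge0 ?sqr_ge0// divr_ge0// ltW.
have g0 := green_kernel_le0 bD oD gD z xi.
have hr : `|xi - z0| < r.
  have hA := HG z xi; have : N ^+ 2 <= A * newton A (z - xi) by apply: le_trans hA; nra.
  rewrite /newton; case: ifP => _ h; last by exfalso; nra.
  have v0 : 0 < `|z - xi|.
    rewrite lt_neqAle normr_ge0 andbT eq_sym; apply/eqP => v0.
    by move: h; rewrite v0 invr0; nra.
  have {}h : N ^+ 2 * `|z - xi| <= A by rewrite -ler_pdivlMr.
  have h2 : 2 * A <= N * r.
    by rewrite -ler_pdivrMr//; move: HN; lra.
  have h3 : `|z - xi| <= r / 2.
    have : N * (2 * N * `|z - xi|) <= N * r by lra.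
    by rewrite ler_pM2l//; move: (`|_|) v0 => q q0; nra.
  have -> : xi - z0 = (z - z0) - (z - xi) by rewrite opprB [RHS]addrC addrA subrK.
  by rewrite (le_lt_trans (ler_normB _ _))//; lra.
have := Hu _ hr => hu.
rewrite -mulrBl normrM opprK.
rewrite [leRHS]mulrAC ler_pdivlMr//.
have : `|G z xi + N| * N <= G z xi ^+ 2 by rewrite ler0_norm; nra.
move: `|_ + N| (normr_ge0 (G z xi + N)) => q q0 hq; have := normr_ge0 (u xi).
move: `|u xi| hu => uu h1 h2.
have -> : q * uu * N = uu * (q * N) by ring.
by apply: ler_pM => //; nra.
Qed.

Lemma L1_green_trunc N z (u : P -> R) : 0 <= N -> L1 u -> L1 (fun xi => green_trunc N z xi * u xi).
Proof.
move=> N0 Lu; apply: (@L1M_bounded _ _ _ N) => //; last by move=> xi; exact: green_trunc_norm.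
apply: measurable_maxr; last exact: measurable_cst.
exact: (jmfun_row z (jmfun_green_kernel bD oD gD)).
Qed.

Lemma L1_green_integrand (z0 : P) (r B : R) (u : P -> R) : 0 < r -> L1 u ->
  (forall xi, `|xi - z0| < r -> `|u xi| <= B) ->
  forall z, `|z - z0| < r / 2 -> L1 (fun xi => G z xi * u xi).
Proof.
move=> r0 Lu Hu z zr; have [N N0 HN] := green_trunc_error r0 Hu.
have [C1 [C2 [_ _ /(_ z)[_ L2 _ _] _]]] := green_kernel_integrals bD oD gD.
have LN := L1_green_trunc z (ltW N0) Lu.
have := L1D LN (_ : L1 (fun xi => G z xi * u xi - green_trunc N z xi * u xi)).
have -> : (fun xi => green_trunc N z xi * u xi + (G z xi * u xi - green_trunc N z xi * u xi))
   = fun xi => G z xi * u xi by apply/funext => xi; rewrite addrC subrK.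
apply; apply: (@L1_le _ _ (fun xi => B / N * G z xi ^+ 2)).
- apply: measurable_funB; last exact: L1_mfun LN.
  by apply: mfun_green_integrand; exact: L1_mfun.
- exact: L1Z.
- by move=> xi; exact: HN.
Qed.

(** The truncated potentials are continuous by domination, and they converge uniformly
    near [z0]. *)
Lemma green_potential_continuous (z0 : P) (u : P -> R) : L1 u -> {for z0, continuous u} ->
  {for z0, continuous (T u)}.
Proof.
move=> Lu cu.
have [r r0 Hu] : exists2 r, 0 < r & forall xi, `|xi - z0| < r -> `|u xi| <= `|u z0| + 1.
  have : \forall xi \near z0, `|u z0 - u xi| <= 1 by move/cvgr_dist_le : cu => /(_ 1 ltr01).
  move=> /nbhs_ballP[r /= r0 Hr]; exists r => // xi xr.
  have := Hr xi; rewrite -ball_normE /= distrC => /(_ xr) h.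
  have := ler_normB (u z0) (u z0 - u xi); rewrite subKr; lra.
set B := _ + 1 in Hu; have B0 : 0 < B by rewrite ltr_wpDl.
have [N0 N00 HN] := green_trunc_error r0 Hu.
have [C1 [C2 [_ C20 HC _]]] := green_kernel_integrals bD oD gD.
have Lz := L1_green_integrand r0 Lu Hu.
have err N z : N0 <= N -> `|z - z0| < r / 2 ->
    `|T u z - pint (fun xi => green_trunc N z xi * u xi)| <= B / N * C2.
  move=> NN zr; have N_0 : 0 < N by rewrite (lt_le_trans N00).
  have LN := L1_green_trunc z (ltW N_0) Lu.
  have [_ L2 _ HC2] := HC z.
  rewrite /green_potential -pintB//; last exact: Lz.
  apply: (@le_trans _ _ (pint (fun xi => B / N * G z xi ^+ 2))).
    apply: pint_norm_le; [|exact: L1Z|by move=> xi; exact: HN].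
    by apply: L1_mfun; apply: L1B => //; exact: Lz.
  by rewrite pintZ// ler_wpM2l// divr_ge0// ltW.
apply/cvgrPdist_le => d d0; apply: contrapT => nH.
have seq n : exists y, `|y - z0| < (n.+1)%:R^-1 /\ d < `|T u z0 - T u y|.
  apply: contrapT => nE; apply: nH.
  suff : \forall y \near z0, `|T u z0 - T u y| <= d by [].
  apply/nbhs_ballP.
  exists (n.+1)%:R^-1 => /=; first by rewrite invr_gt0.
  move=> y; rewrite -ball_normE /= distrC => yn; rewrite leNgt; apply/negP => yd.
  by apply: nE; exists y.
have [y Hy] := choice seq.
have yz : y @ \oo --> z0.
  apply/cvgrPdist_lt => s s0; near=> n; rewrite distrC (lt_trans (Hy n).1)//.
  by near: n; exact: near_infty_natSinv_lt (PosNum s0).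
(* At this level the truncation costs at most d / 3. *)
pose N := Num.max N0 (3 * B * C2 / d + 1).
have NN0 : N0 <= N by rewrite le_max lexx.
have N_0 : 0 < N by rewrite (lt_le_trans N00).
have Nd : B / N * C2 <= d / 3.
  rewrite mulrAC ler_pdivrMr//.
  have : 3 * B * C2 / d + 1 <= N by rewrite le_max lexx orbT.
  have : 3 * B * C2 / d * d = 3 * B * C2 by rewrite divfK// gt_eqF.
  move: (_ / d) => q; nra.
have cT : (fun n => pint (fun xi => green_trunc N (y n) xi * u xi)) @ \oo -->
    pint (fun xi => green_trunc N z0 xi * u xi).
  apply: (@pint_dominated _ z0 _ _ (fun xi => N * `|u xi|)).
  - by move=> n; apply: L1_mfun; apply: L1_green_trunc => //; exact: ltW.
  - by apply: L1_mfun; apply: L1_green_trunc => //; exact: ltW.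
  - by apply: L1Z; exact: L1_norm.
  - by move=> n xi _; rewrite normrM ler_wpM2r// green_trunc_norm// ltW.
  move=> xi xz; apply: cvgM; last exact: cvg_cst.
  apply: (@cvg_comp _ _ _ y (fun z => green_trunc N z xi) _ _ _ yz).
  apply: (@continuous_max _ _ (G^~ xi) (fun=> - N)); last exact: cvg_cst.
  by apply: green_kernel_continuous => // zx; apply: xz.
have d3 : 0 < d / 3 by lra.
have e1 : \forall n \near \oo, `|pint (fun xi => green_trunc N z0 xi * u xi) -
    pint (fun xi => green_trunc N (y n) xi * u xi)| < d / 3.
  by move/cvgr_dist_lt : cT => /(_ _ d3).
have r2 : 0 < r / 2 by lra.
have e2 : \forall n \near \oo, `|z0 - y n| < r / 2.
  by move/cvgr_dist_lt : yz => /(_ _ r2).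
have [n [h1 h2]] := filter_ex (filterI e1 e2).
rewrite distrC in h2.
have z00 : `|z0 - z0| < r / 2 by rewrite subrr normr0.
have [_] := Hy n; rewrite ltNge => /negP; apply.
have := le_trans (err N z0 NN0 z00) Nd.
have := le_trans (err N (y n) NN0 h2) Nd.
move: h1; rewrite !ler_norml !ltr_norml.
by move=> /andP[? ?] /andP[? ?] /andP[? ?]; apply/andP; split; lra.
Unshelve. all: by end_near. Qed.
End green_potential.

(** * The Helmholtz Green function as a real function *)

Section off_points.
Context {R : realType}.
Local Notation P := (R * R)%type.
Local Notation pl := (measurableTypeR R * measurableTypeR R)%type.

Lemma measurable_compact (K : set P) : compact K -> measurable (K : set pl).
Proof.
move=> cK; rewrite -[K]setCK; apply: measurableC; apply: open_plane.
by apply/closed_openC; apply: compact_closed => //; exact: norm_hausdorff.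
Qed.

(** Extended real functions with poles are identified with real functions away from
    them. *)
Lemma measurable_off_points (w1 w2 : P) (f : P -> R) (U : P -> \bar R) : mfun f ->
  (forall z, z <> w1 -> z <> w2 -> U z = (f z)%:E) ->
  measurable_fun [set: pl] (U : pl -> \bar R).
Proof.
move=> mf fU.
have -> : U = fun z => if z == w1 then U w1 else if z == w2 then U w2 else (f z)%:E.
  by apply/funext => z; case: eqP => [->//|h1]; case: eqP => [->//|h2]; exact: fU.
have mb (w : P) : measurable_fun [set: pl] (fun z : pl => z == w :> P).
  apply: (measurable_fun_bool true).
  rewrite setTI (_ : _ @^-1` _ = [set w]); first exact: measurable_point.
  by apply/seteqP; split => z /= => [/eqP//|->]; rewrite eqxx.
apply: measurable_fun_if => //.
apply: (@measurable_funS _ _ _ _ setT) => //; apply: measurable_fun_if => //.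
apply: (@measurable_funS _ _ _ _ setT) => //; exact/measurable_EFinP.
Qed.

Lemma ae_off_points (w1 w2 : P) (Q : P -> Prop) :
  (forall z, z <> w1 -> z <> w2 -> Q z) -> {ae plane_area, forall z, Q z}.
Proof.
move=> HQ; exists ([set w1] `|` [set w2]); split.
- by apply: measurableU; exact: measurable_point.
- apply/eqP; rewrite -measure_le0; apply: le_trans (measureU2 _ _ _) _; try exact: measurable_point.
  by rewrite [X in (X + _)%E](plane_area_point w1) [X in (_ + X)%E](plane_area_point w2) adde0.
- by move=> z /= nQ; apply: contrapT => /not_orP[h1 h2]; apply: nQ; exact: HQ.
Qed.

Lemma integral_off_points (w1 w2 : P) (f : P -> R) (U : P -> \bar R) : mfun f ->
  (forall z, z <> w1 -> z <> w2 -> U z = (f z)%:E) ->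
  (\int[plane_area]_z U z = \int[plane_area]_z (f z)%:E)%E.
Proof.
move=> mf fU; apply: ae_eq_integral => //.
- exact: (measurable_off_points mf fU).
- exact/measurable_EFinP.
- have := @ae_off_points w1 w2 (fun z => [set: pl] z -> U z = (f z)%:E).
  by apply => z h1 h2 _; exact: fU.
Qed.

Lemma L1_off_points (w1 w2 : P) (f : P -> R) (U : P -> \bar R) : mfun f ->
  (forall z, z <> w1 -> z <> w2 -> U z = (f z)%:E) ->
  plane_area.-integrable [set: pl] U -> L1 f.
Proof.
move=> mf fU /integrableP[mU UI]; apply/integrableP; split; first exact/measurable_EFinP.
move: UI; congr (_ < _)%E; apply: ae_eq_integral => //.
- exact: measurableT_comp.
- by apply: measurableT_comp => //; exact/measurable_EFinP.
- have := @ae_off_points w1 w2 (fun z => [set: pl] z -> `|U z|%E = `|(f z)%:E|%E).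
  by apply => z h1 h2 _; rewrite fU.
Qed.

End off_points.

Section helmholtz.
Context {R : realType}.
Local Notation P := (R * R)%type.
Local Notation pl := (measurableTypeR R * measurableTypeR R)%type.
Context (D : set P) (w : P) (a : R) (u : P -> \bar R).
Context (bD : bounded_set D) (oD : open D) (Dw : D w).

(** A real function on the whole plane, with the value 0 at the pole in place of -oo. *)
Definition finite_part (z : P) : R := if `[< D z /\ z <> w >] then fine (u z) else 0.
Local Notation h := finite_part.

Context (hu : helmholtz_green_at D a w u).

Lemma finite_partE z : D z -> z <> w -> u z = (h z)%:E.
Proof.
move=> Dz zw; rewrite /finite_part asboolT//.
by have [_ /(_ z (conj Dz zw))[+ _] _ _] := hu => /fineK ->.
Qed.

Lemma finite_part_out z : ~ D z -> h z = 0.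
Proof. by move=> nDz; rewrite /finite_part asboolF// => -[]. Qed.

Lemma finite_part_continuous z : z <> w -> {for z, continuous h}.
Proof.
move=> zw; have [_ cu _ vb] := hu; have [Dz|nDz] := pselect (D z).
  have [_ cz] := cu z (conj Dz zw).
  have E : \forall y \near z, (fine \o u) y = h y.
    have n1 : \forall y \near z, D y by exact: open_nbhs_nbhs (conj oD Dz).
    apply: filterS (filterI n1 (near_neq (introN eqP zw))) => y [Dy /eqP yw].
    by rewrite /finite_part asboolT.
  apply: near_eq_continuous E _.
  move: cz; rewrite /prop_for /continuous_at finite_partE// => /fine_cvgP[_].
  by rewrite /= finite_partE.
apply/cvgrPdist_le => d d0; rewrite finite_part_out//.
have : \forall y \near z, `|h y| <= d.
  apply: (extension_small vb) => // [y Dy|y]; last exact: finite_part_out.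
  by rewrite /finite_part; case: asboolP; [right|left].
by apply: filterS => y; rewrite sub0r normrN.
Qed.

Lemma mfun_finite_part : mfun h.
Proof.
apply: (@mfun_continuous_on _ [set z | z <> w]).
- rewrite openE => z /= /eqP zw; by apply: filterS (near_neq zw) => y /eqP.
- exact: finite_part_continuous.
- by move=> z zw; rewrite /finite_part asboolF// => -[].
Qed.

(** The function is bounded by 1 off a compact subset of [D] because it vanishes on the
    boundary; on that subset it is integrable by assumption. *)
Lemma L1_finite_part : L1 h.
Proof.
have [[Lu _] _ _ vb] := hu.
pose V := ([set y | `|h y| <= 1])°.
have oV : open V by exact: open_interior.
have Vout z : ~ D z -> V z.
  move=> nDz; apply: (extension_small vb) => // [y Dy|y]; last exact: finite_part_out.
  by rewrite /finite_part; case: asboolP; [right|left].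
have cK : compact (closure D `\` V) by exact: compact_closure_diff.
set K := _ `\` _ in cK.
have KD : K `<=` D by move=> z [_ nV]; apply: contrapT => /Vout.
have mK := measurable_compact cK.
have mi : mfun (\1_K : P -> R) by exact: measurable_indic.
pose f z := \1_K z * h z.
have mf : mfun f by apply: measurable_funM => //; exact: mfun_finite_part.
have Lf : L1 f.
  apply: (@L1_off_points _ w w _ (u \_ K)) => //; last first.
    exact: ((integrable_mkcond _ mK).1 (Lu K cK KD)).
  move=> z zw _; rewrite patchE /f indicE; case: ifPn => [|_]; last by rewrite mul0r.
  by rewrite inE mul1r => /KD Dz; exact: finite_partE.
have [M M0 HM] := bounded_setE bD.
have Lb := L1_box (0 : P) (ltW M0).
apply: L1_le mfun_finite_part (L1D (L1_norm Lf) Lb) _ => z; rewrite /f indicE.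
case: (boolP (z \in K)) => [zK|]; first by rewrite mul1r lerDl; case: ifP.
rewrite notin_setE => nK; rewrite mul0r normr0 add0r subr0.
have [Dz|nDz] := pselect (D z); last by rewrite finite_part_out// normr0; case: ifP.
rewrite HM//; have Vz : V z.
  by apply: contrapT => nV; apply: nK; split => //; exact: subset_closure.
exact: (interior_subset Vz).
Qed.

Lemma finite_part_weak (c : P) (e r : R) : 0 < e -> e < r ->
  (forall y, `|y - c| < r -> D y) ->
  pint (fun y => laplacian (bump e c) y * h y) =
    bump e c w + a * pint (fun y => bump e c y * h y).
Proof.
move=> e0 er HD; have [[_ hweak] _ _ _] := hu.
have tb : test_function D (bump e c).
  by apply: test_function_bump => // y ye; apply: HD; exact: le_lt_trans er.
have [B1 _ HB1] := bounded_bump e0; have [B2 _ HB2] := bounded_laplacian_bump e0.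
have L1l := L1M_bounded (mfun_laplacian_bump c e0) (HB2 c) L1_finite_part.
have L1b := L1M_bounded (mfun_bump c e0) (HB1 c) L1_finite_part.
pose f y := laplacian (bump e c) y * h y - a * (bump e c y * h y).
have Lf : L1 f by apply: L1B => //; exact: L1Z.
have := hweak _ tb.
rewrite integral_mkcond (@integral_off_points _ w w f); first last.
- move=> z zw _; rewrite patchE /f; case: ifPn => [|]; rewrite ?inE ?notin_setE => Dz.
    by rewrite finite_partE// -EFinM; congr EFin; ring.
  by rewrite finite_part_out// !mulr0 subr0.
- exact: L1_mfun.
rewrite pintE// => -[]; rewrite /f pintB//; last exact: L1Z.
by rewrite pintZ// => <-; rewrite subrK.
Qed.

End helmholtz.

(** * The resolvent equation and its Neumann series *)

Section resolvent_expansion.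
Context {R : realType}.
Local Notation P := (R * R)%type.
Context (D : set P) (g : P -> P -> \bar R) (w : P).
Context (bD : bounded_set D) (oD : open D) (gD : laplace_green D g) (Dw : D w).

Local Notation G := (green_kernel D g).
Local Notation T := (green_potential D g).

Context (C1 C2 : R).
Context (C2_ge0 : 0 <= C2).
Context (row_int : forall z, [/\ L1 (G z), L1 (fun xi => G z xi ^+ 2),
  pint (fun xi => `|G z xi|) <= C1 & pint (fun xi => G z xi ^+ 2) <= C2]).
Context (col_int : forall xi, [/\ L1 (G^~ xi), L1 (fun z => G z xi ^+ 2),
  pint (fun z => `|G z xi|) <= C1 & pint (fun z => G z xi ^+ 2) <= C2]).

Let jG : jmfun G := jmfun_green_kernel bD oD gD.

(** The kernel of T o T is bounded, because 2 |p q| <= p^2 + q^2. *)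
Lemma green_pair z y : L1 (fun x => G z x * G x y) /\
  pint (fun x => `|G z x * G x y|) <= C2.
Proof.
have [_ r2 _ rC] := row_int z; have [_ c2 _ cC] := col_int y.
have Lm : L1 (fun x => 2^-1 * (G z x ^+ 2 + G x y ^+ 2)) by apply: L1Z; exact: L1D.
have le x : `|G z x * G x y| <= 2^-1 * (G z x ^+ 2 + G x y ^+ 2).
  rewrite normrM -[G z x ^+ 2]real_normK ?num_real// -[G x y ^+ 2]real_normK ?num_real//.
  by have := sqr_ge0 (`|G z x| - `|G x y|); move: `|_| `|_| => p q; nra.
have L : L1 (fun x => G z x * G x y).
  apply: L1_le Lm le; apply: measurable_funM; [exact: (jmfun_row z jG)|exact: (jmfun_col y jG)].
split => //; apply: (@le_trans _ _ (pint (fun x => 2^-1 * (G z x ^+ 2 + G x y ^+ 2)))).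
  by apply: pint_le => //; exact: L1_norm.
by rewrite pintZ; [rewrite pintD//; lra|exact: L1D].
Qed.

Lemma L1_green_potential (u : P -> R) : L1 u -> L1 (T u).
Proof.
move=> Lu; have [||L _ _] := @fubini_kernel _ G (fun=> 1) u C1 jG (measurable_cst _) Lu.
- by move=> y; have [Lc _ _ _] := col_int y; apply: L1_eq Lc => x; rewrite mul1r.
- move=> y; have [_ _ Hc _] := col_int y; apply: le_trans Hc.
  by rewrite le_eqVlt; apply/orP; left; apply/eqP/pint_eq => x; rewrite mul1r.
- by apply: L1_eq L => x; rewrite mul1r.
Qed.

Lemma green_potential_potential (u : P -> R) z : L1 u ->
  L1 (fun x => G z x * T u x) /\ `|T (T u) z| <= C2 * pint (fun y => `|u y|).
Proof.
move=> Lu; have [||L _ H] := @fubini_kernel _ G (G z) u C2 jG (jmfun_row z jG) Lu.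
- by move=> y; have [] := green_pair z y.
- by move=> y; have [] := green_pair z y.
- by split.
Qed.

Lemma green_potential_bounded (u : P -> R) B : mfun u -> (forall z, z <> w -> `|u z| <= B) ->
  forall z, L1 (fun x => G z x * u x) /\ `|T u z| <= C1 * B.
Proof.
move=> mu uB z.
have B0 : 0 <= B.
  have [z0 z0w] : exists z0, z0 <> w.
    exists (w.1 + 1, w.2) => /(congr1 fst) /= /eqP.
    by rewrite -subr_eq0 addrAC subrr add0r oner_eq0.
  exact: le_trans (uB z0 z0w).
have [Lr _ HC _] := row_int z.
have LB : L1 (fun x => B * `|G z x|) by apply: L1Z; exact: L1_norm.
have mGu : mfun (fun x => G z x * u x) by exact: mfun_green_integrand.
have le x : x <> w -> `|G z x * u x| <= B * `|G z x|.
  by move=> xw; rewrite normrM mulrC ler_wpM2r// uB.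
have L : L1 (fun x => G z x * u x) by exact: L1_le_off mGu LB le.
split => //; rewrite (le_trans (pint_norm L))//.
apply: (@le_trans _ _ (pint (fun x => B * `|G z x|))); last first.
  by rewrite pintZ; [rewrite mulrC ler_wpM2r|exact: L1_norm].
pose f x := if x == w then 0 else `|G z x * u x|.
have fE x : x <> w -> `|G z x * u x| = f x by move=> /eqP xw; rewrite /f (negbTE xw).
have Lf : L1 f by apply: (L1_off_point (L1_norm L) fE).
rewrite (pint_off_point (L1_mfun (L1_norm L)) fE); apply: pint_le => // x; rewrite /f.
by case: eqP => [_|]; [rewrite mulr_ge0|exact: le].
Qed.

(** In the weak sense the Laplacian of the potential is [u], by Fubini and the
    corresponding property of the kernel. *)
Lemma green_potential_weak (u : P -> R) (c : P) (e r : R) : L1 u -> 0 < e -> e < r ->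
  (forall y, `|y - c| < r -> D y) ->
  pint (fun y => laplacian (bump e c) y * T u y) = pint (fun y => bump e c y * u y).
Proof.
move=> Lu e0 er HD; have [B B0 HB] := bounded_laplacian_bump e0.
have ml := mfun_laplacian_bump c e0.
have [||_ E _] := @fubini_kernel _ G (laplacian (bump e c)) u (B * C1) jG ml Lu.
- by move=> y; have [Lc _ _ _] := col_int y; exact: L1M_bounded ml (HB c) Lc.
- move=> y; have [Lc _ Hc _] := col_int y.
  apply: (@le_trans _ _ (pint (fun x => B * `|G x y|))); last first.
    by rewrite pintZ; [rewrite ler_wpM2l|exact: L1_norm].
  apply: pint_le => [||x]; last by rewrite normrM ler_wpM2r.
  + by apply: L1_norm; exact: L1M_bounded ml (HB c) Lc.
  + by apply: L1Z; exact: L1_norm.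
rewrite [LHS]E; apply: pint_eq => y.
by rewrite (green_kernel_weak bD oD gD y e0 er HD) mulrC.
Qed.

Lemma norm_potential_green z : `|T (G^~ w) z| <= C2.
Proof. by have [L H] := green_pair z w; rewrite (le_trans (pint_norm L)). Qed.

Definition neumann_term n : P -> R := iter n T (G^~ w).

Lemma L1_neumann_term n : L1 (neumann_term n).
Proof.
elim: n => [|n IH]; first by have [] := col_int w.
exact: L1_green_potential.
Qed.

Lemma L1_green_neumann_term n z : L1 (fun x => G z x * neumann_term n x).
Proof.
case: n => [|n]; first by have [] := green_pair z w.
by have [] := green_potential_potential z (L1_neumann_term n).
Qed.

Lemma L1_sqr_bounded (f : P -> R) B : L1 f -> (forall z, `|f z| <= B) ->
  L1 (fun z => f z ^+ 2).
Proof. by move=> Lf fB; apply: L1_eq (L1M_bounded (L1_mfun Lf) fB Lf) => z; rewrite expr2. Qed.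

Lemma L1_sqr_neumann_term n : L1 (fun z => neumann_term n z ^+ 2).
Proof.
case: n => [|[|n]]; first by have [] := col_int w.
  exact: L1_sqr_bounded (L1_neumann_term 1) norm_potential_green.
apply: (@L1_sqr_bounded _ (C2 * pint (fun y => `|neumann_term n y|)) (L1_neumann_term n.+2)).
by move=> z; have [_] := green_potential_potential z (L1_neumann_term n).
Qed.

Section one_parameter.
Context (a : R) (u : P -> \bar R).
Context (hu : helmholtz_green_at D a w u).
Local Notation h := (finite_part D w u).

Let Lh : L1 h := L1_finite_part bD oD hu.

(** The difference of the two sides is weakly harmonic and vanishes outside [D]. *)
Lemma resolvent_equation z : z <> w -> h z = G z w + a * T h z.
Proof.
move=> zw; pose v y := h y - G y w - a * T h y.
have LT := L1_green_potential Lh; have [Lw _ _ _] := col_int w.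
suff : v z = 0 by rewrite /v; lra.
have Lhw : L1 (fun y => h y - G y w) by exact: L1B.
have LaT : L1 (fun y => a * T h y) by exact: L1Z.
apply: (@weakly_harmonic_eq0 R D w v bD oD Dw) => //.
- exact: L1B.
- move=> y yw.
  have ch := finite_part_continuous oD hu yw.
  have cT := green_potential_continuous bD oD gD Lh ch.
  have cG := green_kernel_continuous oD gD yw.
  apply: cvgB; first exact: (cvgB ch cG).
  by apply: cvgM; [exact: cvg_cst|exact: cT].
- move=> y nDy; rewrite /v finite_part_out// green_potential_out// green_kernel_out; last by left.
  by rewrite mulr0 !subr0.
move=> e c r e0 er HD; have [B B0 HB] := bounded_laplacian_bump e0.
have ml := mfun_laplacian_bump c e0.
have l1 := L1M_bounded ml (HB c) Lh.
have l2 := L1M_bounded ml (HB c) Lw.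
have l3 := L1M_bounded ml (HB c) LT.
rewrite (pint_eq (g := fun y => laplacian (bump e c) y * h y -
   laplacian (bump e c) y * G y w - a * (laplacian (bump e c) y * T h y))); last first.
  by move=> y; rewrite /v; ring.
rewrite (pintB (L1B l1 l2) (L1Z a l3)) (pintB l1 l2) (pintZ a l3).
rewrite (finite_part_weak bD oD hu e0 er HD) (green_kernel_weak bD oD gD w e0 er HD).
rewrite (green_potential_weak Lh e0 er HD).
by rewrite [_ + a * _]addrC addrK subrr.
Qed.

Local Notation b := (fun z => a * T h z).

Lemma L1_green_finite_part z : L1 (fun x => G z x * h x).
Proof.
have [L1' _] := green_pair z w; have [L2 _] := green_potential_potential z Lh.
apply: (@L1_off_point _ w _ _ (L1D L1' (L1Z a L2))) => x xw.
by rewrite resolvent_equation//; ring.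
Qed.

Lemma potential_resolvent_equation z : T h z = T (G^~ w) z + a * T (T h) z.
Proof.
have [L1' _] := green_pair z w; have [L2 _] := green_potential_potential z Lh.
rewrite /green_potential -(pintZ a L2) -(pintD L1' (L1Z a L2)).
apply: (@pint_off_point _ w); first exact: L1_mfun (L1_green_finite_part z).
by move=> x xw; rewrite resolvent_equation//; rewrite /green_potential; ring.
Qed.

Lemma potential_scale (v : P -> R) z c : L1 (fun x => G z x * v x) ->
  T (fun x => c * v x) z = c * T v z.
Proof. by move=> L; rewrite /green_potential -pintZ//; apply: pint_eq => x; ring. Qed.

Context (aC1 : `|a| * C1 <= 2^-1).

(** Since b = a T G_w + a T b, a bound X on |b| improves to |a| C2 + X / 2. That some bound
    exists follows from the bounded kernel of T o T. *)
Lemma correction_bound z : `|b z| <= 2 * (`|a| * C2).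
Proof.
pose N := pint (fun y => `|h y|); have N0 : 0 <= N by exact: pint_ge0.
pose X0 := `|a| * (C2 + `|a| * (C2 * N)).
have b0 x : `|b x| <= X0.
  rewrite normrM ler_wpM2l// potential_resolvent_equation.
  rewrite (le_trans (ler_normD _ _))// lerD ?norm_potential_green// normrM ler_wpM2l//.
  by have [] := green_potential_potential x Lh.
have mb : mfun b by apply: L1_mfun; apply: L1Z; exact: L1_green_potential.
have step X : (forall x, `|b x| <= X) -> forall x, `|b x| <= `|a| * C2 + 2^-1 * X.
  move=> bX x; have [Lx _] := green_potential_potential x Lh.
  have [_ HT] := green_potential_bounded mb (fun z _ => bX z) x.
  rewrite normrM potential_resolvent_equation -(potential_scale a Lx).
  apply: (@le_trans _ _ (`|a| * (C2 + C1 * X))).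
    by rewrite ler_wpM2l// (le_trans (ler_normD _ _))// lerD ?norm_potential_green.
  rewrite mulrDr lerD2l mulrA ler_wpM2r//.
  exact: le_trans (normr_ge0 _) (bX x).
pose S := [set `|b x| | x in [set: P]].
have S0 : has_sup S.
  by split; [exists `|b z|, z|exists X0 => _ [x _ <-]; exact: b0].
have hS x : `|b x| <= sup S by apply: sup_upper_bound => //; exists x.
have : sup S <= `|a| * C2 + 2^-1 * sup S.
  by apply: ge_sup; [exact: S0.1|move=> _ [x _ <-]; exact: step].
have := hS z; move: (sup S) (`|a| * C2) => s t; lra.
Qed.

(** The error is a T b, and b is of order a. *)
Lemma first_order_bound z : z <> w ->
  `|h z - G z w - a * T (G^~ w) z| <= 2 * C1 * C2 * `|a| ^+ 2.
Proof.
move=> zw; have [Lx _] := green_potential_potential z Lh.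
have mb : mfun b by apply: L1_mfun; apply: L1Z; exact: L1_green_potential.
have [_ HT] := green_potential_bounded mb (fun z _ => correction_bound z) z.
have -> : h z - G z w - a * T (G^~ w) z = a * T b z.
  rewrite resolvent_equation// (potential_scale a Lx) [T h z]potential_resolvent_equation; ring.
rewrite normrM; have -> : 2 * C1 * C2 * `|a| ^+ 2 = `|a| * (C1 * (2 * (`|a| * C2))) by ring.
by rewrite ler_wpM2l.
Qed.

Definition neumann_rest N (z : P) : R := h z - \sum_(0 <= n < N) a ^+ n * neumann_term n z.

(** Applying a T to the resolvent equation shifts every term of the series by one. *)
Lemma neumann_rest_step N z : L1 (fun x => G z x * neumann_rest N x) /\
  (z <> w -> neumann_rest N.+1 z = a * T (neumann_rest N) z).
Proof.
elim: N => [|N [L IH]].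
  have E x : neumann_rest 0 x = h x by rewrite /neumann_rest big_geq// subr0.
  have -> : neumann_rest 0 = h by exact/funext.
  split; first exact: L1_green_finite_part.
  move=> zw; rewrite /neumann_rest big_nat1 expr0 mul1r resolvent_equation//.
  by rewrite [G z w + _]addrC addrK.
have S M x : neumann_rest M.+1 x = neumann_rest M x - a ^+ M * neumann_term M x.
  by rewrite /neumann_rest big_nat_recr//= opprD addrA.
have Lt := L1Z (a ^+ N) (L1_green_neumann_term N z).
have E x : G z x * neumann_rest N x - a ^+ N * (G z x * neumann_term N x) =
    G z x * neumann_rest N.+1 x by rewrite S; ring.
split; first exact: L1_eq E (L1B L Lt).
move=> zw; rewrite S IH//.
rewrite [in RHS]/green_potential -(pint_eq E) (pintB L Lt) (pintZ _ (L1_green_neumann_term N z)).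
by rewrite /neumann_term /= /green_potential exprS; ring.
Qed.

Lemma mfun_neumann_rest N : mfun (neumann_rest N).
Proof.
elim: N => [|N IH].
  have -> : neumann_rest 0 = h.
    by apply/funext => x; rewrite /neumann_rest big_geq// subr0.
  exact: L1_mfun Lh.
have -> : neumann_rest N.+1 = fun x => neumann_rest N x - a ^+ N * neumann_term N x.
  by apply/funext => x; rewrite /neumann_rest big_nat_recr//= opprD addrA.
apply: measurable_funB => //; apply: L1_mfun; apply: L1Z; exact: L1_neumann_term.
Qed.

Lemma neumann_rest_bound N z : z <> w ->
  `|neumann_rest N.+1 z| <= 2 * (`|a| * C2) * 2^-1 ^+ N.
Proof.
elim: N z => [|N IH] z zw.
  rewrite expr0 mulr1 /neumann_rest big_nat1 expr0 mul1r resolvent_equation//.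
  by rewrite [G z w + _]addrC addrK; exact: correction_bound.
have [_ ->//] := neumann_rest_step N.+1 z.
have [_ HT] := green_potential_bounded (mfun_neumann_rest N.+1) IH z.
rewrite normrM; apply: (@le_trans _ _ (`|a| * (C1 * (2 * (`|a| * C2) * 2^-1 ^+ N)))).
  by rewrite ler_wpM2l.
have q0 : 0 <= 2 * (`|a| * C2) * 2^-1 ^+ N :> R by rewrite !mulr_ge0.
rewrite exprS [leRHS]mulrCA; move: (2 * (_ * _) * _) q0 => q q0.
by rewrite mulrA ler_wpM2r.
Qed.

Lemma L1_sqr_finite_part : L1 (fun z => h z ^+ 2).
Proof.
have [_ LG _ _] := col_int w.
have Lb := L1_sqr_bounded (L1Z a (L1_green_potential Lh)) correction_bound.
apply: (@L1_le_off _ w _ (fun z => 2 * G z w ^+ 2 + 2 * b z ^+ 2)).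
- by apply: measurable_funX; exact: L1_mfun Lh.
- by apply: L1D; apply: L1Z.
move=> z zw; rewrite ger0_norm ?sqr_ge0// resolvent_equation//.
by have := sqr_ge0 (G z w - a * T h z); move: (a * _) (G z w) => p q; nra.
Qed.

End one_parameter.
End resolvent_expansion.

(** The constants depend on the domain only, not on [a]. *)
Lemma helmholtz_neumann_expansion (R : realType) (D : set (R * R))
    (g : R * R -> R * R -> \bar R) (w : R * R) :
  bounded_set D -> open D -> laplace_green D g -> D w ->
  exists C K : R, [/\ 0 <= C, 0 <= K,
    (forall n z, L1 (fun x => green_kernel D g z x * neumann_term D g w n x)),
    (forall n, mfun (neumann_term D g w n) /\ L1 (fun z => neumann_term D g w n z ^+ 2)) &
    forall a u, helmholtz_green_at D a w u -> `|a| * C <= 2^-1 ->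
    [/\ L1 (fun z => finite_part D w u z ^+ 2),
      (forall z, z <> w -> `|finite_part D w u z - green_kernel D g z w
         - a * green_potential D g (green_kernel D g ^~ w) z| <= K * `|a| ^+ 2),
      (forall N, mfun (neumann_rest D g w a u N)) &
      (forall N z, z <> w ->
         `|neumann_rest D g w a u N.+1 z| <= 2 * (`|a| * K) * 2^-1 ^+ N)]].
Proof.
move=> bD oD gD Dw.
have [C1 [C2 [C10 C20 row_int col_int]]] := green_kernel_integrals bD oD gD.
exists C1, (2 * C1 * C2 + C2); split => //.
- by rewrite addr_ge0// !mulr_ge0.
- by move=> n z; exact: (L1_green_neumann_term w bD oD gD row_int col_int n z).
- move=> n; split; first by apply: L1_mfun; exact: (L1_neumann_term w bD oD gD col_int n).
  exact: (L1_sqr_neumann_term w bD oD gD row_int col_int n).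
move=> a u hu aC; split.
- exact: (L1_sqr_finite_part bD oD gD Dw row_int col_int hu aC).
- move=> z zw.
  apply: le_trans (first_order_bound bD oD gD Dw row_int col_int hu aC zw) _.
  by rewrite ler_wpM2r ?sqr_ge0// lerDl.
- move=> N; exact: (mfun_neumann_rest bD oD gD col_int hu N).
- move=> N z zw.
  apply: le_trans (neumann_rest_bound bD oD gD Dw C20 row_int col_int hu aC N zw) _.
  rewrite ler_wpM2r ?exprn_ge0 ?invr_ge0// ler_wpM2l// ler_wpM2l// lerDr.
  by rewrite !mulr_ge0.
Qed.

(** * Square integrability and the expansion *)

Section square_integrable.
Context {R : realType}.
Local Notation P := (R * R)%type.
Local Notation pl := (measurableTypeR R * measurableTypeR R)%type.

Lemma Lnorm2_off_point (w : P) (f : P -> R) (U : P -> \bar R) : mfun f ->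
  L1 (fun z => f z ^+ 2) -> (forall z, z <> w -> U z = (f z)%:E) ->
  ('N[area]_2%:E [U] = (Num.sqrt (pint (fun z => (f z ^+ 2)%R)))%:E)%E.
Proof.
move=> mf L2 fU; rewrite unlock.
have -> : (\int[area]_x `|U x| `^ 2 = (pint (fun z => (f z ^+ 2)%R))%:E)%E.
  rewrite -pintE//; apply: (@integral_off_points _ w w); first exact: L1_mfun.
  by move=> z zw _; rewrite fU//= powR_mulrn// real_normK// num_real.
rewrite poweR_EFin powR12_sqrt//; apply: pint_ge0 => z; exact: sqr_ge0.
Qed.

Lemma pint_le_off (w : P) (f k : P -> R) : L1 f -> L1 k ->
  (forall z, z <> w -> f z <= k z) -> pint f <= pint k.
Proof.
move=> Lf Lk fk; pose f' z := if z == w then k z else f z.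
have ff' z : z <> w -> f z = f' z by move=> /eqP zw; rewrite /f' (negbTE zw).
rewrite (pint_off_point (L1_mfun Lf) ff'); apply: pint_le (L1_off_point Lf ff') Lk _ => z.
by rewrite /f'; case: eqP => [_|]; [exact: lexx|exact: fk].
Qed.

Lemma in_L2_off_point (D : set P) (w : P) (f : P -> R) (U : P -> \bar R) : open D ->
  mfun f -> L1 (fun z => f z ^+ 2) -> (forall z, D z -> z <> w -> U z = (f z)%:E) ->
  (forall z, ~ D z -> f z = 0) -> in_L2 D U.
Proof.
move=> oD mf L2 fU f0.
have E z : z <> w -> (U \_ D) z = (f z)%:E.
  move=> zw; rewrite patchE; case: ifPn; rewrite ?inE ?notin_setE => Dz; first exact: fU.
  by rewrite f0.
split; last by rewrite (Lnorm2_off_point mf L2 E) ltry.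
apply/(measurable_restrictT _ (open_plane oD)).
by apply: (@measurable_off_points _ w w f) => // z zw _; exact: E.
Qed.

End square_integrable.

Section green_operator.
Context {R : realType}.
Local Notation P := (R * R)%type.
Context (D : set P) (g : P -> P -> \bar R) (w : P).
Context (bD : bounded_set D) (oD : open D) (gD : laplace_green D g) (Dw : D w).

Local Notation G := (green_kernel D g).
Local Notation T := (green_potential D g).

Lemma green_op_potential (phi : P -> \bar R) (u : P -> R) z : D z ->
  (forall xi, D xi -> xi <> w -> phi xi = (u xi)%:E) ->
  L1 (fun xi => G z xi * u xi) -> green_op D g phi z = (T u z)%:E.
Proof.
move=> Dz phiu L; rewrite /green_op integral_mkcond /green_potential -pintE//.
apply: (@integral_off_points _ w z); first exact: L1_mfun.
move=> xi xw xz; rewrite patchE; case: ifPn; rewrite ?inE ?notin_setE => Dxi.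
  by rewrite phiu// (green_kernelE gD)//; [rewrite -EFinM mulrC|exact: nesym].
by rewrite green_kernel_out ?mul0r//; right.
Qed.

(** For [n = 0] the iterate is the Green function itself, which is -oo at the pole. *)
Lemma iter_green_op n z :
  (forall n z, L1 (fun x => G z x * neumann_term D g w n x)) ->
  D z -> (n = 0%N -> z <> w) ->
  iter n (green_op D g) (g^~ w) z = (neumann_term D g w n z)%:E.
Proof.
move=> L; elim: n z => [|n IH] z Dz nz; first by rewrite /= (green_kernelE gD)//; exact: nz.
rewrite iterS (@green_op_potential _ (neumann_term D g w n))//.
by move=> xi Dxi xw; apply: IH.
Qed.

Lemma domain_other_point : exists z, D z /\ z <> w.
Proof.
have /nbhs_ballP[r /= r0 Hr] : nbhs w D by exact: open_nbhs_nbhs.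
exists (w.1 + r / 2, w.2); split.
  apply: Hr; split => /=; last exact: ballxx.
  by rewrite /ball /= opprD addrA subrr add0r normrN gtr0_norm; lra.
by move=> /(congr1 fst) /= h; lra.
Qed.

End green_operator.

Theorem theorem4 (R : realType) (D : set (R * R)) (w : R * R)
    (g : R * R -> R * R -> \bar R) (gs : R -> R * R -> \bar R) :
  bounded_domain D -> real_analytic_boundary D -> D w ->
  laplace_green D g ->
  (\forall a \near (0 : R), helmholtz_green_at D a w (gs a)) ->
  (ereal_sup [set (`|a|^-1%:E *
      `|gs a z - g z w - a%:E * green_op D g (g^~ w) z|)%E | z in D `\ w]
    @[a --> (0 : R)^'] --> 0%E) /\
  (\forall a \near (0 : R),
    L2_series_sum D
      (fun n z => ((a ^+ n)%:E * iter n (green_op D g) (g^~ w) z)%E) (gs a)).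
Proof.
move=> [_ oD _ bD] _ Dw gD hgs.
have [C [K [C0 K0 LGt Lt exp]]] := helmholtz_neumann_expansion bD oD gD Dw.
have small : \forall a \near (0 : R), `|a| * C <= 2^-1.
  have C1 : 0 < C + 1 by lra.
  have r0 : 0 < 2^-1 / (C + 1) by rewrite divr_gt0.
  apply/nbhs_ballP; exists (2^-1 / (C + 1)) => //= a.
  rewrite -ball_normE /= sub0r normrN ltr_pdivlMr// => /ltW; apply: le_trans.
  by rewrite ler_wpM2l// lerDl.
have good : \forall a \near (0 : R), helmholtz_green_at D a w (gs a) /\ `|a| * C <= 2^-1.
  exact: filterI hgs small.
split; last first.
  apply: filterS good => a [hu aC]; have [Lh _ mr br] := exp a (gs a) hu aC.
  have mh : mfun (finite_part D w (gs a)) by exact: (mfun_finite_part oD hu).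
  have tE n z : D z -> z <> w -> ((a ^+ n)%:E * iter n (green_op D g) (g^~ w) z)%E =
      (a ^+ n * neumann_term D g w n z)%:E.
    by move=> Dz zw; rewrite (iter_green_op gD Dw LGt).
  have t0 n z : ~ D z -> neumann_term D g w n z = 0.
    case: n => [|n] nDz; first by rewrite /neumann_term /= green_kernel_out//; left.
    exact: green_potential_out.
  split.
  - apply: (@in_L2_off_point _ D w (finite_part D w (gs a))) => //.
      by move=> z Dz zw; exact: (finite_partE hu Dz zw).
    exact: finite_part_out.
  - move=> n; have [mt Lt2] := Lt n.
    apply: (@in_L2_off_point _ D w (fun z => a ^+ n * neumann_term D g w n z)) => //.
    + exact: measurable_funM.
    + by apply: L1_eq (L1Z ((a ^+ n) ^+ 2) Lt2) => z; rewrite exprMn.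
    + by move=> z Dz zw; exact: tE.
    + by move=> z nDz; rewrite t0// mulr0.
  have [M M0 HM] := bounded_setE bD.
  pose r N := neumann_rest D g w a (gs a) N.
  pose box (y : R * R) : R := if `|y - 0| <= M then 1 else 0.
  pose k N := 2 * (`|a| * K) * 2^-1 ^+ N : R.
  have k0 N : 0 <= k N by rewrite !mulr_ge0.
  have Lb : L1 box by apply: L1_box; exact: ltW.
  have r_out N z : ~ D z -> r N z = 0.
    move=> nDz; rewrite /r /neumann_rest finite_part_out// big1 ?subrr// => n _.
    by rewrite t0// mulr0.
  have r2 N z : z <> w -> `|r N.+1 z ^+ 2| <= k N ^+ 2 * box z.
    move=> zw; rewrite /box subr0; have [Dz|nDz] := pselect (D z); last first.
      by rewrite r_out// expr0n normr0 mulr_ge0 ?sqr_ge0//; case: ifP.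
    by rewrite HM// mulr1 normrX lerXn2r ?nnegrE//; exact: br.
  have Lr N : L1 (fun z => r N.+1 z ^+ 2).
    have m2 : mfun (fun z => r N.+1 z ^+ 2) by apply: measurable_funX; exact: mr.
    exact: (L1_le_off m2 (L1Z (k N ^+ 2) Lb) (r2 N)).
  have rE N z : z <> w ->
     ((fun z => gs a z - \sum_(0 <= n < N) ((a ^+ n)%:E * iter n (green_op D g) (g^~ w) z))
       \_ D)%E z = (r N z)%:E.
    move=> zw; rewrite patchE; case: ifPn; rewrite ?inE ?notin_setE => Dz; last by rewrite r_out.
    under eq_bigr do rewrite tE//.
    by rewrite sumEFin (finite_partE hu)// -EFinB.
  pose err N := ('N[area]_2%:E [(fun z => gs a z -
     \sum_(0 <= n < N) ((a ^+ n)%:E * iter n (green_op D g) (g^~ w) z)) \_ D])%E.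
  (* The remainder of order 0 is unbounded at the pole, so the bounds start at order 1. *)
  suff H : (fun N => err N.+1) @ \oo --> 0%E.
    by move: H; rewrite -(cvg_shiftS err (nbhs 0%E)).
  have NE N : err N.+1 = _ := Lnorm2_off_point (mr N.+1) (Lr N) (@rE N.+1).
  pose s := Num.sqrt (pint box).
  apply: (@squeeze_cvge _ \oo _ R (fun=> 0%E) _ (fun N => (k N * s)%:E)); first last.
  - apply: cvg_EFin; first exact: nearW.
    have -> : (0 : R) = 2 * (`|a| * K) * 0 * s by rewrite mulr0 mul0r.
    apply: cvgM; last exact: cvg_cst.
    apply: cvgM; first exact: cvg_cst.
    by apply: cvg_expr; rewrite gtr0_norm ?invr_gt0// invf_lt1// ltr1n.
  - exact: cvg_cst.
  apply: nearW => N; rewrite Lnorm_ge0 NE lee_fin /s.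
  rewrite -[k N]ger0_norm// -sqrtr_sqr -sqrtrM ?sqr_ge0// ler_wsqrtr// -pintZ//.
  apply: (@pint_le_off _ w (fun z => r N.+1 z ^+ 2)) => //; first exact: L1Z.
  by move=> z zw; apply: le_trans (ler_norm _) (r2 N z zw).
have [z0 [Dz0 z0w]] := domain_other_point oD Dw.
have bound : \forall a \near (0 : R)^', (0 <= ereal_sup [set (`|a|^-1%:E *
      `|gs a z - g z w - a%:E * green_op D g (g^~ w) z|)%E | z in D `\ w] <= (K * `|a|)%:E)%E.
  have good' : \forall a \near (0 : R), a != 0 -> a != 0 /\ helmholtz_green_at D a w (gs a) /\ `|a| * C <= 2^-1.
    by apply: filterS good => a h.
  have : \forall a \near (0 : R)^', a != 0 /\ helmholtz_green_at D a w (gs a) /\ `|a| * C <= 2^-1.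
    exact: good'.
  apply: filterS => a [a0 [hu aC]]; have [_ fo _ _] := exp a (gs a) hu aC.
  apply/andP; split.
    apply: le_trans (_ : _ <= _)%E; last first.
      by apply: ereal_sup_ubound; exists z0.
    by rewrite mule_ge0// lee_fin invr_ge0.
  apply: ge_ereal_sup => _ [z [Dz zw] <-].
  rewrite (finite_partE hu)// (green_kernelE gD)//.
  rewrite (@green_op_potential _ D g w gD _ (green_kernel D g ^~ w))//; first last.
  + exact: (LGt 0%N z).
  + by move=> xi Dxi xw; rewrite (green_kernelE gD).
  rewrite -(EFinB (finite_part _ _ _ _)) -(EFinM a) -EFinB abse_EFin -EFinM lee_fin.
  have a1 : 0 < `|a| by rewrite normr_gt0.
  rewrite mulrC ler_pdivrMr//; have := fo z zw; by rewrite expr2 mulrA.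
apply: (squeeze_cvge bound); first exact: cvg_cst.
apply: cvg_EFin; first exact: nearW.
apply: cvg_within_filter.
have cn : {for (0 : R), continuous (fun a : R => K * `|a|)}.
  by apply: cvgM; [exact: cvg_cst|exact: norm_continuous].
by move: cn; rewrite /prop_for /continuous_at normr0 mulr0.
Qed.
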